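(* Let $R$ be a domain of characteristic $0$, let $F$ be a one-dimensional commutative formal group law over $R$, let $A$ be a generalized Cartan matrix and $\Lambda$ a Demazure lattice for its root datum, and let $S=R[[\Lambda]]_F$. For every $v\in W$ fix a reduced sequence $I_v$ of $v$. If $I_w$ and $I_w'$ are two reduced sequences of the same element $w\in W$, then in $\mathbf{D}_F$ $$X_{I_w}-X_{I_w'}=\sum_{v<w,\ \ell(v)\le\ell(w)-2}p_{w,I_v}X_{I_v}$$ for some $p_{w,I_v}\in S$, where $<$ is the Bruhat order on $W$.
   Context: Root datum: $A=(a_{ij})_{1\le i,j\le n}$ is an integer matrix with $a_{ii}=2$, $-a_{ij}\in\mathbb{Z}_{\ge 0}$ for $i\ne j$, and $a_{ij}=0\Leftrightarrow a_{ji}=0$. Let $\mathfrak{h}$ be a complex vector space of dimension $2n-\mathrm{rank}\,A$ with linearly independent subsets $\{\alpha_1,\dots,\alpha_n\}\subset\mathfrak{h}^*$ (simple roots) and $\{\alpha_1^\vee,\dots,\alpha_n^\vee\}\subset\mathfrak{h}$ (simple coroots) with $a_{ij}=\langle\alpha_j,\alpha_i^\vee\rangle$. The Weyl group $W$ is generated by $s_i(\lambda)=\lambda-\langle\lambda,\alpha_i^\vee\rangle\alpha_i$ on $\mathfrak{h}^*$; $\ell$ is its length function. The set of (real) roots is $\Phi=\{w(\alpha_i)\}$; $\Phi_+=\Phi\cap\sum_i\mathbb{Z}_{\ge0}\alpha_i$, $\Phi_-=-\Phi_+$, $\Phi=\Phi_+\amalg\Phi_-$. For $\alpha=w(\alpha_i)$,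 $s_\alpha=ws_iw^{-1}$. Demazure lattice: a finitely generated free abelian subgroup $\Lambda$ of $\mathfrak{h}^*$ containing the simple roots, with $\langle\Lambda,\alpha_i^\vee\rangle\subset\mathbb{Z}$ for all $i$, such that every simple root can be extended to a $\mathbb{Z}$-basis of $\Lambda$. It is $W$-invariant. Formal group algebra: $S=R[[\Lambda]]_F=R[[x_\lambda\mid\lambda\in\Lambda]]/J$, where $R[[x_\lambda\mid\lambda\in\Lambda]]$ is the completion of the polynomial ring at the kernel of $x_\lambda\mapsto0$, and $J$ is the closure of the ideal generated by $x_0$ and $x_{\lambda+\mu}-F(x_\lambda,x_\mu)$, $\lambda,\mu\in\Lambda$. $W$ acts on $S$ by $w(x_\lambda)=x_{w(\lambda)}$. Twisted group algebra: $Q=S[\frac1{x_\alpha}\mid\alpha\in\Phi_+]$; $Q_W$ is the left $Q$-module with basis $\{\delta_w\}_{w\in W}$ and product $q\delta_w\cdot q'\delta_{w'}=qw(q')\delta_{ww'}$; $\delta_e=1$, $\delta_\alpha=\delta_{s_\alpha}$. Formal Demazure elements: $X_\alpha=\frac1{x_\alpha}(1-\delta_\alpha)\in Q_W$, $X_i=X_{\alpha_i}$. For a sequence $I=(i_1,\dots,i_l)$ in $\{1,\dots,n\}$, $X_I=X_{i_1}\cdots X_{i_l}$, $X_\emptyset=1$. A reduced sequence of $v\in W$ is $(i_1,\dots,i_l)$ with $v=s_{i_1}\cdots s_{i_l}$ and $l=\ell(v)$. The formal affine Demazure algebra $\mathbf{D}_F$ is the $R$-subalgebra of $Q_W$ generated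 by the elements of $S$ and all $X_\alpha$, $\alpha\in\Phi$. *)

(* Defs.v *)
From HB Require Import structures.
From mathcomp Require Import all_boot all_order all_algebra.
From mathcomp Require Import boolp classical_sets functions fsbigop.
From mathcomp Require Import reals complex.
From mathcomp Require Import finmap monalg ring.

Set Implicit Arguments.
Unset Strict Implicit.
Unset Printing Implicit Defensive.

Import Order.TTheory GRing.Theory Num.Theory.

Local Open Scope classical_set_scope.
Local Open Scope ring_scope.
Local Open Scope quotient_scope.

Section Ideals.
Variable A : comNzRingType.

Definition ideal_gen (G : set A) : set A :=
  [set a | exists2 s : seq (A * A),
     (forall p, p \in s -> G p.2) & a = \sum_(p <- s) p.1 * p.2].

Fixpoint ideal_pow (I : set A) (k : nat) : set A :=
  if k is k'.+1 then
    ideal_gen [set a | exists x y, [/\ I x, ideal_pow I k' y & a = x * y]]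
  else setT.

Lemma ideal_gen0 G : ideal_gen G 0.
Proof. by exists [::]; rewrite ?big_nil. Qed.

Lemma ideal_genD G a b : ideal_gen G a -> ideal_gen G b -> ideal_gen G (a + b).
Proof.
move=> [s sG ->] [t tG ->]; exists (s ++ t); last by rewrite big_cat.
by move=> p; rewrite mem_cat => /orP[/sG|/tG].
Qed.

Lemma ideal_genM G a b : ideal_gen G b -> ideal_gen G (a * b).
Proof.
move=> [s sG ->]; exists [seq (a * p.1, p.2) | p <- s].
  by move=> p /mapP[q qs ->]; apply: sG qs.
by rewrite big_map mulr_sumr; apply: eq_bigr => p _; rewrite mulrA.
Qed.

Lemma ideal_gen_sub G a : G a -> ideal_gen G a.
Proof.
move=> Ga; exists [:: (1, a)]; last by rewrite big_seq1 mul1r.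
by move=> p; rewrite inE => /eqP->.
Qed.

Lemma ideal_gen_le G (P : set A) : P 0 ->
  (forall a b, P a -> P b -> P (a + b)) -> (forall a b, P b -> P (a * b)) ->
  G `<=` P -> ideal_gen G `<=` P.
Proof.
move=> P0 PD PM GP a [s sG ->]; rewrite big_seq.
by apply: (big_ind P) => // p ps; apply/PM/GP/sG.
Qed.

Lemma ideal_pow0 I k : ideal_pow I k 0.
Proof. by case: k => //= k; apply: ideal_gen0. Qed.

Lemma ideal_powD I k a b :
  ideal_pow I k a -> ideal_pow I k b -> ideal_pow I k (a + b).
Proof. by case: k => //= k; apply: ideal_genD. Qed.

Lemma ideal_powM I k a b : ideal_pow I k b -> ideal_pow I k (a * b).
Proof. by case: k => //= k; apply: ideal_genM. Qed.

Lemma ideal_powMr I k a b : ideal_pow I k a -> ideal_pow I k (a * b).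
Proof. by rewrite mulrC; apply: ideal_powM. Qed.

Lemma ideal_powN I k a : ideal_pow I k a -> ideal_pow I k (- a).
Proof. by rewrite -mulN1r; apply: ideal_powM. Qed.

Lemma ideal_powB I k a b :
  ideal_pow I k a -> ideal_pow I k b -> ideal_pow I k (a - b).
Proof. by move=> ? /ideal_powN; apply: ideal_powD. Qed.

Lemma ideal_pow_sum I k (T : Type) (r : seq T) (P : pred T) (f : T -> A) :
  (forall i, P i -> ideal_pow I k (f i)) ->
  ideal_pow I k (\sum_(i <- r | P i) f i).
Proof.
move=> If; apply: (big_ind (ideal_pow I k)) => //; first exact: ideal_pow0.
by move=> x y; apply: ideal_powD.
Qed.

Lemma ideal_powS I k a b : I a -> ideal_pow I k b -> ideal_pow I k.+1 (a * b).
Proof. by move=> Ia Ib /=; apply: ideal_gen_sub; exists a, b. Qed.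

Lemma ideal_powMX I k a b m :
  I a -> ideal_pow I k b -> ideal_pow I (m + k) (a ^+ m * b).
Proof.
move=> Ia Ib; elim: m => [|m IHm]; first by rewrite mul1r.
by rewrite addSn exprS -mulrA; apply: ideal_powS.
Qed.

Lemma ideal_pow_leS I k : ideal_pow I k.+1 `<=` ideal_pow I k.
Proof.
apply: ideal_gen_le => [|a b|a b|_ [x [y [_ Iy ->]]]].
- exact: ideal_pow0.
- exact: ideal_powD.
- exact: ideal_powM.
- exact: ideal_powM.
Qed.

Lemma ideal_pow_le I k l : (k <= l)%N -> ideal_pow I l `<=` ideal_pow I k.
Proof.
elim: l => [|l IHl]; first by rewrite leqn0 => /eqP->.
rewrite leq_eqVlt => /predU1P[->//|]; rewrite ltnS => /IHl; apply: subset_trans.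
exact: ideal_pow_leS.
Qed.

Lemma ideal_pow1 (I : idealr A) : ideal_pow [set` I] 1 `<=` [set` I].
Proof.
apply: ideal_gen_le => /= [|a b|a b|_ [x [y [Ix _ ->]]]].
- exact: idealr0.
- exact: rpredD.
- exact: idealMr.
- by rewrite mulrC; exact: idealMr.
Qed.

End Ideals.

Section IdealMorphism.
Variables (A B : comNzRingType) (f : {rmorphism A -> B}).

Lemma ideal_gen_morph (G : set A) (H : set B) :
  (forall a, G a -> H (f a)) -> forall a, ideal_gen G a -> ideal_gen H (f a).
Proof.
move=> GH a [s sG ->]; rewrite rmorph_sum.
exists [seq (f p.1, f p.2) | p <- s].
  by move=> p /mapP[q qs ->]; apply/GH/sG.
by rewrite big_map; apply: eq_bigr => p _; rewrite rmorphM.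
Qed.

Lemma ideal_pow_morph (I : set A) (J : set B) k :
  (forall a, I a -> J (f a)) -> forall a, ideal_pow I k a -> ideal_pow J k (f a).
Proof.
move=> IJ; elim: k => //= k IHk; apply: ideal_gen_morph => _ [x [y [Ix Iy ->]]].
by exists (f x), (f y); split; [apply: IJ|apply: IHk|rewrite rmorphM].
Qed.

End IdealMorphism.

Section QuotientMap.
Variables (A B : comNzRingType) (I : idealr A) (J : idealr B).
Variable f : {rmorphism A -> B}.
Hypothesis IJ : forall a, a \in I -> f a \in J.

Definition quot_map of (forall a, a \in I -> f a \in J) :
    {ideal_quot I} -> {ideal_quot J} :=
  fun z => \pi_({ideal_quot J})%qT (f (repr z)).

Lemma quot_mapE a :
  quot_map IJ (\pi_({ideal_quot I})%qT a) = \pi_({ideal_quot J})%qT (f a).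
Proof.
apply/eqP; rewrite -Quotient.idealrBE -rmorphB; apply: IJ.
by rewrite Quotient.idealrBE reprK.
Qed.

Fact quot_map_zmod : zmod_morphism (quot_map IJ).
Proof.
move=> x y; rewrite -[x]reprK -[y]reprK -rmorphB.
by rewrite !quot_mapE !rmorphB.
Qed.

Fact quot_map_monoid : monoid_morphism (quot_map IJ).
Proof.
split=> [|x y].
  by rewrite -[X in quot_map _ X](rmorph1 \pi_({ideal_quot I})%qT) quot_mapE !rmorph1.
by rewrite -[x]reprK -[y]reprK -rmorphM !quot_mapE !rmorphM.
Qed.

HB.instance Definition _ := GRing.isZmodMorphism.Build _ _ (quot_map IJ)
  quot_map_zmod.
HB.instance Definition _ := GRing.isMonoidMorphism.Build _ _ (quot_map IJ)
  quot_map_monoid.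

End QuotientMap.

(** The completion of [A] at [I] is the inverse limit of the rings [A / I^k].
    An element is given by a sequence of representatives [u k] modulo [I^k],
    with [u k.+1 = u k] modulo [I^k]; two sequences are identified when they
    agree modulo [I^k] for all [k]. *)
Section Completion.
Variables (A : comNzRingType) (I : idealr A).
Local Notation "I ^^ k" := (ideal_pow [set` I] k) (at level 30).

Definition coherent : pred (nat -> A) :=
  fun u => `[< forall k, (I ^^ k) (u k.+1 - u k) >].

Lemma coherentP u : reflect (forall k, (I ^^ k) (u k.+1 - u k)) (u \in coherent).
Proof. exact: asboolP. Qed.

Fact coherent_subring : subring_closed coherent.
Proof.
split=> [|u v /coherentP Iu /coherentP Iv|u v /coherentP Iu /coherentP Iv];
  apply/coherentP => k.
- by rewrite /= subrr; apply: ideal_pow0.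
- have -> : (u - v) k.+1 - (u - v) k = (u k.+1 - u k) - (v k.+1 - v k).
    by rewrite !fctE !opprD !opprK addrACA.
  exact: ideal_powB.
- have -> : (u * v) k.+1 - (u * v) k =
      u k.+1 * (v k.+1 - v k) + (u k.+1 - u k) * v k.
    by rewrite !fctE /= mulrBr mulrBl addrA subrK.
  by apply: ideal_powD; [apply: ideal_powM|apply: ideal_powMr].
Qed.
HB.instance Definition _ := GRing.isSubringClosed.Build _ coherent
  coherent_subring.

Definition coherent_seq : Type := {u : nat -> A | u \in coherent}.
Definition CoherentSeq u (cu : u \in coherent) : coherent_seq :=
  exist (fun u => is_true (u \in coherent)) u cu.
HB.instance Definition _ := SubChoice.on coherent_seq.
HB.instance Definition _ :=
  [SubChoice_isSubComNzRing of coherent_seq by <:].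

Definition null_seq : pred coherent_seq :=
  fun u => `[< forall k, (I ^^ k) (val u k) >].

Lemma null_seqP u : reflect (forall k, (I ^^ k) (val u k)) (u \in null_seq).
Proof. exact: asboolP. Qed.

Fact null_seq_ideal : idealr_closed null_seq.
Proof.
split=> [||a u v /null_seqP Iu /null_seqP Iv]; try apply/null_seqP.
- by move=> k; rewrite raddf0; apply: ideal_pow0.
- move=> /(_ 1%N) /(@ideal_pow1 A I).
  by rewrite rmorph1 /= idealr1.
- move=> k; rewrite rmorphD rmorphM.
  by apply: ideal_powD => //; apply: ideal_powM.
Qed.
HB.instance Definition _ := isIdealr.Build _ null_seq null_seq_ideal.
Definition null_ideal : idealr coherent_seq := null_seq.

Definition completion : comNzRingType := {ideal_quot null_ideal}.

Fact const_coherent (a : A) : (fun _ => a) \in coherent.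
Proof. by apply/coherentP => k; rewrite subrr; apply: ideal_pow0. Qed.

Definition to_completion (a : A) : completion :=
  \pi_({ideal_quot null_ideal})%qT (CoherentSeq (const_coherent a)).

(** The closure of [J] for the topology given by the kernels of
    [completion -> A / I^k]. *)
Definition adic_closure (J : set completion) : set completion :=
  [set z | forall k, exists2 y, J y &
     exists2 u : coherent_seq, z - y = \pi_({ideal_quot null_ideal})%qT u &
       (I ^^ k) (val u k)].

End Completion.

Section CompletionMap.
Variables (A B : comNzRingType) (I : idealr A) (J : idealr B).
Variable f : {rmorphism A -> B}.
Hypothesis IJ : forall a, a \in I -> f a \in J.

Fact coherent_map_subproof (u : coherent_seq I) : f \o val u \in coherent J.
Proof.
apply/coherentP => k /=; rewrite -rmorphB.
apply: (@ideal_pow_morph _ _ f [set` I] [set` J]) => //.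
by have /coherentP := valP u.
Qed.

Definition coherent_map (u : coherent_seq I) : coherent_seq J :=
  CoherentSeq (coherent_map_subproof u).

Fact coherent_map_zmod : zmod_morphism coherent_map.
Proof. by move=> u v; apply/val_inj/funext => k; rewrite /= rmorphB. Qed.

Fact coherent_map_monoid : monoid_morphism coherent_map.
Proof.
by split=> [|u v]; apply/val_inj/funext => k; rewrite /= ?rmorph1 ?rmorphM.
Qed.

HB.instance Definition _ := GRing.isZmodMorphism.Build _ _ coherent_map
  coherent_map_zmod.
HB.instance Definition _ := GRing.isMonoidMorphism.Build _ _ coherent_map
  coherent_map_monoid.

Fact coherent_map_null u :
  u \in null_ideal I -> coherent_map u \in null_ideal J.
Proof.
move=> /null_seqP Iu; apply/null_seqP => k /=.
exact: (@ideal_pow_morph _ _ f [set` I] [set` J]).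
Qed.

Definition completion_map : {rmorphism completion I -> completion J} :=
  quot_map coherent_map_null.

Lemma completion_mapE a :
  completion_map (to_completion I a) = to_completion J (f a).
Proof.
rewrite /completion_map /= quot_mapE.
by congr (\pi_(_)%qT _); apply: val_inj.
Qed.

Lemma adic_closure_map (G : set (completion I)) (H : set (completion J)) :
  (forall z, G z -> H (completion_map z)) ->
  forall z, adic_closure G z -> adic_closure H (completion_map z).
Proof.
move=> GH z Gz k; have [y Gy [u zy uk]] := Gz k.
exists (completion_map y); first exact: GH.
exists (coherent_map u); first by rewrite -rmorphB zy /completion_map /= quot_mapE.
exact: (@ideal_pow_morph _ _ f [set` I] [set` J]).
Qed.

End CompletionMap.

Notation polyring R L := {malg R[{cmonom L}]}.

HB.lock Definition polyvar (R : comNzRingType) (L : choiceType) (l : L) :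
  polyring R L := << ucm l >>.
Arguments polyvar R {L} l.

Section Polynomials.
Variables (R : comNzRingType) (L : choiceType).
Local Notation polyring := (polyring R L).

(** [mcoeff mone] is the morphism of [R]-algebras [polyring -> R] that sends all
    variables to 0. *)
Definition augmentation : pred polyring := fun p => mcoeff (mone : {cmonom L}) p == 0.

Fact augmentation_ideal : idealr_closed augmentation.
Proof.
split; rewrite ?unfold_in /augmentation ?raddf0 ?eqxx //.
  by rewrite rmorph1 oner_eq0.
move=> a u v; rewrite !unfold_in /augmentation => /eqP u0 /eqP v0.
by rewrite rmorphD rmorphM /= u0 v0 mulr0 addr0.
Qed.
HB.instance Definition _ := isIdealr.Build _ augmentation augmentation_ideal.
Definition aug_ideal : idealr polyring := augmentation.

Lemma polyvar_coef0 l : mcoeff (mone : {cmonom L}) (polyvar R l) = 0.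
Proof. by rewrite polyvar.unlock mcoeffU cm1_eq1. Qed.

Lemma polyvar_aug l : polyvar R l \in aug_ideal.
Proof. by rewrite unfold_in /= /augmentation polyvar_coef0. Qed.

End Polynomials.

Section RenameMonom.
Variables (R : comNzRingType) (L M : choiceType) (g : L -> M).

Definition rename_monom (m : {cmonom L}) : polyring R M :=
  \prod_(l <- finsupp m) polyvar R (g l) ^+ m l.

Lemma rename_monomEw (m : {cmonom L}) (d : {fset L}) :
  (finsupp m `<=` d)%fset ->
  rename_monom m = \prod_(l <- d) polyvar R (g l) ^+ m l.
Proof.
move=> md; rewrite /rename_monom (big_fset_incl _ md) // => l _.
by rewrite -cmE_neq0 negbK => /eqP->; rewrite expr0.
Qed.

Fact rename_monom_morph : mmorphism rename_monom.
Proof.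
split=> [m1 m2|]; last by rewrite /rename_monom mdom1 big_seq_fset0.
rewrite {1}/rename_monom mdomD.
rewrite (rename_monomEw (fsubsetUl (finsupp m1) (finsupp m2))).
rewrite (rename_monomEw (fsubsetUr (finsupp m1) (finsupp m2))).
by rewrite -big_split /=; apply: eq_bigr => l _; rewrite cmM exprD.
Qed.
HB.instance Definition _ :=
  monalg.isMultiplicative.Build _ _ rename_monom rename_monom_morph.

End RenameMonom.

HB.lock Definition rename (R : comNzRingType) (L M : choiceType) (g : L -> M)
  (p : polyring R L) : polyring R M := mmap malgC (@rename_monom R L M g) p.

Section Rename.
Variables (R : comNzRingType) (L M : choiceType) (g : L -> M).
Local Notation rename := (@rename R L M g).

Fact rename_zmod : zmod_morphism rename.
Proof. by move=> p q; rewrite rename.unlock rmorphB. Qed.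

Fact rename_monoid : monoid_morphism rename.
Proof. by split=> [|p q]; rewrite rename.unlock ?rmorph1 ?rmorphM. Qed.

HB.instance Definition _ := GRing.isZmodMorphism.Build _ _ rename rename_zmod.
HB.instance Definition _ :=
  GRing.isMonoidMorphism.Build _ _ rename rename_monoid.

Lemma rename_var l : rename (polyvar R l) = polyvar R (g l).
Proof.
rewrite rename.unlock !polyvar.unlock mmapU /= mpolyC1E mul1r.
by rewrite /rename_monom mdomU big_seq_fset1 cmUU polyvar.unlock.
Qed.

Lemma rename_const c : rename c%:MP = c%:MP.
Proof. by rewrite rename.unlock; exact: mmapC. Qed.

Lemma rename_aug p : p \in aug_ideal R L -> rename p \in aug_ideal R M.
Proof.
rewrite !unfold_in /= /augmentation => /eqP p0.
rewrite rename.unlock mmapE raddf_sum big_seq big1 //= => m mp.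
have m1 : m != mone by apply: contraTneq mp => ->; rewrite -mcoeff_neq0 p0 eqxx.
have /fset0Pn[l lm] : (finsupp m != fset0)%fset.
  apply: contraNneq m1 => mE; apply/eqP/eqP/cmP => i.
  by rewrite cm1; apply/eqP; rewrite cmE_eq0 mE in_fset0.
rewrite rmorphM /= /rename_monom (big_fsetD1 l) //= rmorphM rmorphXn /=.
have ml : (m l == 0%N) = false by apply: negbTE; rewrite cmE_neq0.
by rewrite polyvar_coef0 expr0n ml mul0r mulr0.
Qed.

End Rename.

(** The part of degree [< k] in each variable of [F(a, b)], where [F i j] is the
    coefficient of [u^i v^j] in [F(u, v)]. *)
Definition fgl_trunc (R : comNzRingType) (L : choiceType) (F : nat -> nat -> R)
    (k : nat) (a b : polyring R L) : polyring R L :=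
  \sum_(i < k) \sum_(j < k) (F i j)%:MP * a ^+ i * b ^+ j.

(** Associativity is the identity [F(F(u, v), w) = F(u, F(v, w))] of power series
    in three variables, stated modulo [(u, v, w)^k] for every [k]. *)
Record formal_group_law (R : comNzRingType) := FormalGroupLaw {
  fgl_coef :> nat -> nat -> R;
  fgl_x0 : forall i, fgl_coef i 0 = (i == 1%N)%:R;
  fgl_0x : forall j, fgl_coef 0 j = (j == 1%N)%:R;
  fgl_comm : forall i j, fgl_coef i j = fgl_coef j i;
  fgl_assoc : forall k,
    let F := fgl_trunc (L := 'I_3) fgl_coef k in
    let u := polyvar R 0 in let v := polyvar R 1 in let w := polyvar R 2 in
    ideal_pow [set` aug_ideal R 'I_3] k (F (F u v) w - F u (F v w))
}.

Section FormalGroupAlgebra.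
Variables (R : comNzRingType) (F : formal_group_law R).

Section Def.
Variable L : zmodType.
Local Notation P := (polyring R L).
Local Notation I := (aug_ideal R L).

Definition power_series : comNzRingType := completion I.

Definition psvar (l : L) : power_series := to_completion I (polyvar R l).

Fact fgl_eval_coherent (l m : L) :
  (fun k => fgl_trunc F k (polyvar R l) (polyvar R m)) \in coherent I.
Proof.
apply/coherentP => k; rewrite /fgl_trunc.
pose t i j : P := (F i j)%:MP * polyvar R l ^+ i * polyvar R m ^+ j.
have tk i j : (k <= i + j)%N -> ideal_pow [set` I] k (t i j).
  move=> kij; apply: (ideal_pow_le kij).
  rewrite /t -mulrA; apply: ideal_powM; apply: ideal_powMX.
    exact: polyvar_aug.
  rewrite -[X in X ^+ _ ]mulr1 -[j in ideal_pow _ j _]addn0 mulr1.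
  rewrite -[X in ideal_pow _ _ X]mulr1; apply: ideal_powMX => //.
  exact: polyvar_aug.
have -> : \sum_(i < k.+1) \sum_(j < k.+1) t i j - \sum_(i < k) \sum_(j < k) t i j
    = \sum_(i < k) t i k + \sum_(j < k.+1) t k j.
  rewrite big_ord_recr addrAC -sumrB; congr (_ + _).
  by apply: eq_bigr => i _; rewrite big_ord_recr addrC addKr.
apply: ideal_powD; apply: ideal_pow_sum => i _; apply: tk.
  exact: leq_addl.
exact: leq_addr.
Qed.

(** [F(x_l, x_m)]: the limit of the truncations [fgl_trunc F k] *)
Definition fgl_eval (l m : L) : power_series :=
  \pi_({ideal_quot null_ideal I})%qT (CoherentSeq (fgl_eval_coherent l m)).

Definition fga_relations : set power_series :=
  [set z | z = psvar 0 \/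
           exists l m, z = psvar (l + m) - fgl_eval l m].

Definition fga_pred : pred power_series :=
  fun z => `[< adic_closure (ideal_gen fga_relations) z >].

Let const0 : set power_series :=
  [set z | exists2 u : coherent_seq I,
     z = \pi_({ideal_quot null_ideal I})%qT u & val u 1%N \in I].

Let const0D a b : const0 a -> const0 b -> const0 (a + b).
Proof.
move=> [u -> u1] [v -> v1]; exists (u + v); first by rewrite rmorphD.
by rewrite rmorphD /= rpredD.
Qed.

Let const0M a b : const0 b -> const0 (a * b).
Proof.
rewrite -[a]reprK => -[u -> u1].
by exists (repr a * u); rewrite ?rmorphM //= idealMr.
Qed.

Let const0_relations : fga_relations `<=` const0.
Proof.
have var0 l : const0 (psvar l).
  by exists (CoherentSeq (const_coherent I (polyvar R l))) => //=;
     exact: polyvar_aug.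
move=> _ [->|[l [m ->]]]; first exact: var0.
apply: const0D => //; rewrite -mulN1r; apply: const0M.
exists (CoherentSeq (fgl_eval_coherent l m)) => //=.
rewrite /fgl_trunc !big_ord1 fgl_x0 /= mpolyC_nat mulr0n !mul0r.
exact: idealr0.
Qed.

Fact fga_ideal_closed : idealr_closed fga_pred.
Proof.
split=> [||a z1 z2 /asboolP J1 /asboolP J2].
- apply/asboolP => k; exists 0; first exact: ideal_gen0.
  by exists 0; rewrite ?subrr ?rmorph0 //=; apply: ideal_pow0.
- apply/asboolP => /(_ 1%N) [y Jy [u yu u1]].
  have : const0 1.
    rewrite -(subrK y 1); apply: const0D.
      by exists u => //; apply: (@ideal_pow1 _ I).
    apply: (ideal_gen_le _ const0D const0M const0_relations) Jy.
    by exists 0; rewrite ?rmorph0 //=; apply: idealr0.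
  move=> [v /eqP]; rewrite -[X in X == _](rmorph1 \pi_({ideal_quot null_ideal I})%qT).
  rewrite -Quotient.idealrBE => /null_seqP /(_ 1%N) /(@ideal_pow1 _ I).
  rewrite rmorphB rmorph1 /= => v1 v1'.
  have : (1 : polyring R L) \in I by rewrite -(subrK (val v 1%N) 1) rpredD.
  by rewrite idealr1.
- apply/asboolP => k; have [y1 Jy1 [u1 E1 U1]] := J1 k.
  have [y2 Jy2 [u2 E2 U2]] := J2 k.
  exists (a * y1 + y2); first by apply: ideal_genD => //; apply: ideal_genM.
  exists (repr a * u1 + u2).
    by rewrite rmorphD rmorphM /= -E1 -E2 reprK mulrBr opprD addrACA.
  by rewrite rmorphD rmorphM /=; apply: ideal_powD => //; apply: ideal_powM.
Qed.
HB.instance Definition _ := isIdealr.Build _ fga_pred fga_ideal_closed.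
Definition fga_ideal : idealr power_series := fga_pred.

Definition formal_group_algebra : comNzRingType := {ideal_quot fga_ideal}.

Definition fga_var (l : L) : formal_group_algebra :=
  \pi_({ideal_quot fga_ideal})%qT (psvar l).

End Def.

Section Map.
Variables (L M : zmodType) (g : {additive L -> M}).

Let ps_map : {rmorphism power_series L -> power_series M} :=
  completion_map (@rename_aug R L M g).

Let ps_map_var l : ps_map (psvar l) = psvar (g l).
Proof. by rewrite /ps_map completion_mapE /= rename_var. Qed.

Let ps_map_eval l m : ps_map (fgl_eval l m) = fgl_eval (g l) (g m).
Proof.
rewrite /ps_map /completion_map /= quot_mapE; congr (\pi_(_)%qT _).
apply/val_inj/funext => k /=; rewrite /fgl_trunc rmorph_sum.
apply: eq_bigr => i _; rewrite rmorph_sum; apply: eq_bigr => j _.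
by rewrite !rmorphM !rmorphXn /= !rename_var rename_const.
Qed.

Fact fga_map_subproof z : z \in fga_ideal L -> ps_map z \in fga_ideal M.
Proof.
move=> /asboolP Jz; apply/asboolP; apply: adic_closure_map Jz => {}z.
apply: ideal_gen_morph => _ [->|[l [m ->]]].
  by left; rewrite ps_map_var raddf0.
by right; exists (g l), (g m); rewrite rmorphB ps_map_var ps_map_eval raddfD.
Qed.

Definition fga_map :
    {rmorphism formal_group_algebra L -> formal_group_algebra M} :=
  quot_map fga_map_subproof.

Lemma fga_map_var l : fga_map (fga_var l) = fga_var (g l).
Proof. by rewrite /fga_map /fga_var /= quot_mapE ps_map_var. Qed.

End Map.
End FormalGroupAlgebra.

Section Localization.
Variables (S : comNzRingType) (G : set S).

Definition mul_gen : set S :=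
  [set m | exists2 s : seq S, (forall a, a \in s -> G a) & m = \prod_(a <- s) a].

Lemma mul_gen1 : mul_gen 1.
Proof. by exists [::]; rewrite ?big_nil. Qed.

Lemma mul_genM a b : mul_gen a -> mul_gen b -> mul_gen (a * b).
Proof.
move=> [s sG ->] [t tG ->]; exists (s ++ t); last by rewrite big_cat.
by move=> c; rewrite mem_cat => /orP[/sG|/tG].
Qed.

Lemma mul_gen_sub a : G a -> mul_gen a.
Proof.
move=> Ga; exists [:: a]; last by rewrite big_seq1.
by move=> c; rewrite inE => /eqP->.
Qed.

Definition denominator : Type := {m : S | `[< mul_gen m >]}.
HB.instance Definition _ := SubChoice.on denominator.
Definition Denominator m (Gm : mul_gen m) : denominator :=
  exist (fun m => is_true `[< mul_gen m >]) m (asboolT Gm).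

Lemma denominatorP (m : denominator) : mul_gen (val m).
Proof. exact: asboolW (valP m). Qed.

Definition den1 := Denominator mul_gen1.
Definition denM (m n : denominator) :=
  Denominator (mul_genM (denominatorP m) (denominatorP n)).

Definition fraction : Type := (S * denominator)%type.
HB.instance Definition _ := Choice.on fraction.

Definition fraction_equiv (p q : fraction) : bool :=
  `[< exists2 u, mul_gen u & u * (p.1 * val q.2 - q.1 * val p.2) = 0 >].

Fact fraction_equiv_is_equiv : equiv_class_of fraction_equiv.
Proof.
split=> [p|p q|q p r].
- by apply/asboolP; exists 1; [exact: mul_gen1|rewrite subrr mulr0].
- by apply: asbool_equiv_eq; split=> -[u Gu E]; exists u => //;
     rewrite -opprB mulrN E oppr0.
- move=> /asboolP[u Gu E] /asboolP[v Gv E']; apply/asboolP.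
  exists (u * v * val q.2).
    by do 2?apply: mul_genM => //; apply: denominatorP.
  transitivity (v * val r.2 * (u * (p.1 * val q.2 - q.1 * val p.2)) +
    u * val p.2 * (v * (q.1 * val r.2 - r.1 * val q.2))); first by ring.
  by rewrite E E' !mulr0 addr0.
Qed.

Canonical fraction_equiv_rel := EquivRelPack fraction_equiv_is_equiv.
Canonical fraction_enc := defaultEncModRel fraction_equiv.

(** The ring of fractions [S[1/m | m in G]]; it is trivial if [0] is a product of
    elements of [G]. *)
Definition localization := {eq_quot fraction_equiv}.
HB.instance Definition _ := Choice.on localization.
HB.instance Definition _ : EqQuotient fraction fraction_equiv localization :=
  EqQuotient.on localization.

Local Notation pi := (\pi_localization)%qT.

Lemma fraction_eqP p q :
  pi p = pi q <->
  exists2 u, mul_gen u & u * (p.1 * val q.2 - q.1 * val p.2) = 0.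
Proof. by split=> [/eqmodP/asboolP|E]; [|apply/eqmodP/asboolP]. Qed.

Lemma fraction_eq (p q : fraction) :
  p.1 * val q.2 = q.1 * val p.2 -> pi p = pi q.
Proof.
move=> E; apply/fraction_eqP; exists 1; first exact: mul_gen1.
by rewrite E subrr mulr0.
Qed.

Definition fadd (p q : fraction) : fraction :=
  (p.1 * val q.2 + q.1 * val p.2, denM p.2 q.2).
Definition fmul (p q : fraction) : fraction := (p.1 * q.1, denM p.2 q.2).
Definition fopp (p : fraction) : fraction := (- p.1, p.2).

Definition loc_add (x y : localization) : localization :=
  pi (fadd (repr x) (repr y)).
Definition loc_mul (x y : localization) : localization :=
  pi (fmul (repr x) (repr y)).
Definition loc_opp (x : localization) : localization := pi (fopp (repr x)).

Lemma loc_addE p q : loc_add (pi p) (pi q) = pi (fadd p q).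
Proof.
apply/fraction_eqP.
have /fraction_eqP[u Gu E] : pi (repr (pi p)) = pi p by rewrite reprK.
have /fraction_eqP[v Gv E'] : pi (repr (pi q)) = pi q by rewrite reprK.
exists (u * v); first exact: mul_genM.
move: (repr (pi p)) (repr (pi q)) E E' => p' q' E E'; rewrite /fadd /=.
transitivity (v * val q.2 * val q'.2 * (u * (p'.1 * val p.2 - p.1 * val p'.2)) +
  u * val p.2 * val p'.2 * (v * (q'.1 * val q.2 - q.1 * val q'.2))).
  by rewrite /=; ring.
by rewrite E E' !mulr0 addr0.
Qed.

Lemma loc_mulE p q : loc_mul (pi p) (pi q) = pi (fmul p q).
Proof.
apply/fraction_eqP.
have /fraction_eqP[u Gu E] : pi (repr (pi p)) = pi p by rewrite reprK.
have /fraction_eqP[v Gv E'] : pi (repr (pi q)) = pi q by rewrite reprK.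
exists (u * v); first exact: mul_genM.
move: (repr (pi p)) (repr (pi q)) E E' => p' q' E E'; rewrite /fmul /=.
transitivity (v * q'.1 * val q.2 * (u * (p'.1 * val p.2 - p.1 * val p'.2)) +
  u * p.1 * val p'.2 * (v * (q'.1 * val q.2 - q.1 * val q'.2))).
  by rewrite /=; ring.
by rewrite E E' !mulr0 addr0.
Qed.

Lemma loc_oppE p : loc_opp (pi p) = pi (fopp p).
Proof.
apply/fraction_eqP.
have /fraction_eqP[u Gu E] : pi (repr (pi p)) = pi p by rewrite reprK.
exists u => //; move: (repr (pi p)) E => p' E; rewrite /fopp /=.
by rewrite !mulNr -opprD mulrN E oppr0.
Qed.

Let locE := (loc_addE, loc_mulE, loc_oppE).
Let pi_ind (P : localization -> Prop) : (forall p, P (pi p)) -> forall x, P x.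
Proof. by move=> Ppi x; rewrite -[x]reprK. Qed.

Fact loc_addA : associative loc_add.
Proof.
elim/pi_ind => p; elim/pi_ind => q; elim/pi_ind => r.
by rewrite !locE; apply: fraction_eq => /=; ring.
Qed.

Fact loc_addC : commutative loc_add.
Proof.
elim/pi_ind => p; elim/pi_ind => q.
by rewrite !locE; apply: fraction_eq => /=; ring.
Qed.

Fact loc_add0 : left_id (pi (0, den1)) loc_add.
Proof. by elim/pi_ind => p; rewrite !locE; apply: fraction_eq => /=; ring. Qed.

Fact loc_addN : left_inverse (pi (0, den1)) loc_opp loc_add.
Proof. by elim/pi_ind => p; rewrite !locE; apply: fraction_eq => /=; ring. Qed.

HB.instance Definition _ := GRing.isZmodule.Build localization
  loc_addA loc_addC loc_add0 loc_addN.

Fact loc_mulA : associative loc_mul.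
Proof.
elim/pi_ind => p; elim/pi_ind => q; elim/pi_ind => r.
by rewrite !locE; apply: fraction_eq => /=; ring.
Qed.

Fact loc_mulC : commutative loc_mul.
Proof.
elim/pi_ind => p; elim/pi_ind => q.
by rewrite !locE; apply: fraction_eq => /=; ring.
Qed.

Fact loc_mul1 : left_id (pi (1, den1)) loc_mul.
Proof. by elim/pi_ind => p; rewrite !locE; apply: fraction_eq => /=; ring. Qed.

Fact loc_mulDl : left_distributive loc_mul loc_add.
Proof.
elim/pi_ind => p; elim/pi_ind => q; elim/pi_ind => r.
by rewrite !locE; apply: fraction_eq => /=; ring.
Qed.

HB.instance Definition _ := GRing.Zmodule_isComPzRing.Build localization
  loc_mulA loc_mulC loc_mul1 loc_mulDl.

Definition to_loc (s : S) : localization := pi (s, den1).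

Fact to_loc_zmod : zmod_morphism to_loc.
Proof.
move=> s t; change (to_loc (s - t) = loc_add (to_loc s) (loc_opp (to_loc t))).
by rewrite /to_loc !locE; apply: fraction_eq => /=; ring.
Qed.

Fact to_loc_monoid : monoid_morphism to_loc.
Proof.
split=> // s t; change (to_loc (s * t) = loc_mul (to_loc s) (to_loc t)).
by rewrite /to_loc !locE; apply: fraction_eq => /=; ring.
Qed.

HB.instance Definition _ := GRing.isZmodMorphism.Build _ _ to_loc to_loc_zmod.
HB.instance Definition _ :=
  GRing.isMonoidMorphism.Build _ _ to_loc to_loc_monoid.

End Localization.

Record ring_action (W : groupType) (Q : pzRingType) := RingAction {
  ract :> W -> {rmorphism Q -> Q};
  ract1 : forall q, ract 1%g q = q;
  ractM : forall v w q, ract (v * w)%g q = ract v (ract w q)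
}.

Definition trivial_action (W : groupType) (Q : pzRingType) : ring_action W Q :=
  @RingAction W Q (fun _ => idfun : {rmorphism Q -> Q})
    (fun q => erefl) (fun _ _ q => erefl).

Section Twisted.
Variables (W : groupType) (Q : pzRingType) (act : ring_action W Q).

(** Finitely supported families of elements of [Q]; [<< q *g w >>] is
    [q delta_w]. *)
Definition twisted of ring_action W Q : Type := {malg Q[W]}.
Local Notation QW := (twisted act).
HB.instance Definition _ := GRing.Zmodule.on QW.

Implicit Types a b c : {malg Q[W]}.

Definition tw_one : QW := << 1 *g 1%g >>.

Definition tw_mul (a b : QW) : QW :=
  \sum_(v <- msupp a) \sum_(w <- msupp b)
    << mcoeff v a * act v (mcoeff w b) *g (v * w)%g >>.

Let tw_mulw (d e : {fset W}) a b :
  (msupp a `<=` d)%fset -> (msupp b `<=` e)%fset ->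
  tw_mul a b = \sum_(v <- d) \sum_(w <- e)
    << mcoeff v a * act v (mcoeff w b) *g (v * w)%g >>.
Proof.
move=> ad be; rewrite /tw_mul (big_fset_incl _ ad) /= => [|v _ /mcoeff_outdom ->].
  apply: eq_bigr => v _; apply: big_fset_incl => // w _ /mcoeff_outdom ->.
  by rewrite rmorph0 mulr0 monalgU0.
by rewrite big1 // => w _; rewrite mul0r monalgU0.
Qed.

Let tw_mulUU q v r w :
  tw_mul << q *g v >> << r *g w >> = << q * act v r *g (v * w)%g >>.
Proof.
by rewrite (tw_mulw (@msuppU_le _ _ v q) (@msuppU_le _ _ w r)) !big_seq_fset1
  !mcoeffUU.
Qed.

Fact tw_mulDl : left_distributive tw_mul +%R.
Proof.
move=> a b c; rewrite (tw_mulw (msuppD_le a b) (fsubset_refl (msupp c))).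
rewrite (tw_mulw (fsubsetUl (msupp a) (msupp b)) (fsubset_refl (msupp c))).
rewrite (tw_mulw (fsubsetUr (msupp a) (msupp b)) (fsubset_refl (msupp c))).
rewrite -big_split; apply: eq_bigr => v _; rewrite -big_split.
by apply: eq_bigr => w _; rewrite mcoeffD mulrDl monalgUD.
Qed.

Fact tw_mulDr : right_distributive tw_mul +%R.
Proof.
move=> c a b; rewrite (tw_mulw (fsubset_refl (msupp c)) (msuppD_le a b)).
rewrite (tw_mulw (fsubset_refl (msupp c)) (fsubsetUl (msupp a) (msupp b))).
rewrite (tw_mulw (fsubset_refl (msupp c)) (fsubsetUr (msupp a) (msupp b))).
rewrite -big_split; apply: eq_bigr => v _; rewrite -big_split.
by apply: eq_bigr => w _; rewrite mcoeffD rmorphD mulrDr monalgUD.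
Qed.

Let tw_mul0l b : tw_mul 0 b = 0.
Proof. by rewrite /tw_mul msupp0 big_seq_fset0. Qed.

Let tw_mul0r a : tw_mul a 0 = 0.
Proof. by rewrite /tw_mul msupp0; apply: big1 => v _; rewrite big_seq_fset0. Qed.

Let tw_ind (P : QW -> Prop) : P 0 -> (forall a b, P a -> P b -> P (a + b)) ->
  (forall q w, P << q *g w >>) -> forall a, P a.
Proof.
by move=> P0 PD PU a; rewrite [a]monalgE; apply: (big_ind P) => // w _; apply: PU.
Qed.

Fact tw_mulA : associative tw_mul.
Proof.
move=> a b c; elim/tw_ind: a => [|a a' IH IH'|q u]; first by rewrite !tw_mul0l.
  by rewrite !tw_mulDl IH IH'.
elim/tw_ind: b => [|b b' IH IH'|r v]; first by rewrite !(tw_mul0l, tw_mul0r).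
  by rewrite !(tw_mulDl, tw_mulDr) IH IH'.
elim/tw_ind: c => [|c c' IH IH'|s w]; first by rewrite !tw_mul0r.
  by rewrite !tw_mulDr IH IH'.
by rewrite !tw_mulUU rmorphM ractM mulrA mulgA.
Qed.

Fact tw_mul1l : left_id tw_one tw_mul.
Proof.
elim/tw_ind => [|a a' IH IH'|q u]; first by rewrite tw_mul0r.
  by rewrite tw_mulDr IH IH'.
by rewrite tw_mulUU ract1 mul1r mul1g.
Qed.

Fact tw_mul1r : right_id tw_one tw_mul.
Proof.
elim/tw_ind => [|a a' IH IH'|q u]; first by rewrite tw_mul0l.
  by rewrite tw_mulDl IH IH'.
by rewrite tw_mulUU rmorph1 mulr1 mulg1.
Qed.

HB.instance Definition _ := GRing.Zmodule_isPzRing.Build QW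
  tw_mulA tw_mul1l tw_mul1r tw_mulDl tw_mulDr.

Definition tw_scalar (q : Q) : QW := << q *g 1%g >>.
Definition tw_delta (w : W) : QW := << 1 *g w >>.

Lemma tw_scalar_delta q w : tw_scalar q * tw_delta w = << q *g w >> :> QW.
Proof. by rewrite [LHS]tw_mulUU ract1 mulr1 mul1g. Qed.

End Twisted.

(** [ring_inv q] is 0 when [q] is not a unit. *)
Definition ring_inv (Q : comPzRingType) (q : Q) : Q :=
  xget 0 [set r | r * q = 1].

(** An action on [S] extends in at most one way to an action on a localization
    of [S]; [loc_action] is this extension when it exists. *)
Section LocalizedAction.
Variables (W : groupType) (S : comNzRingType) (G : set S).
Variable act : W -> {rmorphism S -> S}.

Definition extends_action (b : ring_action W (localization G)) : Prop :=
  forall w s, b w (to_loc G s) = to_loc G (act w s).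

Definition loc_action : ring_action W (localization G) :=
  if pselect (exists b, extends_action b) is left ex then projT1 (cid ex)
  else trivial_action W (localization G).

End LocalizedAction.

Record generalized_cartan_matrix (n : nat) := GeneralizedCartanMatrix {
  gcm_mx :> 'M[int]_n;
  gcm_diag : forall i, gcm_mx i i = 2;
  gcm_offdiag : forall i j, i != j -> gcm_mx i j <= 0;
  gcm_eq0 : forall i j, gcm_mx i j = 0 <-> gcm_mx j i = 0
}.

(** The complex numbers are [K[i]], for [K] a model of the real numbers. *)
Record root_datum (K : realType) (n : nat) (A : generalized_cartan_matrix n) :=
  RootDatum {
    cartan : vectType K[i];
    simple_root : 'I_n -> 'Hom(cartan, K[i]^o);
    simple_coroot : 'I_n -> cartan;
    cartan_dim : \dim {: cartan} =
      (n.*2 - \rank (map_mx intr (gcm_mx A) : 'M[K[i]]_n))%N;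
    simple_root_free : free [seq simple_root i | i <- enum 'I_n];
    simple_coroot_free : free [seq simple_coroot i | i <- enum 'I_n];
    root_pairing : forall i j, simple_root j (simple_coroot i) = (A i j)%:~R
  }.

Section Weyl.
Variables (K : realType) (n : nat) (A : generalized_cartan_matrix n).
Variable D : root_datum K A.

Definition dual_cartan : vectType K[i] := 'Hom(cartan D, K[i]^o).
Local Notation V := dual_cartan.
Local Notation alpha := (@simple_root K n A D).
Local Notation coroot := (@simple_coroot K n A D).

Definition pairing (l : V) (h : cartan D) : K[i] := l h.

Definition refl_fun (i : 'I_n) (l : V) : V := l - pairing l (coroot i) *: alpha i.

Fact refl_linear i : linear (refl_fun i).
Proof.
move=> a l m; rewrite /refl_fun /pairing add_lfunE scale_lfunE.
by rewrite scalerDl -scalerA opprD addrACA scalerBr.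
Qed.
HB.instance Definition _ i := GRing.isLinear.Build K[i] V V *:%R (refl_fun i)
  (refl_linear i).

Definition simple_refl_end (i : 'I_n) : 'End(V) := linfun (refl_fun i).

Lemma simple_refl_endE i l : simple_refl_end i l = refl_fun i l.
Proof. by rewrite lfunE. Qed.

Fact simple_refl_endK i : involutive (simple_refl_end i).
Proof.
move=> l; rewrite !simple_refl_endE /refl_fun.
have -> : pairing (l - pairing l (coroot i) *: alpha i) (coroot i) =
    - pairing l (coroot i).
  rewrite /pairing add_lfunE opp_lfunE scale_lfunE root_pairing gcm_diag.
  by rewrite /GRing.scale /= -[2%:~R]/(1 + 1) mulrDr mulr1 opprD addNKr.
by rewrite scaleNr opprK subrK.
Qed.

Definition word_end (I : seq 'I_n) : 'End(V) :=
  foldr (fun i f => simple_refl_end i \o f)%VF \1%VF I.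

Lemma word_end_cat I J : word_end (I ++ J) = (word_end I \o word_end J)%VF.
Proof.
by elim: I => [|i I IHI] /=; rewrite ?comp_lfun1l // IHI comp_lfunA.
Qed.

Lemma word_end_revK I : cancel (word_end I) (word_end (rev I)).
Proof.
elim: I => [|i I IHI] l /=; first by rewrite !id_lfunE.
rewrite rev_cons -cats1 word_end_cat /= !comp_lfunE id_lfunE.
by rewrite simple_refl_endK IHI.
Qed.

(** Words in the simple reflections form a group, since these are involutions. *)
Definition weyl_pred : pred 'End(V) := fun f => `[< exists I, f = word_end I >].
Definition weyl : Type := {f : 'End(V) | weyl_pred f}.
HB.instance Definition _ := SubChoice.on weyl.

Definition weyl_end (w : weyl) : 'End(V) := val w.

Fact weyl_word_subproof I : weyl_pred (word_end I).
Proof. by apply/asboolP; exists I. Qed.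
Definition weyl_word I : weyl := exist (fun f => is_true (weyl_pred f)) _
  (weyl_word_subproof I).

Lemma weyl_wordP (w : weyl) : exists I, w = weyl_word I.
Proof. by have /asboolP[I E] := valP w; exists I; apply: val_inj. Qed.

Fact weyl_mul_subproof (v w : weyl) : weyl_pred (weyl_end v \o weyl_end w)%VF.
Proof.
have [I ->] := weyl_wordP v; have [J ->] := weyl_wordP w.
by apply/asboolP; exists (I ++ J); rewrite word_end_cat.
Qed.

Fact weyl_inv_subproof (w : weyl) : weyl_pred (weyl_end w)^-1%VF.
Proof.
have [I ->] := weyl_wordP w; apply/asboolP; exists (rev I).
apply/lfunP => l; rewrite -[in LHS](word_end_revK (rev I) l) revK.
by rewrite lker0_lfunK //; apply/lker0P/(can_inj (word_end_revK I)).
Qed.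

Definition weyl_mul v w : weyl :=
  exist (fun f => is_true (weyl_pred f)) _ (weyl_mul_subproof v w).
Definition weyl_inv w : weyl :=
  exist (fun f => is_true (weyl_pred f)) _ (weyl_inv_subproof w).

Fact weyl_mulA : associative weyl_mul.
Proof. by move=> u v w; apply: val_inj; rewrite /= comp_lfunA. Qed.
Fact weyl_mul1 : left_id (weyl_word [::]) weyl_mul.
Proof. by move=> w; apply: val_inj; rewrite /= comp_lfun1l. Qed.
Fact weyl_1mul : right_id (weyl_word [::]) weyl_mul.
Proof. by move=> w; apply: val_inj; rewrite /= comp_lfun1r. Qed.
Fact weyl_lker0 (w : weyl) : lker (weyl_end w) == 0%VS.
Proof.
by have [I ->] := weyl_wordP w; apply/lker0P/(can_inj (word_end_revK I)).
Qed.
Fact weyl_mulV : left_inverse (weyl_word [::]) weyl_inv weyl_mul.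
Proof.
by move=> w; apply: val_inj; rewrite /= lker0_compVf // weyl_lker0.
Qed.
Fact weyl_Vmul : right_inverse (weyl_word [::]) weyl_inv weyl_mul.
Proof.
by move=> w; apply: val_inj; rewrite /= lker0_compfV // weyl_lker0.
Qed.
HB.instance Definition _ := isGroup.Build weyl
  weyl_mulA weyl_mul1 weyl_1mul weyl_mulV weyl_Vmul.

Definition simple_refl (i : 'I_n) : weyl := weyl_word [:: i].

Lemma weyl_word_prod I : weyl_word I = (\prod_(i <- I) simple_refl i)%g.
Proof.
elim: I => [|i I IHI]; first by rewrite big_nil.
by rewrite big_cons -IHI; apply/val_inj/lfunP => l; rewrite /= !comp_lfunE id_lfunE.
Qed.

Fact weyl_length_subproof (w : weyl) :
  exists k, `[< exists2 I : seq 'I_n, size I = k &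
                  w = (\prod_(i <- I) simple_refl i)%g >].
Proof.
have [I ->] := weyl_wordP w; exists (size I); apply/asboolP; exists I => //.
exact: weyl_word_prod.
Qed.

Definition weyl_length (w : weyl) : nat := ex_minn (weyl_length_subproof w).

Definition reduced_word (v : weyl) (I : seq 'I_n) : Prop :=
  v = (\prod_(i <- I) simple_refl i)%g /\ size I = weyl_length v.

(** The reflection [s_a] for the real root [a = w(alpha_i)] *)
Definition root_refl (w : weyl) (i : 'I_n) : weyl :=
  (w * simple_refl i * w^-1)%g.

(** [u < v] in the Bruhat order when there is a chain
    [u = u_0, u_1 = u_0 t_1, ..., v = u_k], with [k > 0], the [t_j] reflections
    and the lengths strictly increasing. *)
Definition bruhat_step (u v : weyl) : Prop :=
  (exists w i, v = u * root_refl w i)%g /\ (weyl_length u < weyl_length v)%N.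

Definition bruhat_lt : weyl -> weyl -> Prop :=
  Relation_Operators.clos_trans weyl bruhat_step.

Definition is_Zbasis (U : {pred V}) (m : nat) (b : 'I_m -> V) : Prop :=
  (forall j, b j \in U) /\
  forall l, l \in U -> exists! c : {ffun 'I_m -> int}, l = \sum_j b j *~ c j.

Record demazure_lattice := DemazureLattice {
  lattice_pred : zmodClosed V;
  lattice_free : exists m (b : 'I_m -> V), is_Zbasis lattice_pred b;
  lattice_root : forall i, alpha i \in lattice_pred;
  lattice_int : forall l i, l \in lattice_pred ->
    exists z : int, pairing l (coroot i) = z%:~R;
  lattice_extend : forall i, exists m (b : 'I_m -> V) j,
    is_Zbasis lattice_pred b /\ b j = alpha i
}.

Section Lattice.
Variable Lam : demazure_lattice.

Definition lattice : Type := {l : V | l \in lattice_pred Lam}.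
HB.instance Definition _ := SubChoice.on lattice.
HB.instance Definition _ := [SubChoice_isSubZmodule of lattice by <:].

Definition LatticeElt l (Ul : l \in lattice_pred Lam) : lattice :=
  exist (fun l => is_true (l \in lattice_pred Lam)) l Ul.

Fact lattice_act_subproof (w : weyl) (l : lattice) :
  weyl_end w (val l) \in lattice_pred Lam.
Proof.
have [I ->] := weyl_wordP w; rewrite /weyl_end /=.
elim: I => [|i I IHI] /=; first by rewrite id_lfunE (valP l).
rewrite comp_lfunE simple_refl_endE /refl_fun.
have [z ->] := lattice_int i IHI.
by rewrite scaler_int rpredB ?rpredMz // lattice_root.
Qed.

Definition lattice_act (w : weyl) (l : lattice) : lattice :=
  LatticeElt (lattice_act_subproof w l).

Fact lattice_act_zmod w : zmod_morphism (lattice_act w).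
Proof. by move=> l m; apply: val_inj; rewrite /= raddfB. Qed.
HB.instance Definition _ w := GRing.isZmodMorphism.Build _ _ (lattice_act w)
  (lattice_act_zmod w).

Definition lattice_simple_root (i : 'I_n) : lattice :=
  LatticeElt (lattice_root Lam i).

Definition real_root (l : lattice) : Prop :=
  exists w i, l = lattice_act w (lattice_simple_root i).

Definition positive_root (l : lattice) : Prop :=
  real_root l /\
  exists c : 'I_n -> nat, l = \sum_i lattice_simple_root i *+ c i.

End Lattice.
End Weyl.

Section Demazure.
Variables (K : realType) (n : nat) (A : generalized_cartan_matrix n).
Variables (D : root_datum K A) (Lam : demazure_lattice D).
Variables (R : comNzRingType) (F : formal_group_law R).

Local Notation W := (weyl D).
Local Notation L := (lattice Lam).

Definition demazure_S : comNzRingType := formal_group_algebra F L.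
Local Notation S := demazure_S.

Definition weyl_S (w : W) : {rmorphism S -> S} := fga_map F (lattice_act w).

Definition demazure_Q : comPzRingType :=
  localization [set s : S | exists2 a : L, positive_root a & s = fga_var F a].
Local Notation Q := demazure_Q.

(** The action of [W] on [S] extends to [Q]: if [a] is a positive root, then
    [w(a)] or [- w(a)] is a positive root, and [x_(- a)] is the product of [x_a]
    by a unit of [S] because [F(x_a, x_(- a)) = 0]. So [weyl_Q] is this extension,
    not the default of [loc_action]. *)
Definition weyl_Q : ring_action W Q := loc_action _ weyl_S.

Definition demazure_QW : pzRingType := twisted weyl_Q.
Local Notation QW := demazure_QW.

Definition S_to_QW (s : S) : QW := tw_scalar weyl_Q (to_loc _ s).

(** [X_a = (1 / x_a) (1 - delta_a)] for the real root [a = w(alpha_i)]; [x_a] is a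
    unit of [Q] also when [a] is a negative root. *)
Definition demazure_elt (w : W) (i : 'I_n) : QW :=
  tw_scalar weyl_Q
    (ring_inv (to_loc _ (fga_var F (lattice_act w (lattice_simple_root Lam i))))) *
  (1 - tw_delta weyl_Q (root_refl w i)).

(** The subring generated by [S] and the [X_a]; it is also the [R]-subalgebra
    they generate, since [S] contains the image of [R]. *)
Inductive in_demazure : QW -> Prop :=
| InDemazureS s : in_demazure (S_to_QW s)
| InDemazureX w i : in_demazure (demazure_elt w i)
| InDemazureB a b : in_demazure a -> in_demazure b -> in_demazure (a - b)
| InDemazureM a b : in_demazure a -> in_demazure b -> in_demazure (a * b).

Definition demazure_pred : pred QW := fun a => `[< in_demazure a >].

Fact demazure_subring : subring_closed demazure_pred.
Proof.
split=> [|a b /asboolP Da /asboolP Db|a b /asboolP Da /asboolP Db]; apply/asboolP.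
- suff -> : (1 : QW) = S_to_QW 1 by exact: InDemazureS.
  by rewrite /S_to_QW rmorph1.
- exact: InDemazureB.
- exact: InDemazureM.
Qed.

Definition demazure_algebra : Type := {a : QW | a \in demazure_pred}.
HB.instance Definition _ := SubChoice.on demazure_algebra.
HB.instance Definition _ := GRing.SubChoice_isSubPzRing.Build _ _ demazure_algebra
  demazure_subring.

Definition DemazureElt a (Da : in_demazure a) : demazure_algebra :=
  exist (fun a => is_true (a \in demazure_pred)) a (asboolT Da).

Definition demazure_scalar (s : S) : demazure_algebra :=
  DemazureElt (InDemazureS s).

(** [X_i], with [alpha_i = 1(alpha_i)] *)
Definition demazure_X (i : 'I_n) : demazure_algebra :=
  DemazureElt (InDemazureX 1%g i).

Definition demazure_word (I : seq 'I_n) : demazure_algebra :=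
  \prod_(i <- I) demazure_X i.

End Demazure.

(* Main.v *)
(** The coefficients of a product [X_I] of formal Demazure elements, in the basis
    [delta_v] of [Q_W], have simple poles along the [x_a], for [a] a real root, and
    the residues at [v] and [s_a v] are opposite; this property is preserved by
    multiplication by [X_i] on the left.  Hence if [v] is of maximal length in the
    support of such an element, its coefficient at [v] has poles only along the
    inversions of [v], so it is an element of [S] times the leading coefficient of
    [X_(I_v)], and such elements can be expanded on the [X_(I_v)] with coefficients
    in [S], by descending induction on lengths.  For a reduced word [I] of [w], the
    coefficients of [X_I] at [w] and at the elements of length [l(w) - 1] do not
    depend on [I], so that only elements of length at most [l(w) - 2] occur in the
    expansion of [X_I - X_I'].

    This uses that the [x_a] are primes of [S], pairwise non associate for positive
    roots [a]: if [a] is part of a basis of the lattice, then [S] embeds in a ring of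
    power series in one variable [t] over a domain, by sending [x_a] to [t], and is
    a retract of it; as [R] has characteristic 0, [x_b] is not sent to a multiple of
    [t] unless [b] is a multiple of [a]. *)

From HB Require Import structures.
Require Import Defs.
From mathcomp Require Import all_boot all_order all_algebra.
From mathcomp Require Import boolp classical_sets functions fsbigop.
From mathcomp Require Import reals complex.
From mathcomp Require Import finmap monalg ring zify.

Set Implicit Arguments.
Unset Strict Implicit.
Unset Printing Implicit Defensive.

Import GRing.Theory.
Local Open Scope classical_set_scope.
Local Open Scope ring_scope.

(** * Power series in one variable *)

(** Filtrations replace topology throughout: [S], the power series rings and [R] itself are complete
    separated filtered [R]-algebras ([cfil]), whose elements of positive order form a group under
    [F]. A continuous morphism from [S] is then an additive map from the lattice to such a group.
    This is how [S] is compared with power series, and it requires a basis of the lattice through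
    the root, whence the reduction to simple roots by the action of [W]. [W] is a group of linear
    maps, with no Coxeter presentation given, and may be infinite. The exchange properties are all
    derived from one fact: [w(alpha_i)] is positive when [w s_i] is not shorter than [w]. Its rank
    two part is a computation with Cartan integers. The two conditions on residues have to be
    carried together. Multiplication by [X_i] divides by [x_(alpha_i)], and poles stay simple only
    because residues at [v] and [s_i v] are opposite. Conversely, at an element of maximal length
    the opposite residue is that of a zero coefficient as soon as [s_a v] is longer, which leaves
    only the poles along inversions. *)

Section PowerSeries.
Variable A : comNzRingType.

Definition series : Type := nat -> A.
HB.instance Definition _ := GRing.Zmodule.on series.
Implicit Types f g h : series.

Definition series_mul f g : series := fun n => \sum_(i < n.+1) f i * g (n - i)%N.
Definition series_const (a : A) : series := fun n => if n is 0 then a else 0.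
Definition series_trunc n f : {poly A} := \poly_(i < n.+1) f i.

(** Coefficients up to degree [n] only see the truncations at [n], so commutativity and
    associativity are inherited from [{poly A}]. *)
Lemma series_mul_trunc n k f g : (k <= n)%N ->
  series_mul f g k = (series_trunc n f * series_trunc n g)`_k.
Proof.
move=> kn; rewrite coefM; apply: eq_bigr => i _.
by rewrite !coef_poly !ifT //; have := ltn_ord i; lia.
Qed.

Fact series_mulC : commutative series_mul.
Proof. by move=> f g; apply/funext => n; rewrite !(series_mul_trunc _ _ (leqnn n)) mulrC. Qed.

Fact series_mulA : associative series_mul.
Proof.
move=> f g h; apply/funext => n.
transitivity (series_trunc n f * series_trunc n g * series_trunc n h)`_n.
  rewrite -mulrA coefM; apply: eq_bigr => i _.
  rewrite -series_mul_trunc ?leq_subr // coef_poly ifT //.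
rewrite coefM; apply: eq_bigr => i _.
rewrite -series_mul_trunc; last by rewrite -ltnS.
by rewrite coef_poly ifT // ltnS leq_subr.
Qed.

Fact series_mul1 : left_id (series_const 1) series_mul.
Proof.
move=> f; apply/funext => n; rewrite /series_mul big_ord_recl /= subn0 mul1r.
by rewrite big1 ?addr0 // => i _; rewrite mul0r.
Qed.

Lemma seriesD f g n : (f + g) n = f n + g n. Proof. by []. Qed.
Lemma seriesN f n : (- f) n = - f n. Proof. by []. Qed.

Fact series_mulDl : left_distributive series_mul +%R.
Proof.
move=> f g h; apply/funext => n; rewrite seriesD /series_mul -big_split.
by apply: eq_bigr => i _; rewrite seriesD mulrDl.
Qed.

Fact series_1neq0 : series_const 1 != 0.
Proof. by apply/eqP => /(congr1 (fun f : series => f 0%N))/eqP; rewrite oner_eq0. Qed.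

HB.instance Definition _ := GRing.Zmodule_isComNzRing.Build series
  series_mulA series_mulC series_mul1 series_mulDl series_1neq0.

Lemma seriesM f g n : (f * g) n = \sum_(i < n.+1) f i * g (n - i)%N.
Proof. by []. Qed.

Lemma seriesM0 f g : (f * g) 0 = f 0 * g 0.
Proof. by rewrite seriesM big_ord1. Qed.

Fact series_const_zmod : zmod_morphism series_const.
Proof. by move=> a b; apply/funext => -[|n] //; rewrite seriesD seriesN /= subr0. Qed.

Lemma series_constM a f n : (series_const a * f) n = a * f n.
Proof.
by rewrite seriesM big_ord_recl subn0 big1 ?addr0 // => i _; rewrite mul0r.
Qed.

Fact series_const_monoid : monoid_morphism series_const.
Proof.
split=> // a b; apply/funext => n; rewrite series_constM.
by case: n => //= n; rewrite mulr0.
Qed.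
HB.instance Definition _ := GRing.isZmodMorphism.Build _ _ series_const
  series_const_zmod.
HB.instance Definition _ := GRing.isMonoidMorphism.Build _ _ series_const
  series_const_monoid.

Definition series_coef0 f : A := f 0.
Fact series_coef0_zmod : zmod_morphism series_coef0. Proof. by []. Qed.
Fact series_coef0_monoid : monoid_morphism series_coef0.
Proof. by split=> // f g; rewrite /series_coef0 seriesM0. Qed.
HB.instance Definition _ := GRing.isZmodMorphism.Build _ _ series_coef0
  series_coef0_zmod.
HB.instance Definition _ := GRing.isMonoidMorphism.Build _ _ series_coef0
  series_coef0_monoid.

Definition series_var : series := fun n => (n == 1)%:R.

Lemma series_varM f n : (series_var * f) n = if n is n'.+1 then f n' else 0.
Proof.
rewrite seriesM big_ord_recl mul0r add0r; case: n => [|n]; first by rewrite big_ord0.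
rewrite big_ord_recl mul1r subn1 big1 ?addr0 // => i _.
by rewrite mul0r.
Qed.

Lemma series_var_dvd f : f 0 = 0 -> exists g, f = series_var * g.
Proof.
by move=> f0; exists (fun n => f n.+1); apply/funext => -[|n]; rewrite series_varM.
Qed.

End PowerSeries.

Definition no_zero_divisor (A : comNzRingType) :=
  forall a b : A, a * b = 0 -> a = 0 \/ b = 0.

Lemma series_domain (A : comNzRingType) :
  no_zero_divisor A -> no_zero_divisor (series A).
Proof.
move=> domA f g fg0; have [f0|nf0] := EM (f = 0); [by left|right].
have /ex_minnP[m fm minm] : exists n, f n != 0.
  by apply: contrapT => /forallNP f0; apply/nf0/funext => n; apply/eqP/negbNE/negP.
apply/funext; elim/ltn_ind => n IHn.
have := congr1 (fun h : series A => h (m + n)%N) fg0; rewrite seriesM.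
(* With [m] the order of [f], terms with [i < m] vanish by minimality and those with [i > m] by
   induction; only [f m * g n] is left. *)
rewrite (bigD1 (Ordinal (leq_addr n m : m < (m + n).+1)%N)) //= addKn big1 => [|i im].
  by rewrite addr0 => /domA[/eqP|//]; rewrite (negbTE fm).
have [im'|mi] := ltnP i m.
  suff -> : f i = 0 by rewrite mul0r.
  by apply/eqP; apply: contraLR im' => /minm; rewrite -leqNgt.
rewrite IHn ?mulr0 //.
have : (i : nat) != m by apply: contraNneq im => im; apply/eqP/val_inj.
by have := ltn_ord i; lia.
Qed.

(** * Complete filtered algebras *)

(** The filtration is data and need not consist of powers of an ideal: on power series it is by
    total degree, on [S] it comes from representatives. [cf_full] and [cf_MM] make every step stable
    under multiplication by [A]; [cf_sep] and [cf_lim] give uniqueness and existence of limits. *)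
Record cfil (R A : comNzRingType) := CFil {
  cf_str : {rmorphism R -> A};
  cf_set :> nat -> set A;
  cf_0 : forall k, cf_set k 0;
  cf_D : forall k a b, cf_set k a -> cf_set k b -> cf_set k (a + b);
  cf_full : forall a, cf_set 0 a;
  cf_decr : forall k, cf_set k.+1 `<=` cf_set k;
  cf_MM : forall i j a b, cf_set i a -> cf_set j b -> cf_set (i + j)%N (a * b);
  cf_sep : forall a, (forall k, cf_set k a) -> a = 0;
  cf_lim : forall u : nat -> A, (forall k, cf_set k (u k.+1 - u k)) ->
    exists l, forall k, cf_set k (l - u k)
}.

Section CFil.
Variables (R A : comNzRingType) (f : cfil R A).
Implicit Types (a b c d : A) (k : nat).

Lemma cf_M k a b : f k b -> f k (a * b).
Proof. by rewrite -[k in f k (_ * _)]add0n; apply: cf_MM; apply: cf_full. Qed.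

Lemma cf_Mr k a b : f k a -> f k (a * b).
Proof. by rewrite mulrC; apply: cf_M. Qed.

Lemma cf_N k a : f k a -> f k (- a).
Proof. by rewrite -mulN1r; apply: cf_M. Qed.

Lemma cf_B k a b : f k a -> f k b -> f k (a - b).
Proof. by move=> fa /cf_N; apply: cf_D. Qed.

Lemma cf_le k l : (k <= l)%N -> f l `<=` f k.
Proof.
elim: l => [|l IHl]; first by rewrite leqn0 => /eqP->.
rewrite leq_eqVlt => /predU1P[->//|]; rewrite ltnS => /IHl; apply: subset_trans.
exact: cf_decr.
Qed.

Lemma cf_sum k (T : Type) (r : seq T) (P : pred T) (F : T -> A) :
  (forall i, P i -> f k (F i)) -> f k (\sum_(i <- r | P i) F i).
Proof.
move=> Ff; apply: (big_ind (f k)) => //; first exact: cf_0.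
by move=> x y; apply: cf_D.
Qed.

Lemma cf_X k a : f 1 a -> f k (a ^+ k).
Proof.
move=> fa; elim: k => [|k IHk]; first exact: cf_full.
by rewrite exprS -add1n; apply: cf_MM.
Qed.

Definition cf_eq k a b := f k (a - b).

Lemma cf_eqxx k a : cf_eq k a a.
Proof. by rewrite /cf_eq subrr; apply: cf_0. Qed.

Lemma cf_eqC k a b : cf_eq k a b -> cf_eq k b a.
Proof. by move=> /cf_N; rewrite opprB. Qed.

Lemma cf_eqT k b a c : cf_eq k a b -> cf_eq k b c -> cf_eq k a c.
Proof. by move=> /cf_D H /H; rewrite addrA subrK. Qed.

Lemma cf_eqD k a b c d : cf_eq k a b -> cf_eq k c d -> cf_eq k (a + c) (b + d).
Proof. by move=> /cf_D H /H; rewrite /cf_eq opprD addrACA. Qed.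

Lemma cf_eqB k a b c d : cf_eq k a b -> cf_eq k c d -> cf_eq k (a - c) (b - d).
Proof. by move=> /cf_B H /H; rewrite /cf_eq !opprD addrACA. Qed.

Lemma cf_eqM k a b c d : cf_eq k a b -> cf_eq k c d -> cf_eq k (a * c) (b * d).
Proof.
move=> ab cd; apply: (@cf_eqT _ (b * c)); rewrite /cf_eq.
  by rewrite -mulrBl; apply: cf_Mr.
by rewrite -mulrBr; apply: cf_M.
Qed.

Lemma cf_eqX k a b n : cf_eq k a b -> cf_eq k (a ^+ n) (b ^+ n).
Proof.
by move=> ab; elim: n => [|n IHn]; rewrite ?exprS; [apply: cf_eqxx|apply: cf_eqM].
Qed.

Lemma cf_eq_sum k (T : Type) (r : seq T) (P : pred T) (F G : T -> A) :
  (forall i, P i -> cf_eq k (F i) (G i)) ->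
  cf_eq k (\sum_(i <- r | P i) F i) (\sum_(i <- r | P i) G i).
Proof. by move=> FG; rewrite /cf_eq -sumrB; apply: cf_sum. Qed.

Lemma cf_eq_le k l a b : (k <= l)%N -> cf_eq l a b -> cf_eq k a b.
Proof. by move=> kl; apply: (cf_le kl). Qed.

Lemma cf_eqP a b : (forall k, cf_eq k a b) -> a = b.
Proof. by move=> ab; apply/subr0_eq/(cf_sep ab). Qed.

Lemma cf_eq0 k a : cf_eq k a 0 <-> f k a.
Proof. by rewrite /cf_eq subr0. Qed.

Lemma cf_eq_fil k a b : cf_eq k a b -> f k b -> f k a.
Proof. by move=> /cf_D H /H; rewrite subrK. Qed.

End CFil.

(** * Evaluation of polynomials in filtered algebras *)

Section Evaluation.
Variables (R A : comNzRingType) (s : {rmorphism R -> A}) (L : choiceType).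
Variable h : L -> A.

Definition eval_monom (m : {cmonom L}) : A := \prod_(l <- finsupp m) h l ^+ m l.

Lemma eval_monomEw (m : {cmonom L}) (d : {fset L}) :
  (finsupp m `<=` d)%fset -> eval_monom m = \prod_(l <- d) h l ^+ m l.
Proof.
move=> md; rewrite /eval_monom (big_fset_incl _ md) // => l _.
by rewrite -cmE_neq0 negbK => /eqP->; rewrite expr0.
Qed.

Fact eval_monom_morph : mmorphism eval_monom.
Proof.
split=> [m1 m2|]; last by rewrite /eval_monom mdom1 big_seq_fset0.
rewrite {1}/eval_monom mdomD.
rewrite (eval_monomEw (fsubsetUl (finsupp m1) (finsupp m2))).
rewrite (eval_monomEw (fsubsetUr (finsupp m1) (finsupp m2))).
by rewrite -big_split /=; apply: eq_bigr => l _; rewrite cmM exprD.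
Qed.
HB.instance Definition _ :=
  monalg.isMultiplicative.Build _ _ eval_monom eval_monom_morph.

Definition eval_poly : {rmorphism polyring R L -> A} := mmap s eval_monom.

Lemma eval_poly_var l : eval_poly (polyvar R l) = h l.
Proof.
rewrite polyvar.unlock; transitivity (s 1 * eval_monom (ucm l)).
  exact: mmapU.
by rewrite rmorph1 mul1r /eval_monom mdomU big_seq_fset1 cmUU.
Qed.

Lemma eval_poly_const c : eval_poly c%:MP = s c.
Proof. exact: mmapC. Qed.

End Evaluation.

Section PolyringMorphism.
Variables (R A : comNzRingType) (L : choiceType).

Lemma polyring_morph_eq (g1 g2 : {rmorphism polyring R L -> A}) :
  (forall c, g1 c%:MP = g2 c%:MP) -> (forall l, g1 (polyvar R l) = g2 (polyvar R l)) ->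
  g1 =1 g2.
Proof.
move=> gC gV p; rewrite [p]monalgE !rmorph_sum; apply: eq_bigr => m _.
have UE (c : R) (m' : {cmonom L}) : << c *g m' >> = c%:MP * << m' >>.
  by rewrite malgM_def fgmulUU mulr1 mul1m.
rewrite UE.
rewrite (rmorphM g1).
rewrite (rmorphM g2).
apply: f_equal2; first exact: gC.
have [N] := ubnP (mdeg m); elim: N m => // N IHN m mN.
have [->|m1] := eqVneq m (mone : {cmonom L}); first exact: gC.
have /fset0Pn[l lm] : (finsupp m != fset0)%fset.
  apply: contraNneq m1 => mE; apply/eqP/eqP/cmP => i.
  by rewrite cm1; apply/eqP; rewrite cmE_eq0 mE in_fset0.
have mE : m = mmul (ucm l) (divcm m (ucm l)).
  apply/eqP/cmP => i; rewrite cmM divcmE cmU subnKC //.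
  by case: eqP => // <-; rewrite lt0n cmE_neq0.
move: mN; rewrite mE mdegM mdegU => mN.
have -> : << mmul (ucm l) (divcm m (ucm l)) >> =
    polyvar R l * << divcm m (ucm l) >> :> polyring R L.
  by rewrite polyvar.unlock malgM_def fgmulUU mulr1.
by rewrite (rmorphM g1) (rmorphM g2); apply: f_equal2; [exact: gV|exact: IHN].
Qed.

End PolyringMorphism.

Section FilteredEvaluation.
Variables (R A : comNzRingType) (f : cfil R A) (L : choiceType) (h : L -> A).
Hypothesis h1 : forall l, f 1 (h l).

Lemma eval_poly_aug p : p \in aug_ideal R L -> f 1 (eval_poly (cf_str f) h p).
Proof.
rewrite !unfold_in /= /augmentation => /eqP p0.
rewrite /eval_poly /= mmapE; apply: big_ind => [||m _]; try exact: cf_0.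
  exact: cf_D.
have [->|m1] := eqVneq m (mone : {cmonom L}); first by rewrite p0 rmorph0 mul0r; apply: cf_0.
have /fset0Pn[l lm] : (finsupp m != fset0)%fset.
  apply: contraNneq m1 => mE; apply/eqP/eqP/cmP => i.
  by rewrite cm1; apply/eqP; rewrite cmE_eq0 mE in_fset0.
apply: cf_M; rewrite /= /eval_monom (big_fsetD1 l) //=; apply: cf_Mr.
move: lm; rewrite -cmE_neq0; case: (m l) => // k _.
by rewrite exprS; apply: cf_Mr.
Qed.

Lemma eval_poly_pow k p :
  ideal_pow [set` aug_ideal R L] k p -> f k (eval_poly (cf_str f) h p).
Proof.
elim: k p => [|k IHk] p; first by move=> _; apply: cf_full.
move: p; apply: ideal_gen_le => [|a b|a b|_ [x [y [Ix Iy ->]]]].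
- by rewrite rmorph0; apply: cf_0.
- by rewrite rmorphD; apply: cf_D.
- by rewrite rmorphM; apply: cf_M.
- by rewrite rmorphM -add1n; apply: cf_MM; [apply: eval_poly_aug|apply: IHk].
Qed.

End FilteredEvaluation.

(** * Sums for a formal group law *)

Section DoubleSeries.
Variables (R A : comNzRingType) (f : cfil R A) (F : nat -> nat -> R).
Implicit Types (a b c d : A) (k l : nat).

(** [F] is any double family of coefficients here, as the construction is also applied to [fcross],
    which is not a formal group law. *)
Definition dsum k a b : A :=
  \sum_(i < k) \sum_(j < k) cf_str f (F i j) * a ^+ i * b ^+ j.

Lemma eval_fgl_trunc (L : choiceType) (h : L -> A) k p q :
  eval_poly (cf_str f) h (fgl_trunc F k p q) =
  dsum k (eval_poly (cf_str f) h p) (eval_poly (cf_str f) h q).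
Proof.
rewrite /fgl_trunc rmorph_sum; apply: eq_bigr => i _.
rewrite rmorph_sum; apply: eq_bigr => j _.
by rewrite !rmorphM !rmorphXn; congr (_ * _ * _); apply: eval_poly_const.
Qed.

Lemma dsum_cong k l a b c d : cf_eq f k a b -> cf_eq f k c d ->
  cf_eq f k (dsum l a c) (dsum l b d).
Proof.
move=> ab cd; apply: cf_eq_sum => i _; apply: cf_eq_sum => j _.
by apply: cf_eqM; [apply: cf_eqM; [apply: cf_eqxx|]|]; apply: cf_eqX.
Qed.

Lemma dsumS k a b : f 1 a -> f 1 b -> cf_eq f k (dsum k.+1 a b) (dsum k a b).
Proof.
move=> fa fb; pose t i j := cf_str f (F i j) * a ^+ i * b ^+ j.
have tk i j : (k <= i)%N || (k <= j)%N -> f k (t i j).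
  by case/orP=> [ki|kj]; [apply: cf_Mr; apply: cf_M; apply: (cf_le ki)|
    apply: cf_M; apply: (cf_le kj)]; apply: cf_X.
rewrite /cf_eq /dsum big_ord_recr /= addrAC -sumrB.
apply: cf_D; apply: cf_sum => i _; last by apply: tk; rewrite leqnn.
by rewrite big_ord_recr /= addrAC subrr add0r; apply: tk; rewrite leqnn orbT.
Qed.

Lemma dsum_le k l a b : f 1 a -> f 1 b -> (k <= l)%N ->
  cf_eq f k (dsum l a b) (dsum k a b).
Proof.
move=> fa fb; elim: l => [|l IHl]; first by rewrite leqn0 => /eqP->; apply: cf_eqxx.
rewrite leq_eqVlt => /predU1P[->|]; first exact: cf_eqxx.
rewrite ltnS => kl; apply: cf_eqT (IHl kl).
by apply: (cf_eq_le kl); apply: dsumS.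
Qed.

Lemma dsum_lim a b : f 1 a -> f 1 b ->
  exists c, forall k, cf_eq f k c (dsum k a b).
Proof. by move=> fa fb; apply: (@cf_lim _ _ f) => k; apply: dsumS. Qed.

End DoubleSeries.

Section FormalSum.
Variables (R A : comNzRingType) (f : cfil R A) (F : formal_group_law R).
Implicit Types (a b c d : A) (k l : nat).
Local Notation dsum := (dsum f F).

Definition fplus a b : A := xget 0 [set c | forall k, cf_eq f k c (dsum k a b)].

Lemma fplusP a b : f 1 a -> f 1 b -> forall k, cf_eq f k (fplus a b) (dsum k a b).
Proof.
move=> fa fb; have [c cP] := dsum_lim F fa fb.
rewrite /fplus; case: xgetP => [d _ dP //|/(_ c)]; by case.
Qed.

Lemma fplus_unique a b c : f 1 a -> f 1 b ->
  (forall k, cf_eq f k c (dsum k a b)) -> fplus a b = c.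
Proof.
move=> fa fb cP; apply: (cf_eqP (f := f)) => k.
by apply: cf_eqT (fplusP fa fb k) _; apply: cf_eqC.
Qed.

Lemma dsum1 a b : dsum 1 a b = 0.
Proof. by rewrite /dsum !big_ord1 fgl_x0 rmorph0 !mul0r. Qed.

Lemma fplus1 a b : f 1 a -> f 1 b -> f 1 (fplus a b).
Proof. by move=> fa fb; have := fplusP fa fb 1; rewrite dsum1 cf_eq0. Qed.

Lemma fplusC a b : fplus a b = fplus b a.
Proof.
rewrite /fplus; congr (xget _ _); apply/funext => c /=.
have E k : dsum k a b = dsum k b a.
  rewrite /dsum exchange_big; apply: eq_bigr => i _; apply: eq_bigr => j _.
  by rewrite fgl_comm mulrAC.
by apply/propext; split=> cP k; move: (cP k); rewrite E.
Qed.

Definition fcross i j := F i.+1 j.+1.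

(** Since [F i 0] and [F 0 j] are the coefficients of the identity series, all monomials other than
    [a] and [b] are divisible by [a * b]. The truncation is at [k.+2] so that both linear terms are
    present. *)
Lemma dsumE k a b :
  dsum k.+2 a b = a + b + a * b *
    \sum_(i < k.+1) \sum_(j < k.+1) cf_str f (fcross i j) * a ^+ i * b ^+ j.
Proof.
have row0 : \sum_(j < k.+2) cf_str f (F 0 j) * a ^+ 0 * b ^+ j = b.
  rewrite big_ord_recl fgl_0x rmorph0 !mul0r add0r big_ord_recl fgl_0x rmorph1 !mul1r.
  by rewrite big1 ?addr0 ?expr1 // => j _; rewrite fgl_0x rmorph0 !mul0r.
have rowS i : \sum_(j < k.+2) cf_str f (F i.+1 j) * a ^+ i.+1 * b ^+ j =
    (if i is 0 then a else 0) +
    \sum_(j < k.+1) a * b * (cf_str f (fcross i j) * a ^+ i * b ^+ j).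
  rewrite big_ord_recl fgl_x0 mulr1; congr (_ + _).
    by case: i => [|i]; rewrite /= ?rmorph1 ?rmorph0 ?mul1r ?mul0r.
  by apply: eq_bigr => j _; rewrite /fcross !exprS; ring.
rewrite /dsum big_ord_recl row0 (eq_bigr _ (fun (i : 'I_k.+1) _ => rowS i)) big_split.
rewrite [X in _ + (X + _)]big_ord_recl /= [X in _ + (_ + X + _)]big1 // addr0.
rewrite addrA [b + a]addrC; congr (_ + _).
by rewrite mulr_sumr; apply: eq_bigr => i _; rewrite mulr_sumr.
Qed.

Lemma fplus_cross a b : f 1 a -> f 1 b -> exists c, fplus a b = a + b + a * b * c.
Proof.
move=> fa fb; have [c cP] := dsum_lim fcross fa fb; exists c.
apply: fplus_unique => // k; apply: cf_eqT (dsum_le F fa fb (leqW (leqnSn k))).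
rewrite dsumE; apply: cf_eqD; first exact: cf_eqxx.
apply: cf_eqM; first exact: cf_eqxx.
by apply: cf_eqT (cf_eqC (dsum_le fcross fa fb (leqnSn k))).
Qed.

Lemma fplus_mod2 a b : f 1 a -> f 1 b -> cf_eq f 2 (fplus a b) (a + b).
Proof.
move=> fa fb; have [c ->] := fplus_cross fa fb.
by rewrite /cf_eq addrAC subrr add0r; apply: cf_Mr; apply: (@cf_MM _ _ f 1 1).
Qed.

Lemma fplus0 a : f 1 a -> fplus a 0 = a.
Proof.
move=> fa; have [c ->] := fplus_cross fa (cf_0 f 1).
by rewrite mulr0 mul0r !addr0.
Qed.

(** [fgl_assoc] is a congruence between polynomials in three variables; evaluation at [a], [b], [c]
    sends the powers of the augmentation ideal into the filtration. *)
Lemma fplusA a b c : f 1 a -> f 1 b -> f 1 c ->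
  fplus a (fplus b c) = fplus (fplus a b) c.
Proof.
move=> fa fb fc; apply: fplus_unique => // [|k]; first exact: fplus1.
apply: cf_eqT (fplusP (fplus1 fa fb) fc k) _.
apply: cf_eqT (dsum_cong _ _ (fplusP fa fb k) (cf_eqxx f k c)) _.
apply: cf_eqT (dsum_cong _ _ (cf_eqxx f k a) (cf_eqC (fplusP fb fc k))).
pose h (i : 'I_3) := nth 0 [:: a; b; c] i.
have h1 i : f 1 (h i) by case: i => -[|[|[|]]].
have ev p q r : eval_poly (cf_str f) h (fgl_trunc F k (fgl_trunc F k p q) r -
      fgl_trunc F k p (fgl_trunc F k q r)) =
    dsum k (dsum k (eval_poly (cf_str f) h p) (eval_poly (cf_str f) h q))
      (eval_poly (cf_str f) h r) -
    dsum k (eval_poly (cf_str f) h p)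
      (dsum k (eval_poly (cf_str f) h q) (eval_poly (cf_str f) h r)).
  apply: etrans (rmorphB (eval_poly (cf_str f) h) _ _) _.
  apply: (f_equal2 (fun x y => x - y)); apply: etrans (eval_fgl_trunc _ _ _ _ _ _) _.
    apply: (f_equal2 (fun x y => dsum k x y)); [exact: eval_fgl_trunc|by []].
  by apply: (f_equal2 (fun x y => dsum k x y)); [|exact: eval_fgl_trunc].
have := eval_poly_pow h1 (fgl_assoc F k); rewrite ev.
have -> : a = eval_poly (cf_str f) h (polyvar R 0) by rewrite eval_poly_var.
have -> : b = eval_poly (cf_str f) h (polyvar R 1) by rewrite eval_poly_var.
by have -> : c = eval_poly (cf_str f) h (polyvar R 2) by rewrite eval_poly_var.
Qed.

Lemma fplus_cong k a b c d : f 1 a -> f 1 b -> f 1 c -> f 1 d ->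
  cf_eq f k a b -> cf_eq f k c d -> cf_eq f k (fplus a c) (fplus b d).
Proof.
move=> fa fb fc fd ab cd; apply: cf_eqT (fplusP fa fc k) _.
by apply: cf_eqT (dsum_cong _ _ ab cd) _; apply/cf_eqC/fplusP.
Qed.

(** The cross term of [fplus] carries the factor [a], of order 1, so its variation gains one step
    over [d]. This gain makes the iteration in [fopp_exists] converge. *)
Lemma fplus_addr k a b d : f 1 a -> f 1 b -> f k.+1 d ->
  cf_eq f k.+2 (fplus a (b + d)) (fplus a b + d).
Proof.
move=> fa fb fd; have fbd : f 1 (b + d) by apply: cf_D => //; apply: cf_le fd.
apply: cf_eqT (fplusP fa fbd k.+2) _.
apply: (@cf_eqT _ _ _ _ (dsum k.+2 a b + d)); last first.
  by apply: cf_eqD (cf_eqxx f _ d); apply/cf_eqC/fplusP.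
have bdb : cf_eq f k.+1 (b + d) b by rewrite /cf_eq addrAC subrr add0r.
rewrite !dsumE.
set C := (X in a * (b + d) * X); set D := (X in a * b * X).
have CD : cf_eq f k.+1 ((b + d) * C) (b * D).
  by apply: cf_eqM => //; apply: (@dsum_cong _ _ f fcross k.+1 k.+1 a a _ _ (cf_eqxx f _ a)).
have -> : a + b + a * b * D + d = a + (b + d) + a * (b * D) by ring.
apply: cf_eqD; first exact: cf_eqxx.
by rewrite /cf_eq -mulrA -mulrBr -add1n; apply: cf_MM.
Qed.

(** Successive approximation: [u k.+1 = u k - fplus a (u k)] moves the error from order [k.+1] to
    order [k.+2]. *)
Lemma fopp_exists a : f 1 a -> exists2 b, f 1 b & fplus b a = 0.
Proof.
move=> fa; pose u := fix u k := if k is k'.+1 then u k' - fplus a (u k') else 0.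
have uP k : f 1 (u k) /\ f k.+1 (fplus a (u k)).
  elim: k => [|k [u1 uk]] /=; first by rewrite fplus0 //; split=> //; apply: cf_0.
  split; first by apply: cf_B => //; apply: cf_le uk.
  apply: cf_eq_fil (cf_0 f _); rewrite -(subrr (fplus a (u k))).
  by apply: fplus_addr => //; apply: cf_N.
have [k|b bP] := @cf_lim _ _ f u.
  rewrite /= addrAC subrr add0r; apply: cf_N.
  by have [_] := uP k; apply: cf_le.
have b1 : f 1 b by apply: cf_eq_fil (bP 1) _; case: (uP 1).
exists b; rewrite // fplusC; apply: (cf_eqP (f := f)) => k; apply/cf_eq0.
have [u1 uk] := uP k; apply: cf_eq_fil (cf_decr uk).
by apply: fplus_cong => //; [apply: cf_eqxx|apply: bP].
Qed.

(** The points of [F] in the elements of order at least 1. [F] is a parameter of the type because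
    the group structure attached to it depends on [F]; this structure makes additive maps and
    integer multiples available. *)
Definition fpoint of formal_group_law R : Type := {a : A | `[< f 1 a >]}.
Local Notation pt := (fpoint F).
HB.instance Definition _ := SubChoice.on pt.
Definition FPoint a (fa : f 1 a) : pt :=
  exist (fun a => is_true `[< f 1 a >]) a (asboolT fa).
Lemma fpointP (p : pt) : f 1 (val p). Proof. exact: asboolW (valP p). Qed.

Definition fpoint_add (p q : pt) : pt :=
  FPoint (fplus1 (fpointP p) (fpointP q)).
Definition fpoint0 : pt := FPoint (cf_0 f 1).
Definition fpoint_opp (p : pt) : pt :=
  let ex := cid2 (fopp_exists (fpointP p)) in FPoint (s2valP ex).

Fact fpoint_addA : associative fpoint_add.
Proof. by move=> p q r; apply: val_inj; rewrite /= fplusA //; apply: fpointP. Qed.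
Fact fpoint_addC : commutative fpoint_add.
Proof. by move=> p q; apply: val_inj; rewrite /= fplusC. Qed.
Fact fpoint_add0 : left_id fpoint0 fpoint_add.
Proof. by move=> p; apply: val_inj; rewrite /= fplusC fplus0 //; apply: fpointP. Qed.
Fact fpoint_addN : left_inverse fpoint0 fpoint_opp fpoint_add.
Proof.
by move=> p; apply: val_inj; rewrite /= (s2valP' (cid2 (fopp_exists (fpointP p)))).
Qed.
HB.instance Definition _ := GRing.isZmodule.Build pt
  fpoint_addA fpoint_addC fpoint_add0 fpoint_addN.

End FormalSum.

(** * The formal group algebra as a complete filtered algebra *)

Section QuotientLift.
Variables (A B : comNzRingType) (I : idealr A) (g : {rmorphism A -> B}).
Hypothesis gI : forall a, a \in I -> g a = 0.

Definition quot_lift of (forall a, a \in I -> g a = 0) : {ideal_quot I} -> B :=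
  fun z => g (repr z).

Lemma quot_liftE a : quot_lift gI (\pi_({ideal_quot I})%qT a) = g a.
Proof.
apply: subr0_eq; rewrite -rmorphB; apply: gI.
by rewrite Quotient.idealrBE reprK.
Qed.

Fact quot_lift_zmod : zmod_morphism (quot_lift gI).
Proof.
by move=> x y; rewrite -[x]reprK -[y]reprK -rmorphB !quot_liftE rmorphB.
Qed.

Fact quot_lift_monoid : monoid_morphism (quot_lift gI).
Proof.
split=> [|x y].
  by rewrite -[X in quot_lift _ X](rmorph1 \pi_({ideal_quot I})%qT) quot_liftE rmorph1.
by rewrite -[x]reprK -[y]reprK -rmorphM !quot_liftE rmorphM.
Qed.

HB.instance Definition _ := GRing.isZmodMorphism.Build _ _ (quot_lift gI)
  quot_lift_zmod.
HB.instance Definition _ := GRing.isMonoidMorphism.Build _ _ (quot_lift gI)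
  quot_lift_monoid.

End QuotientLift.

Section IdealPowers.
Variables (A : comNzRingType) (I : idealr A).
Local Notation "I ^^ k" := (ideal_pow [set` I] k) (at level 30).

Lemma ideal_powMM i j a b : (I ^^ i) a -> (I ^^ j) b -> (I ^^ (i + j)) (a * b).
Proof.
move=> + Ib; elim: i a => [|i IHi] a; first by move=> _; apply: ideal_powM.
move: a; apply: ideal_gen_le => [|a c|a c|_ [x [y [Ix Iy ->]]]].
- by rewrite mul0r; apply: ideal_pow0.
- by rewrite mulrDl; apply: ideal_powD.
- by rewrite -mulrA; apply: ideal_powM.
- by rewrite -mulrA; apply: ideal_powS => //; apply: IHi.
Qed.

Lemma coherent_le (u : coherent_seq I) k l : (k <= l)%N ->
  (I ^^ k) (val u l - val u k).
Proof.
elim: l => [|l IHl]; first by rewrite leqn0 => /eqP->; rewrite subrr; apply: ideal_pow0.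
rewrite leq_eqVlt => /predU1P[->|]; first by rewrite subrr; apply: ideal_pow0.
rewrite ltnS => kl; rewrite -(subrK (val u l) (val u l.+1)) -addrA.
apply: ideal_powD (IHl kl); apply: (ideal_pow_le kl).
by have /coherentP := valP u.
Qed.

Lemma coherent_pow (u : coherent_seq I) k l : (k <= l)%N ->
  (I ^^ k) (val u k) <-> (I ^^ k) (val u l).
Proof.
move=> /(coherent_le u) ukl; split=> uk.
  by rewrite -(subrK (val u k) (val u l)); apply: ideal_powD.
by rewrite -(subKr (val u l) (val u k)); apply: ideal_powB.
Qed.

Lemma coherentB_fil (u v : coherent_seq I) k : val u k = val v k ->
  (I ^^ k) (val (u - v) k).
Proof.
move=> uv; have -> : val (u - v) k = val u k - val v k by [].
by rewrite uv subrr; apply: ideal_pow0.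
Qed.

Definition const_seq (a : A) : coherent_seq I := CoherentSeq (const_coherent I a).

Fact const_seq_zmod : zmod_morphism const_seq.
Proof. by move=> a b; apply: val_inj. Qed.
Fact const_seq_monoid : monoid_morphism const_seq.
Proof. by split=> [|a b]; apply: val_inj. Qed.
HB.instance Definition _ := GRing.isZmodMorphism.Build _ _ const_seq const_seq_zmod.
HB.instance Definition _ := GRing.isMonoidMorphism.Build _ _ const_seq const_seq_monoid.

End IdealPowers.

Section FormalGroupAlgebraFiltration.
Variables (R : comNzRingType) (F : formal_group_law R) (L : zmodType).
Local Notation P := (polyring R L).
Local Notation I := (aug_ideal R L).
Local Notation "I ^^ k" := (ideal_pow [set` I] k) (at level 30).
Local Notation S := (formal_group_algebra F L).
Local Notation cseq := (coherent_seq I).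

Definition fga_proj (u : cseq) : S :=
  \pi_({ideal_quot (fga_ideal F L)})%qT (\pi_({ideal_quot (null_ideal I)})%qT u).

Fact fga_proj_zmod : zmod_morphism fga_proj.
Proof. by move=> u v; rewrite /fga_proj !rmorphB. Qed.
Fact fga_proj_monoid : monoid_morphism fga_proj.
Proof. by split=> [|u v]; rewrite /fga_proj ?rmorphM ?rmorph1. Qed.
HB.instance Definition _ := GRing.isZmodMorphism.Build _ _ fga_proj fga_proj_zmod.
HB.instance Definition _ := GRing.isMonoidMorphism.Build _ _ fga_proj fga_proj_monoid.

Lemma fga_proj_surj z : exists u, z = fga_proj u.
Proof. by exists (repr (repr z)); rewrite /fga_proj !reprK. Qed.

Definition fga_poly : {rmorphism P -> S} := fga_proj \o const_seq I.
Definition fga_str : {rmorphism R -> S} := fga_poly \o malgC.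

Lemma fga_poly_var l : fga_poly (polyvar R l) = fga_var F l.
Proof. by []. Qed.

Definition fga_fil k : set S :=
  [set z | exists2 u : cseq, z = fga_proj u & (I ^^ k) (val u k)].

Fact fga_fil0 k : fga_fil k 0.
Proof. by exists 0; rewrite ?rmorph0 //; apply: ideal_pow0. Qed.

Fact fga_filD k a b : fga_fil k a -> fga_fil k b -> fga_fil k (a + b).
Proof.
move=> [u -> uk] [v -> vk]; exists (u + v); first by rewrite rmorphD.
exact: ideal_powD.
Qed.

Fact fga_fil_full a : fga_fil 0 a.
Proof. by have [u ->] := fga_proj_surj a; exists u. Qed.

Fact fga_fil_decr k : fga_fil k.+1 `<=` fga_fil k.
Proof.
move=> _ [u -> uk]; exists u => //; apply/(coherent_pow u (leqnSn k)).
exact: ideal_pow_leS uk.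
Qed.

Fact fga_filMM i j a b : fga_fil i a -> fga_fil j b -> fga_fil (i + j) (a * b).
Proof.
move=> [u -> ui] [v -> vj]; exists (u * v); first by rewrite rmorphM.
by apply: ideal_powMM; [apply/(coherent_pow u (leq_addr j i))|
  apply/(coherent_pow v (leq_addl i j))].
Qed.

(** Here the closure of the ideal of relations matters: an element of every step is, for each [k],
    within [I ^^ k] of that ideal, hence in its closure. *)
Fact fga_fil_sep a : (forall k, fga_fil k a) -> a = 0.
Proof.
have [u ->] := fga_proj_surj a => uk.
rewrite /fga_proj; set z := \pi_(_)%qT u.
suff zJ : z \in fga_ideal F L.
  by apply/eqP; rewrite -(rmorph0 \pi_({ideal_quot (fga_ideal F L)})%qT)
    -Quotient.idealrBE subr0.
apply/asboolP => k; have [v /eqP + vk] := uk k.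
rewrite /fga_proj -Quotient.idealrBE -rmorphB => /asboolP/(_ k)[y Jy [w + wk]].
move=> /eqP; rewrite subr_eq => /eqP E; exists y => //; exists (w + v).
  rewrite rmorphD -(subrK (\pi_({ideal_quot (null_ideal I)})%qT v) z) -rmorphB E.
  by rewrite addrAC addrK.
exact: ideal_powD.
Qed.

(** Lifting the successive differences, and not the terms, yields partial sums [y] that are coherent
    sequences and whose diagonal [w] is coherent too; its class is the limit. *)
Fact fga_fil_lim (z : nat -> S) : (forall k, fga_fil k (z k.+1 - z k)) ->
  exists l, forall k, fga_fil k (l - z k).
Proof.
move=> dz; have [v zv] := fga_proj_surj (z 0).
have /choice[d dP] k : exists u : cseq, z k.+1 - z k = fga_proj u /\ (I ^^ k) (val u k).
  by have [u] := dz k; exists u.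
pose y n : cseq := v + \sum_(j < n) d j.
have yS n : y n.+1 = y n + d n by rewrite /y big_ord_recr addrA.
pose w n := val (y n) n.
have wc : w \in coherent I.
  apply/coherentP => k; have wS : w k.+1 = val (y k) k.+1 + val (d k) k.+1.
    by rewrite /w yS.
  rewrite wS addrAC; apply: ideal_powD; first exact: coherent_le.
  by apply/(coherent_pow (d k) (leqnSn k)); case: (dP k).
exists (fga_proj (CoherentSeq wc)) => k.
have -> : z k = fga_proj (y k).
  elim: k => [|k IHk]; first by rewrite /y big_ord0 addr0.
  rewrite yS -[LHS](subrK (z k)) (proj1 (dP k)) IHk addrC.
  exact/esym/(rmorphD fga_proj).
exists (CoherentSeq wc - y k); first by rewrite rmorphB.
exact: coherentB_fil.
Qed.

Definition fga_cfil : cfil R S := @CFil R S fga_str fga_fil fga_fil0 fga_filD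
  fga_fil_full fga_fil_decr fga_filMM fga_fil_sep fga_fil_lim.

Lemma fga_poly_approx u k : cf_eq fga_cfil k (fga_proj u) (fga_poly (val u k)).
Proof.
exists (u - const_seq I (val u k)); first by rewrite rmorphB.
exact: coherentB_fil.
Qed.

Lemma fga_var1 l : fga_cfil 1 (fga_var F l).
Proof.
exists (const_seq I (polyvar R l)) => //.
by rewrite -[val _ _]mulr1; apply: (@ideal_powS _ _ 0); [apply: polyvar_aug|].
Qed.

Lemma fga_poly_trunc k p q :
  fga_poly (fgl_trunc F k p q) = dsum fga_cfil F k (fga_poly p) (fga_poly q).
Proof.
rewrite /fgl_trunc /dsum (rmorph_sum fga_poly); apply: eq_bigr => i _.
rewrite (rmorph_sum fga_poly); apply: eq_bigr => j _.
apply: etrans (rmorphM fga_poly _ _) _; apply: f_equal2; last exact: rmorphXn.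
by apply: etrans (rmorphM fga_poly _ _) _; apply: f_equal2; last exact: rmorphXn.
Qed.

Lemma fga_varD l m : fga_var F (l + m) = fplus fga_cfil F (fga_var F l) (fga_var F m).
Proof.
apply/esym/fplus_unique => [||k]; try exact: fga_var1.
rewrite -!fga_poly_var -fga_poly_trunc fga_poly_var.
have -> : fga_var F (l + m) = fga_proj (CoherentSeq (fgl_eval_coherent F l m)).
  apply/eqP; rewrite -Quotient.idealrBE; apply/asboolP => j.
  exists (psvar R (l + m) - fgl_eval F l m).
    by apply: ideal_gen_sub; right; exists l, m.
  by exists 0; rewrite ?subrr ?rmorph0 //; apply: ideal_pow0.
exact: (fga_poly_approx (CoherentSeq (fgl_eval_coherent F l m))).
Qed.

Lemma fga_var0 : fga_var F (0 : L) = 0.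
Proof.
apply/eqP; rewrite -(rmorph0 \pi_({ideal_quot (fga_ideal F L)})%qT).
rewrite -Quotient.idealrBE subr0; apply/asboolP => k.
exists (psvar R 0); first by apply: ideal_gen_sub; left.
by exists 0; rewrite ?subrr ?rmorph0 //; apply: ideal_pow0.
Qed.

Definition fga_point (l : L) : fpoint fga_cfil F := FPoint F (fga_var1 l).

Lemma fga_pointD l m : fga_point (l + m) = fga_point l + fga_point m.
Proof. by apply: val_inj; rewrite /= fga_varD. Qed.

End FormalGroupAlgebraFiltration.

(** * Universal property of the formal group algebra *)

Section UniversalProperty.
Variables (R A : comNzRingType) (F : formal_group_law R) (L : zmodType).
Variable f : cfil R A.
Local Notation P := (polyring R L).
Local Notation I := (aug_ideal R L).
Local Notation "I ^^ k" := (ideal_pow [set` I] k) (at level 30).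
Local Notation S := (formal_group_algebra F L).
Local Notation cseq := (coherent_seq I).

(** Polynomials in the [x_l] approximate every element to any order ([fga_poly_approx]), and both
    morphisms respect the filtrations. *)
Lemma fga_morph_eq (g1 g2 : {rmorphism S -> A}) :
  (forall k z, fga_cfil F L k z -> f k (g1 z)) ->
  (forall k z, fga_cfil F L k z -> f k (g2 z)) ->
  (forall c, g1 (fga_str F L c) = g2 (fga_str F L c)) ->
  (forall l, g1 (fga_var F l) = g2 (fga_var F l)) -> g1 =1 g2.
Proof.
move=> f1 f2 gC gV z; have [u ->] := fga_proj_surj z.
have gP p : g1 (fga_poly F L p) = g2 (fga_poly F L p).
  exact: (@polyring_morph_eq _ _ _ (g1 \o fga_poly F L) (g2 \o fga_poly F L)).
apply: (cf_eqP (f := f)) => k; have uk := fga_poly_approx F u k.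
apply: (@cf_eqT _ _ _ _ (g1 (fga_poly F L (val u k)))).
  by rewrite /cf_eq -rmorphB; apply: f1.
by rewrite gP; apply: cf_eqC; rewrite /cf_eq -rmorphB; apply: f2.
Qed.

Variable h : {additive L -> fpoint f F}.
Local Notation ev := (eval_poly (cf_str f) (fun l => val (h l))).

Let h1 l : f 1 (val (h l)). Proof. exact: fpointP. Qed.

Definition fga_lim (u : cseq) : A :=
  xget 0 [set a | forall k, cf_eq f k a (ev (val u k))].

Lemma fga_limP u k : cf_eq f k (fga_lim u) (ev (val u k)).
Proof.
rewrite /fga_lim; case: xgetP => [d _ dP //|].
have [j|a aP /(_ a)] := @cf_lim _ _ f (fun k => ev (val u k)); last by case.
by rewrite -rmorphB; apply: eval_poly_pow => //; apply: coherent_le.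
Qed.

Lemma fga_lim_unique u a : (forall k, cf_eq f k a (ev (val u k))) -> fga_lim u = a.
Proof.
move=> aP; apply: (cf_eqP (f := f)) => k.
by apply: cf_eqT (fga_limP u k) _; apply: cf_eqC.
Qed.

Fact fga_lim_zmod : zmod_morphism fga_lim.
Proof.
move=> u v; apply: fga_lim_unique => k.
have -> : ev (val (u - v) k) = ev (val u k) - ev (val v k) by exact: rmorphB.
by apply: cf_eqB; apply: fga_limP.
Qed.

Fact fga_lim_monoid : monoid_morphism fga_lim.
Proof.
split=> [|u v]; apply: fga_lim_unique => k.
  by rewrite [ev _](rmorph1 ev); apply: cf_eqxx.
have -> : ev (val (u * v) k) = ev (val u k) * ev (val v k) by exact: rmorphM.
by apply: cf_eqM; apply: fga_limP.
Qed.

HB.instance Definition _ := GRing.isZmodMorphism.Build _ _ fga_lim fga_lim_zmod.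
HB.instance Definition _ := GRing.isMonoidMorphism.Build _ _ fga_lim fga_lim_monoid.

Lemma fga_lim_fil u k : (I ^^ k) (val u k) -> f k (fga_lim u).
Proof. by move=> uk; apply: cf_eq_fil (fga_limP u k) _; apply: eval_poly_pow. Qed.

Fact fga_lim_null u : u \in null_ideal I -> fga_lim u = 0.
Proof.
by move=> /asboolP un; apply: (@cf_sep _ _ f) => k; apply: fga_lim_fil (un k).
Qed.

Let ps_lim : {rmorphism power_series R L -> A} := quot_lift fga_lim_null.

Let ps_lim_proj u : ps_lim (\pi_({ideal_quot (null_ideal I)})%qT u) = fga_lim u.
Proof. exact: quot_liftE. Qed.

Let ps_lim_var l : ps_lim (psvar R l) = val (h l).
Proof.
rewrite /psvar /to_completion ps_lim_proj; apply: fga_lim_unique => k.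
by rewrite [ev _]eval_poly_var; apply: cf_eqxx.
Qed.

Fact fga_lim_ideal z : z \in fga_ideal F L -> ps_lim z = 0.
Proof.
move=> /asboolP Jz; apply: (@cf_sep _ _ f) => k; have [y Jy [u zy uk]] := Jz k.
rewrite -(subrK y z) rmorphD zy ps_lim_proj; apply: cf_D; first exact: fga_lim_fil.
suff -> : ps_lim y = 0 by apply: cf_0.
move: y Jy {zy}; apply: ideal_gen_le => [|a b a0 b0|a b b0|_ [->|[l [m ->]]]].
- exact: rmorph0.
- by rewrite rmorphD a0 b0 addr0.
- by rewrite rmorphM b0 mulr0.
- by rewrite ps_lim_var raddf0.
- rewrite rmorphB ps_lim_var ps_lim_proj raddfD /=; apply/eqP.
  rewrite subr_eq0; apply/eqP/esym/fga_lim_unique => j.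
  rewrite [ev _]eval_fgl_trunc !eval_poly_var.
  by apply: fplusP; apply: fpointP.
Qed.

(** The continuous morphism of [R]-algebras with [x_l] sent to [h l]; additivity of [h] is what
    kills the defining relations. *)
Definition fga_lift : {rmorphism S -> A} := quot_lift fga_lim_ideal.

Lemma fga_lift_proj u : fga_lift (fga_proj F u) = fga_lim u.
Proof. exact: etrans (quot_liftE _ _) (ps_lim_proj _). Qed.

Lemma fga_lift_fil k z : fga_cfil F L k z -> f k (fga_lift z).
Proof. by move=> [u -> uk]; rewrite fga_lift_proj; apply: fga_lim_fil. Qed.

Lemma fga_lift_str c : fga_lift (fga_str F L c) = cf_str f c.
Proof.
rewrite [LHS]fga_lift_proj; apply: fga_lim_unique => k.
by rewrite [ev _]eval_poly_const; apply: cf_eqxx.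
Qed.

Lemma fga_lift_var l : fga_lift (fga_var F l) = val (h l).
Proof. exact: etrans (quot_liftE _ _) (ps_lim_var _). Qed.

End UniversalProperty.

(** * Power series over a complete filtered algebra *)

Section SeriesFiltration.
Variables (R A : comNzRingType) (f : cfil R A).
Local Notation T := (series A).

(** Order by total degree: the variable has order 1 and a coefficient keeps its own order. *)
Definition series_fil k : set T :=
  [set p | forall i, (i <= k)%N -> f (k - i)%N (p i)].

Fact series_fil0 k : series_fil k 0.
Proof. by move=> i _; apply: cf_0. Qed.
Fact series_filD k p q : series_fil k p -> series_fil k q -> series_fil k (p + q).
Proof. by move=> pk qk i ik; rewrite seriesD; apply: cf_D; [apply: pk|apply: qk]. Qed.
Fact series_fil_full p : series_fil 0 p.
Proof. by move=> i; rewrite leqn0 => /eqP->; apply: cf_full. Qed.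
Fact series_fil_decr k : series_fil k.+1 `<=` series_fil k.
Proof.
move=> p pk i ik; apply: (cf_le _ (pk i (leqW ik))).
by rewrite leq_sub2r.
Qed.
Fact series_filMM i j p q :
  series_fil i p -> series_fil j q -> series_fil (i + j) (p * q).
Proof.
move=> pi qj n nij; rewrite seriesM; apply: cf_sum => a _.
have fp : f (i - a)%N (p a).
  have [ai|/ltnW/eqP->] := leqP a i; [exact: pi|exact: cf_full].
have fq : f (j - (n - a))%N (q (n - a)%N).
  have [aj|/ltnW/eqP->] := leqP (n - a) j; [exact: qj|exact: cf_full].
by apply: cf_le (cf_MM fp fq); have := ltn_ord a; lia.
Qed.
Fact series_fil_sep p : (forall k, series_fil k p) -> p = 0.
Proof.
move=> pk; apply/funext => i; apply: (@cf_sep _ _ f) => k.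
by have := pk (k + i)%N i (leq_addl _ _); rewrite addnK.
Qed.
Fact series_fil_lim (u : nat -> T) : (forall k, series_fil k (u k.+1 - u k)) ->
  exists l, forall k, series_fil k (l - u k).
Proof.
move=> du; have /choice[l lP] i :
    exists a, forall k, f k (a - u (k + i)%N i).
  apply: (@cf_lim _ _ f) => k.
  by have := du (k + i)%N i (leq_addl _ _); rewrite addnK.
exists l => k i ik; have := lP i (k - i)%N; rewrite subnK //.
Qed.

Definition series_cfil : cfil R T := @CFil R T (@series_const A \o cf_str f)
  series_fil series_fil0 series_filD series_fil_full series_fil_decr series_filMM
  series_fil_sep series_fil_lim.

Lemma series_const_fil k a : f k a -> series_cfil k (series_const a).
Proof. by move=> fa [|i] _; [rewrite subn0|apply: cf_0]. Qed.

Lemma series_coef0_fil k p : series_cfil k p -> f k (series_coef0 p).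
Proof. by move=> /(_ 0 (leq0n k)); rewrite subn0. Qed.

Lemma series_var1 : series_cfil 1 (series_var A).
Proof. by move=> -[|[|i]] // _; [apply: cf_0|apply: cf_full]. Qed.

Section Lift.
Variables (B : comNzRingType) (g : cfil R B) (psi : {rmorphism A -> B}) (y : B).
Hypothesis psi_fil : forall k a, f k a -> g k (psi a).
Hypothesis y1 : g 1 y.

Let ev : {rmorphism {poly A} -> B} := horner_morph (fun a => mulrC y (psi a)).
Let trunc k (p : T) : {poly A} := \poly_(i < k) p i.

Let ev_fil k (P : {poly A}) : (forall i, f (k - i)%N P`_i) -> g k (ev P).
Proof.
move=> Pk; rewrite /ev /= /horner_morph /map_poly horner_poly.
apply: cf_sum => i _; apply: cf_le (cf_MM (psi_fil (Pk i)) (cf_X i y1)).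
by lia.
Qed.

Let ev_eq k (P Q : {poly A}) : (forall i, (i < k)%N -> P`_i = Q`_i) ->
  cf_eq g k (ev P) (ev Q).
Proof.
move=> PQ; rewrite /cf_eq -rmorphB; apply: ev_fil => i; rewrite coefB.
have [ik|ki] := ltnP i k; first by rewrite PQ // subrr; apply: cf_0.
by have /eqP-> : (k - i == 0)%N by []; apply: cf_full.
Qed.

Definition series_lift of (forall k a, f k a -> g k (psi a)) & g 1 y :=
  fun p : T => xget 0 [set b | forall k, cf_eq g k b (ev (trunc k p))].
Local Notation lift := (series_lift psi_fil y1).

Lemma series_liftP p k : cf_eq g k (lift p) (ev (trunc k p)).
Proof.
rewrite /series_lift; case: xgetP => [d _ dP //|].
have [j|a aP /(_ a)] := @cf_lim _ _ g (fun k => ev (trunc k p)); last by case.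
by apply: ev_eq => i ij; rewrite !coef_poly ij ltnS (ltnW ij).
Qed.

Lemma series_lift_unique p b : (forall k, cf_eq g k b (ev (trunc k p))) ->
  lift p = b.
Proof.
move=> bP; apply: (cf_eqP (f := g)) => k.
by apply: cf_eqT (series_liftP p k) _; apply: cf_eqC.
Qed.

Fact series_lift_zmod : zmod_morphism lift.
Proof.
move=> p q; apply: series_lift_unique => k.
apply: cf_eqT (cf_eqB (series_liftP p k) (series_liftP q k)) _.
rewrite -rmorphB; apply: ev_eq => i ik.
by rewrite coefB !coef_poly ik.
Qed.

Fact series_lift_monoid : monoid_morphism lift.
Proof.
split=> [|p q]; apply: series_lift_unique => k.
  rewrite -(rmorph1 ev); apply: ev_eq => i ik.
  by rewrite coef1 coef_poly ik; case: i {ik}.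
apply: cf_eqT (cf_eqM (series_liftP p k) (series_liftP q k)) _.
rewrite -rmorphM; apply: ev_eq => i ik.
rewrite coef_poly ik seriesM coefM; apply: eq_bigr => j _.
by rewrite !coef_poly !ifT //; have := ltn_ord j; lia.
Qed.

HB.instance Definition _ := GRing.isZmodMorphism.Build _ _ lift
  series_lift_zmod.
HB.instance Definition _ := GRing.isMonoidMorphism.Build _ _ lift
  series_lift_monoid.

Lemma series_lift_fil k p : series_cfil k p -> g k (lift p).
Proof.
move=> pk; apply: cf_eq_fil (series_liftP p k) _; apply: ev_fil => i.
by rewrite coef_poly; case: ifP => [/ltnW/pk //|_]; apply: cf_0.
Qed.

Lemma series_lift_const a : lift (series_const a) = psi a.
Proof.
apply: series_lift_unique => k; have <- : ev a%:P = psi a by apply: horner_morphC.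
by apply: ev_eq => i ik; rewrite coef_poly coefC ik; case: i {ik}.
Qed.

Lemma series_lift_var : lift (series_var A) = y.
Proof.
apply: series_lift_unique => k; have <- : ev 'X = y by apply: horner_morphX.
by apply: ev_eq => i ik; rewrite coef_poly coefX ik.
Qed.

End Lift.
End SeriesFiltration.

(** [A] is the ring of power series in [m] variables over [R], obtained by iterating [series].
    Independence of the variables to first order and the mapping property are its purpose; the
    clause on integers carries characteristic 0 through the induction. *)
Lemma cfil_model (R : comNzRingType) (m : nat) : no_zero_divisor R ->
  (forall c : int, c%:~R = 0 :> R -> c = 0) ->
  exists (A : comNzRingType) (f : cfil R A) (t : 'I_m -> A),
    [/\ no_zero_divisor A, forall i, f 1 (t i),
        forall c : 'I_m -> int, f 2 (\sum_i t i *~ c i) -> forall i, c i = 0,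
        forall c : int, f 1 c%:~R -> c = 0 &
        forall (B : comNzRingType) (g : cfil R B) (y : 'I_m -> B),
          (forall i, g 1 (y i)) ->
          exists psi : {rmorphism A -> B},
            [/\ forall k a, f k a -> g k (psi a),
                forall c, psi (cf_str f c) = cf_str g c &
                forall i, psi (t i) = y i]].
Proof.
move=> domR charR; elim: m => [|m [A [f [t [domA t1 tI tZ tpsi]]]]].
  (* With no variable, step 0 is everything and the other steps are 0, so a sequence as in [cf_lim]
     is constant from index 1 on. *)
  pose fil k : set R := if k is 0 then setT else [set 0].
  have f0 k : fil k 0 by case: k.
  have fD k a b : fil k a -> fil k b -> fil k (a + b).
    by case: k => //= k -> ->; rewrite addr0.
  have ff a : fil 0 a by [].
  have fd k : fil k.+1 `<=` fil k by move=> a ->; apply: f0.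
  have fM i j a b : fil i a -> fil j b -> fil (i + j)%N (a * b).
    case: i => [|i]; last by move=> -> _; rewrite mul0r; apply: f0.
    by case: j => [|j] //= _ ->; rewrite mulr0.
  have fs a : (forall k, fil k a) -> a = 0 by move=> /(_ 1).
  have fl (u : nat -> R) : (forall k, fil k (u k.+1 - u k)) ->
      exists l, forall k, fil k (l - u k).
    move=> du; exists (u 1); elim=> // k IHk; rewrite /=.
    elim: {IHk} k => [|k IHk]; first by rewrite subrr.
    by rewrite -(subrK (u k.+1) (u 1)) IHk add0r -opprB (du k.+1) oppr0.
  exists R, (@CFil R R idfun fil f0 fD ff fd fM fs fl), (fun _ => 0); split=> //.
  - by move=> c _ [].
  - move=> B g y _; exists (cf_str g); split=> // [k a|[]//].
    by case: k => [|k] /= => [_|->]; rewrite ?rmorph0; [apply: cf_full|apply: cf_0].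
pose t' i := if unlift ord0 i is Some j then series_const (t j) else series_var A.
have t'0 : t' ord0 = series_var A by rewrite /t' unlift_none.
have t'S i : t' (lift ord0 i) = series_const (t i) by rewrite /t' liftK.
exists (series A), (series_cfil f), t'; split.
- exact: series_domain.
- by move=> i; rewrite /t'; case: unliftP => [j _|_];
    [apply: series_const_fil|apply: series_var1].
- move=> c; rewrite big_ord_recl t'0.
  under eq_bigr do rewrite t'S.
  have -> : \sum_(i < m) series_const (t i) *~ c (lift ord0 i) =
      series_const (\sum_(i < m) t i *~ c (lift ord0 i)).
    by rewrite rmorph_sum; apply: eq_bigr => i _; rewrite rmorphMz.
  have sMz (p : series A) (z : int) n : (p *~ z) n = p n *~ z.
    have sMn k : (p *+ k) n = p n *+ k.
      by elim: k => // k IHk; rewrite !mulrS seriesD IHk.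
    by case: z => k; rewrite -?NegzE; [exact: sMn|exact: (congr1 -%R (sMn k.+1))].
  (* The coefficient of degree 0 lies in step 2 and is the sum over the old variables; that of
     degree 1 lies in step 1 and is the integer [c ord0]. *)
  move=> fc i; case: (unliftP ord0 i) => [j|] ->.
    apply: (tI (fun j => c (lift ord0 j))) j.
    by have := fc 0 isT; rewrite seriesD sMz mul0rz add0r.
  apply: tZ; have := fc 1 isT; rewrite seriesD sMz /= addr0 //.
- move=> c /(_ 0 isT) H; apply: tZ; move: H.
  by have -> : (c%:~R : series A) 0 = c%:~R by exact: (rmorph_int (@series_coef0 A)).
- move=> B g y y1; have [psi [psiF psiR psit]] := tpsi B g (fun i => y (lift ord0 i)) (fun i => y1 _).
  exists (series_lift psiF (y1 ord0)); split.
  + exact: series_lift_fil.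
  + by move=> c; rewrite [LHS]series_lift_const psiR.
  + move=> i; case: (unliftP ord0 i) => [j|] ->; last first.
      by rewrite t'0; exact: series_lift_var.
    by rewrite t'S; exact: etrans (series_lift_const _ _ _) (psit j).
Qed.

(** * Functoriality *)

Section FormalPointMap.
Variables (R A B : comNzRingType) (F : formal_group_law R).
Variables (f : cfil R A) (g : cfil R B) (psi : {rmorphism A -> B}).
Hypothesis psi_fil : forall k a, f k a -> g k (psi a).
Hypothesis psi_str : forall c, psi (cf_str f c) = cf_str g c.

Lemma fplus_morph a b : f 1 a -> f 1 b ->
  psi (fplus f F a b) = fplus g F (psi a) (psi b).
Proof.
move=> fa fb; apply/esym/fplus_unique => [||k]; try exact: psi_fil.
have -> : dsum g F k (psi a) (psi b) = psi (dsum f F k a b).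
  rewrite /dsum rmorph_sum; apply: eq_bigr => i _.
  rewrite rmorph_sum; apply: eq_bigr => j _.
  by rewrite !rmorphM !rmorphXn psi_str.
by rewrite /cf_eq -rmorphB; apply/psi_fil/fplusP.
Qed.

Definition fpoint_map of (forall c, psi (cf_str f c) = cf_str g c) :=
  fun p : fpoint f F => FPoint F (psi_fil (fpointP p)).
Local Notation pmap := (fpoint_map psi_str).

Fact fpoint_map_semi : nmod_morphism pmap.
Proof.
split=> [|p q]; apply: val_inj; first exact: rmorph0.
by apply: fplus_morph; apply: fpointP.
Qed.
HB.instance Definition _ := GRing.isNmodMorphism.Build _ _ pmap fpoint_map_semi.

Lemma fpoint_mapE p : val (pmap p) = psi (val p).
Proof. by []. Qed.

End FormalPointMap.

(** * First-order terms of formal sums *)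

Section FormalPointLinear.
Variables (R A : comNzRingType) (F : formal_group_law R) (f : cfil R A).
Implicit Types p q : fpoint f F.

Lemma fpointD_mod2 p q : cf_eq f 2 (val (p + q)) (val p + val q).
Proof. by apply: fplus_mod2; apply: fpointP. Qed.

Lemma fpointMn_mod2 p k : cf_eq f 2 (val (p *+ k)) (val p *+ k).
Proof.
elim: k => [|k IHk]; first exact: cf_eqxx.
rewrite !mulrS; apply: cf_eqT (fpointD_mod2 _ _) _.
by apply: cf_eqD; first exact: cf_eqxx.
Qed.

Lemma fpointN_mod2 p : cf_eq f 2 (val (- p)) (- val p).
Proof.
apply: cf_eqC; rewrite /cf_eq -opprD -[X in f 2 (- X)]subr0; apply: cf_N.
have := fpointD_mod2 p (- p); rewrite subrr => /cf_eqC; exact.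
Qed.

Lemma fpointMz_mod2 p c : cf_eq f 2 (val (p *~ c)) (val p *~ c).
Proof.
case: c => k; first exact: fpointMn_mod2.
rewrite NegzE !mulrNz; apply: cf_eqT (fpointN_mod2 _) _.
have := cf_eqB (cf_eqxx f 2 0) (fpointMn_mod2 p k.+1).
by rewrite !sub0r.
Qed.

Lemma fpoint_sum_mod2 (I : Type) (r : seq I) (P : pred I) (p : I -> fpoint f F) :
  cf_eq f 2 (val (\sum_(i <- r | P i) p i)) (\sum_(i <- r | P i) val (p i)).
Proof.
elim/big_rec2: _ => [|i a q _ IH]; first exact: cf_eqxx.
by apply: cf_eqT (fpointD_mod2 _ _) _; apply: cf_eqD; first exact: cf_eqxx.
Qed.

End FormalPointLinear.

Lemma coherent_map_pow (A B : comNzRingType) (I : idealr A) (J : idealr B)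
    (f : {rmorphism A -> B}) (IJ : forall a, a \in I -> f a \in J)
    (u : coherent_seq I) k :
  ideal_pow [set` I] k (val u k) -> ideal_pow [set` J] k (val (coherent_map IJ u) k).
Proof. exact: (@ideal_pow_morph _ _ f [set` I] [set` J]). Qed.

Section FormalGroupAlgebraFunctoriality.
Variables (R : comNzRingType) (F : formal_group_law R) (L M : zmodType).
Variable g : {additive L -> M}.

Lemma fga_map_proj u :
  fga_map F g (fga_proj F u) = fga_proj F (coherent_map (@rename_aug R L M g) u).
Proof.
apply: etrans (quot_mapE _ _) _; congr (\pi_(_)%qT _); exact: quot_mapE.
Qed.

Lemma fga_map_fil k z : fga_cfil F L k z -> fga_cfil F M k (fga_map F g z).
Proof.
move=> [u -> uk]; rewrite fga_map_proj.
exists (coherent_map (@rename_aug R L M g) u) => //.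
exact: coherent_map_pow.
Qed.

Lemma fga_map_str c : fga_map F g (fga_str F L c) = fga_str F M c.
Proof.
apply: etrans (fga_map_proj _) _; congr (fga_proj F _).
by apply/val_inj/funext => k /=; apply: rename_const.
Qed.

End FormalGroupAlgebraFunctoriality.

Section FormalGroupAlgebraActs.
Variables (R : comNzRingType) (F : formal_group_law R) (L : zmodType).
Local Notation S := (formal_group_algebra F L).

Lemma fga_morph_id (g : {rmorphism S -> S}) :
  (forall k z, fga_cfil F L k z -> fga_cfil F L k (g z)) ->
  (forall c, g (fga_str F L c) = fga_str F L c) ->
  (forall l, g (fga_var F l) = fga_var F l) -> g =1 id.
Proof. by move=> gF gR gV; apply: (@fga_morph_eq _ _ _ _ (fga_cfil F L) g idfun). Qed.

Lemma fga_map_id (g : {additive L -> L}) : g =1 id -> fga_map F g =1 id.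
Proof.
move=> gid; apply: fga_morph_id => [||l]; first exact: fga_map_fil.
  exact: fga_map_str.
by rewrite fga_map_var gid.
Qed.

Lemma fga_map_comp (g h k : {additive L -> L}) : k =1 g \o h ->
  fga_map F k =1 fga_map F g \o fga_map F h.
Proof.
move=> kgh; apply: (@fga_morph_eq _ _ _ _ (fga_cfil F L)).
- exact: fga_map_fil.
- by move=> j z jz; apply/fga_map_fil/fga_map_fil.
- by move=> c; rewrite /= !fga_map_str.
- by move=> l; rewrite /= !fga_map_var kgh.
Qed.

(** Since [0 = x_0 = F(x_l, x_(-l))] *)
Lemma fga_varN (l : L) : exists c,
  fga_var F l + fga_var F (- l) = fga_var F l * fga_var F (- l) * c.
Proof.
have [c] := fplus_cross F (fga_var1 F l) (fga_var1 F (- l)).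
rewrite -fga_varD subrr fga_var0 => /esym/eqP; rewrite addr_eq0 => /eqP E.
by exists (- c); rewrite mulrN -E.
Qed.

Lemma fga_varN_dvd (l : L) : exists u, fga_var F l = fga_var F (- l) * u.
Proof.
have [c E] := fga_varN l; exists (fga_var F l * c - 1).
rewrite mulrBr mulr1 mulrA [fga_var F (- l) * _]mulrC -E addrK //.
Qed.

End FormalGroupAlgebraActs.

Fact fga_point_nmod (R : comNzRingType) (F : formal_group_law R) (L : zmodType) :
  nmod_morphism (@fga_point R F L).
Proof.
split=> [|l m]; last exact: fga_pointD.
by apply: val_inj; apply: fga_var0.
Qed.
HB.instance Definition _ R F L := GRing.isNmodMorphism.Build _ _ _
  (@fga_point_nmod R F L).

(** * Primes of the formal group algebra *)

Definition rdvd (A : comPzRingType) (a b : A) : Prop := exists c, b = a * c.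

Section FormalGroupAlgebraOfLattice.
Variables (R : comNzRingType) (F : formal_group_law R) (L : zmodType).
Hypothesis domR : no_zero_divisor R.
Hypothesis charR : forall c : int, c%:~R = 0 :> R -> c = 0.
Variables (m : nat) (b : 'I_m -> L) (coord : 'I_m -> {additive L -> int}).
Hypothesis coordP : forall l, l = \sum_j b j *~ coord j l.
Hypothesis coordB : forall i j, coord j (b i) = (i == j)%:~R.
Local Notation S := (formal_group_algebra F L).
Local Notation x := (fga_var F).

(** [rho] is the reduction modulo [x_(b j)] *)
Lemma fga_reduction (j0 : 'I_m) : no_zero_divisor S /\
  exists (A : comNzRingType) (f : cfil R A) (rho : {rmorphism S -> A}),
    [/\ no_zero_divisor A,
       (forall k z, fga_cfil F L k z -> f k (rho z)) /\
         (forall c, rho (fga_str F L c) = cf_str f c),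
       forall z, rho z = 0 <-> exists z', z = x (b j0) * z',
       x (b j0) <> 0 &
       forall l, rho (x l) = 0 -> l = b j0 *~ coord j0 l].
Proof.
have [A [f [t [domA t1 tI tZ tpsi]]]] := cfil_model m domR charR.
pose T := series A; pose g := series_cfil f.
(* [b j0] is sent to the new variable of [T] and not to [t j0], so that reduction modulo it is
   [series_coef0]. As [t j0] is left over, [phi] is used only as an injection with the retraction
   [psi']. *)
pose p j : fpoint g F := if j == j0 then FPoint F (series_var1 f)
  else FPoint F (series_const_fil (t1 j)).
have [h hE] : exists h : {additive L -> fpoint g F},
    forall l, h l = \sum_j p j *~ coord j l.
  pose h0 l : fpoint g F := \sum_j p j *~ coord j l.
  have h0_zmod : zmod_morphism h0.
    by move=> l l'; rewrite /h0 -sumrB; apply: eq_bigr => j _; rewrite raddfB mulrzBr.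
  pose hm := GRing.isZmodMorphism.Build _ _ h0 h0_zmod.
  by exists (HB.pack h0 hm : {additive L -> fpoint g F}).
pose phi : {rmorphism S -> T} := fga_lift h.
have phi_x l : phi (x l) = val (h l) by apply: fga_lift_var.
have [psi [psiF psiR psit]] := tpsi S (fga_cfil F L) (fun j => x (b j)) (fun j => fga_var1 F (b j)).
pose psi' : {rmorphism T -> S} := series_lift psiF (fga_var1 F (b j0)).
have psi'F k a : g k a -> fga_cfil F L k (psi' a) by apply: series_lift_fil.
have psi'R c : psi' (cf_str g c) = fga_str F L c.
  by rewrite [LHS]series_lift_const psiR.
have phiK : cancel phi psi'.
  apply: (fga_morph_id (g := psi' \o phi)) => [k z zk|c|l] /=.
  - by apply/psi'F/fga_lift_fil.
  - by rewrite -[RHS]psi'R; congr (psi' _); apply: fga_lift_str.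
  transitivity (val (fpoint_map psi'F psi'R (h l))).
    exact: (congr1 psi' (phi_x l)).
  have -> : fpoint_map psi'F psi'R (h l) = fga_point F l; last by [].
  have pP j : fpoint_map psi'F psi'R (p j) = fga_point F (b j).
    apply: val_inj; rewrite fpoint_mapE /p; case: eqP => [->|_].
      exact: series_lift_var.
    by apply: etrans (series_lift_const _ _ _) (psit j).
  rewrite [in RHS](coordP l) hE !raddf_sum; apply: eq_bigr => j _.
  by rewrite !raddfMz; congr (_ *~ _); exact: pP.
have hb : h (b j0) = p j0.
  rewrite hE (bigD1 j0) // big1 => [|j /andP[_ /negbTE j0j]].
    by apply: etrans (addr0 _) _; rewrite coordB eqxx mulr1z.
  by rewrite coordB eq_sym j0j mulr0z.
have phi_xb : phi (x (b j0)) = series_var A by rewrite phi_x hb /p eqxx.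
have x_n0 : x (b j0) <> 0.
  move=> x0; move: phi_xb; rewrite x0 rmorph0 => /(congr1 (fun s : T => s 1)).
  by move=> /esym/eqP; rewrite oner_eq0.
split.
  move=> z z' /(congr1 phi); rewrite rmorphM rmorph0 => /(series_domain domA).
  by rewrite -(rmorph0 phi) => -[]/(can_inj phiK); [left|right].
exists A, f, (@series_coef0 A \o phi); split=> //.
- split=> [k z zk|c]; first by apply/series_coef0_fil/fga_lift_fil.
  exact: (congr1 (@series_coef0 A) (fga_lift_str h c)).
(* The quotient [s] of [phi z] by the variable may lie outside the image of [phi]; the retraction
   brings it back to [S]. *)
- move=> z; split=> [/series_var_dvd[s phis]|[z' ->]].
    exists (psi' s); rewrite -[LHS]phiK phis rmorphM; congr (_ * _).
    exact: series_lift_var.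
  change (series_coef0 (phi (x (b j0) * z')) = 0).
  by rewrite (rmorphM phi) phi_xb; apply: series_varM.
move=> l; change (series_coef0 (phi (x l)) = 0 -> l = b j0 *~ coord j0 l).
rewrite phi_x => hl0; pose c j := if j == j0 then 0 else coord j l.
(* Modulo order 2 the image of [x l] is its linear part, whose constant coefficient keeps the [t j]
   with [j != j0]; their independence kills these coordinates. *)
have /tI c0 : f 2 (\sum_j t j *~ c j).
  have : cf_eq g 2 (val (h l)) (\sum_j val (p j) *~ coord j l).
    rewrite hE; apply: cf_eqT (fpoint_sum_mod2 _ _ _) _.
    by apply: cf_eq_sum => j _; apply: fpointMz_mod2.
  set X := \sum_j _ => /series_coef0_fil.
  have -> : series_coef0 (val (h l) - X) = - series_coef0 X.
    rewrite rmorphB; exact: etrans (congr1 (fun a => a - _) hl0) (sub0r _).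
  move=> /cf_N; rewrite opprK /X rmorph_sum; congr (f 2 _); apply: eq_bigr => j _.
  by rewrite rmorphMz /c /p; case: eqP => // _; rewrite mul0rz mulr0z.
rewrite [LHS]coordP (bigD1 j0) // big1 => [|j /andP[_ jj0]]; first exact: addr0.
by have := c0 j; rewrite /c (negbTE jj0) => ->; rewrite mulr0z.
Qed.

(** [x a] generates the kernel of [rho], a morphism to a domain. For the last clause, [rho] kills
    [x a], so [rho] and its composite with the map induced by [g] agree on each [x l], hence
    everywhere. With [g] a simple reflection, this makes divided differences integral. *)
Lemma fga_basis_prime (j0 : 'I_m) (a := b j0) :
  [/\ no_zero_divisor S, x a <> 0 /\ ~ rdvd (x a) 1,
      forall y z, rdvd (x a) (y * z) -> rdvd (x a) y \/ rdvd (x a) z,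
      forall l, rdvd (x a) (x l) -> exists c, l = a *~ c &
      forall g : {additive L -> L}, (forall l, exists c, g l = l + a *~ c) ->
        forall z, rdvd (x a) (z - fga_map F g z)].
Proof.
have [domS [A [f [rho [domA [rhoF rhoR] rho0 xa0 rhox]]]]] := fga_reduction j0.
split=> //.
- split=> // /rho0; rewrite rmorph1 => /eqP; exact/negP/oner_neq0.
- move=> y z /rho0; rewrite rmorphM => /domA[]/rho0; [by left|by right].
- by move=> l /rho0/rhox ->; exists (coord j0 l).
move=> g gP z; apply/rho0; rewrite rmorphB; apply/eqP; rewrite subr_eq0; apply/eqP.
suff H : rho =1 rho \o fga_map F g by apply: H.
apply: (@fga_morph_eq _ _ _ _ f rho (rho \o fga_map F g)) => //.
- by move=> k y yk; apply/rhoF/fga_map_fil.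
- by move=> c; rewrite /= fga_map_str.
move=> l; rewrite /= fga_map_var; have [c ->] := gP l.
pose q : {additive fpoint (fga_cfil F L) F -> fpoint f F} := fpoint_map rhoF rhoR.
have qa : q (fga_point F a) = 0.
  by apply: val_inj; apply/rho0; exists 1; rewrite mulr1.
transitivity (val (q (fga_point F l + fga_point F a *~ c))).
  by rewrite raddfD raddfMz qa mul0rz addr0.
by rewrite -raddfMz -raddfD.
Qed.

End FormalGroupAlgebraOfLattice.

(** * Lengths in the Weyl group *)

Lemma lcomb_sub_r (F : comNzRingType) (U : lmodType F) (x a b : U) (c d e f : F) :
  d - e = f -> x + c *: a + d *: b - e *: b = x + c *: a + f *: b.
Proof. by move=> <-; rewrite scalerBl addrA. Qed.

Lemma lcomb_sub_l (F : comNzRingType) (U : lmodType F) (x a b : U) (c d e f : F) :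
  c - e = f -> x + c *: a + d *: b - e *: a = x + f *: a + d *: b.
Proof.
by move=> <-; rewrite scalerBl [LHS]addrAC addrA.
Qed.

Section WeylGroup.
Variables (K : realType) (n : nat) (A : generalized_cartan_matrix n).
Variable D : root_datum K A.
Local Notation V := (dual_cartan D).
Local Notation W := (weyl D).
Local Notation alpha := (@simple_root K n A D).
Local Notation coroot := (@simple_coroot K n A D).
Local Notation s := (simple_refl D).
Local Notation len := (@weyl_length K n A D).
Implicit Types (u v w : W) (x y : V) (i j : 'I_n) (I J : seq 'I_n).

Lemma weyl_endM v w x : weyl_end (v * w)%g x = weyl_end v (weyl_end w x).
Proof. exact: comp_lfunE. Qed.

Lemma weyl_end1 x : weyl_end (1%g : W) x = x.
Proof. exact: id_lfunE. Qed.

Lemma weyl_endK w x : weyl_end w^-1%g (weyl_end w x) = x.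
Proof. by rewrite -weyl_endM mulVg weyl_end1. Qed.

Lemma weyl_endVK w x : weyl_end w (weyl_end w^-1%g x) = x.
Proof. by rewrite -weyl_endM mulgV weyl_end1. Qed.

Lemma weyl_eqP v w : (forall x, weyl_end v x = weyl_end w x) -> v = w.
Proof. by move=> vw; apply/val_inj/lfunP. Qed.

Lemma weyl_end_s i x : weyl_end (s i) x = x - pairing x (coroot i) *: alpha i.
Proof.
by rewrite /weyl_end /= comp_lfunE id_lfunE simple_refl_endE.
Qed.

Lemma pairing_root i j : pairing (alpha j) (coroot i) = (A i j)%:~R.
Proof. exact: root_pairing. Qed.

Lemma weyl_end_sroot i j : weyl_end (s i) (alpha j) = alpha j - alpha i *~ A i j.
Proof. by rewrite weyl_end_s pairing_root scaler_int. Qed.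

Lemma weyl_end_sself i : weyl_end (s i) (alpha i) = - alpha i.
Proof. by rewrite weyl_end_sroot gcm_diag (mulrzDr _ 1 1) mulr1z opprD addNKr. Qed.

Lemma s_sq i : (s i * s i)%g = 1%g.
Proof.
apply: weyl_eqP => x; rewrite weyl_endM weyl_end1 [weyl_end (s i) x]weyl_end_s.
rewrite raddfB /= linearZ /= weyl_end_sself weyl_end_s scalerN opprK.
by rewrite subrK.
Qed.

Lemma s_inv i : (s i)^-1%g = s i.
Proof. by rewrite -[LHS]mulg1 -(s_sq i) mulKg. Qed.

Definition wprod I : W := (\prod_(i <- I) s i)%g.

Lemma wprod_nil : wprod [::] = 1%g. Proof. exact: big_nil. Qed.

Lemma wprod_cons i I : wprod (i :: I) = (s i * wprod I)%g.
Proof. exact: big_cons. Qed.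

Lemma wprod_cat I J : wprod (I ++ J) = (wprod I * wprod J)%g.
Proof. exact: big_cat. Qed.

Lemma wprod_seq1 i : wprod [:: i] = s i. Proof. exact: big_seq1. Qed.

Lemma len_word I : (len (wprod I) <= size I)%N.
Proof.
rewrite /weyl_length; case: ex_minnP => k _; apply.
by apply/asboolP; exists I.
Qed.

Lemma lenP w : exists2 I, size I = len w & w = wprod I.
Proof. by rewrite /weyl_length; case: ex_minnP => k /asboolP. Qed.

Lemma len1 : len 1%g = 0%N.
Proof. by apply/eqP; rewrite -leqn0; have := len_word [::]; rewrite wprod_nil. Qed.

Lemma lenM v w : (len (v * w)%g <= len v + len w)%N.
Proof.
have [I <- {1}->] := lenP v; have [J <- {1}->] := lenP w.
by rewrite -wprod_cat -size_cat; apply: len_word.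
Qed.

Lemma len_s i : (len (s i) <= 1)%N.
Proof. by have := len_word [:: i]; rewrite wprod_seq1. Qed.

Lemma wprod_rev I : ((wprod I)^-1 = wprod (rev I))%g.
Proof.
elim: I => [|i I IHI]; first by rewrite !wprod_nil invg1.
by rewrite wprod_cons invgM IHI s_inv rev_cons -cats1 wprod_cat wprod_seq1.
Qed.

Lemma lenV w : len w^-1%g = len w.
Proof.
have H v : (len v^-1%g <= len v)%N.
  have [I <- {1}->] := lenP v.
  by rewrite wprod_rev -(size_rev I); apply: len_word.
by apply/eqP; rewrite eqn_leq H -{1}[w]invgK H.
Qed.

Lemma len_mulr w i : (len w <= (len (w * s i)%g).+1)%N.
Proof.
rewrite -{1}[w]mulg1 -(s_sq i) mulgA; apply: leq_trans (lenM _ _) _.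
by rewrite -addn1 leq_add2l len_s.
Qed.

Lemma len_mulrS w i : (len (w * s i)%g <= (len w).+1)%N.
Proof. by apply: leq_trans (lenM _ _) _; rewrite -addn1 leq_add2l len_s. Qed.

Lemma len0P w : len w = 0%N -> w = 1%g.
Proof. by have [I <- ->] := lenP w => /size0nil->; rewrite wprod_nil. Qed.

Lemma len_rcons w : len w != 0%N -> exists v j, w = (v * s j)%g /\ len w = (len v).+1.
Proof.
have [I] := lenP w; case/lastP: I => [<-//|I j]; rewrite size_rcons => Iw wI _.
have wE : w = (wprod I * s j)%g by rewrite wI -cats1 wprod_cat wprod_seq1.
exists (wprod I), j; split=> //; apply/eqP; rewrite eqn_leq.
by rewrite -{2}Iw ltnS len_word {1}wE len_mulrS.
Qed.

Lemma root_free (c : 'I_n -> K[i]) : \sum_i c i *: alpha i = 0 -> forall i, c i = 0.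
Proof.
have : free (mktuple alpha) := simple_root_free D.
move=> /freeP H c0; apply: H; rewrite -[RHS]c0; apply: eq_bigr => i _.
by rewrite -tnth_nth tnth_mktuple.
Qed.

Definition root_comb (c : 'I_n -> int) : V := \sum_i alpha i *~ c i.

Lemma root_combD c d : root_comb c + root_comb d = root_comb (fun i => c i + d i).
Proof. by rewrite /root_comb -big_split; apply: eq_bigr => i _; rewrite mulrzDr. Qed.

Lemma root_combMz c k : root_comb c *~ k = root_comb (fun i => c i * k).
Proof. by rewrite /root_comb mulrz_suml; apply: eq_bigr => i _; rewrite mulrzA. Qed.

Lemma root_comb0 c : root_comb c = 0 -> forall i, c i = 0.
Proof.
move=> c0 i; have /(_ i)/eqP : forall i, (c i)%:~R = 0 :> K[i].
  apply: root_free; rewrite -[RHS]c0; apply: eq_bigr => j _.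
  by rewrite scaler_int.
by rewrite intr_eq0 => /eqP.
Qed.

Lemma root_comb_inj c d : root_comb c = root_comb d -> forall i, c i = d i.
Proof.
move=> cd i; apply/eqP; rewrite -subr_eq0; apply/eqP.
apply: (root_comb0 (c := fun i => c i - d i)).
have -> : (fun i => c i - d i) = fun i => c i + d i * -1.
  by apply/funext => j; rewrite mulrN1.
by rewrite -root_combD -root_combMz cd mulrN1z subrr.
Qed.

Lemma root_comb1 i : alpha i = root_comb (fun j => (j == i)%:R).
Proof.
rewrite /root_comb (bigD1 i) //= eqxx big1 ?addr0 // => j /negbTE ->.
by rewrite mulr0z.
Qed.

Definition vpos x := exists2 c : 'I_n -> int, (forall i, (0 <= c i)%R) & x = root_comb c.

Lemma vposD x y : vpos x -> vpos y -> vpos (x + y).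
Proof.
move=> [c c0 ->] [d d0 ->]; exists (fun i => c i + d i); last by rewrite root_combD.
by move=> i; apply: Num.Theory.addr_ge0.
Qed.

Lemma vposMz x (k : int) : (0 <= k)%R -> vpos x -> vpos (x *~ k).
Proof.
move=> k0 [c c0 ->]; exists (fun i => c i * k); last by rewrite root_combMz.
by move=> i; apply: Num.Theory.mulr_ge0.
Qed.

Lemma vpos_root i : vpos (alpha i).
Proof. by rewrite root_comb1; exists (fun j => (j == i)%:R) => // j; case: (j == i). Qed.

Lemma vpos_opp x : vpos x -> vpos (- x) -> x = 0.
Proof.
move=> [c c0 ->] [d d0 E].
have cd i : c i = 0.
  have /root_comb0/(_ i) : root_comb (fun i => c i + d i) = 0.
    by rewrite -root_combD -E subrr.
  by move: (c0 i) (d0 i); lia.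
by rewrite /root_comb big1 // => i _; rewrite cd mulr0z.
Qed.

Lemma weyl_endMz w x (k : int) : weyl_end w (x *~ k) = weyl_end w x *~ k.
Proof. exact: raddfMz. Qed.

Lemma weyl_endD w x y : weyl_end w (x + y) = weyl_end w x + weyl_end w y.
Proof. exact: raddfD. Qed.

Lemma weyl_endB w x y : weyl_end w (x - y) = weyl_end w x - weyl_end w y.
Proof. exact: raddfB. Qed.

Lemma weyl_endN w x : weyl_end w (- x) = - weyl_end w x.
Proof. exact: raddfN. Qed.

Lemma weyl_endZ w (k : K[i]) x : weyl_end w (k *: x) = k *: weyl_end w x.
Proof. exact: linearZ. Qed.

Lemma weyl_end_sum w (T : Type) (r : seq T) (F : T -> V) :
  weyl_end w (\sum_(i <- r) F i) = \sum_(i <- r) weyl_end w (F i).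
Proof. exact: raddf_sum. Qed.

(** [altw i j k] is the product of the alternating word of [k] letters in [i] and
    [j] that ends with [j]. *)
Fixpoint altw i j k : W :=
  if k is k'.+1 then (s (if odd k' then i else j) * altw i j k')%g else 1%g.

Lemma altwSr i j k : altw i j k.+1 = (altw j i k * s j)%g.
Proof.
elim: k => [|k IHk]; first by rewrite /= mul1g mulg1.
rewrite -[LHS]/(s (if odd k.+1 then i else j) * altw i j k.+1)%g IHk mulgA.
by rewrite /=; case: (odd k).
Qed.

Lemma len_altw i j k : (len (altw i j k) <= k)%N.
Proof.
elim: k => [|k IHk] /=; first by rewrite len1.
by apply: leq_trans (lenM _ _) _; rewrite -add1n leq_add ?len_s.
Qed.

(** One simple reflection is applied at each step: [a], [b] stand for the two Cartan integers and
    [l], [m] for the pairings of the vector with the two coroots. Both sides of a braid relation can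
    be computed in this form. *)
Fixpoint altw_coef (a b l m : K[i]) k : K[i] * K[i] :=
  if k is k'.+1 then
    let: (x, y) := altw_coef a b l m k' in
    if odd k' then (- x - l - a * y, y) else (x, - y - m - b * x)
  else (0, 0).

Lemma altw_end i j k x :
  let: (c, d) := altw_coef (A i j)%:~R (A j i)%:~R (pairing x (coroot i))
    (pairing x (coroot j)) k in
  weyl_end (altw i j k) x = x + c *: alpha i + d *: alpha j.
Proof.
elim: k => [|k] /=; first by rewrite !scale0r !addr0 weyl_end1.
set cd := altw_coef _ _ _ _ _; case: cd => c d IHk.
have pE h : pairing (x + c *: alpha i + d *: alpha j) h =
    pairing x h + c * pairing (alpha i) h + d * pairing (alpha j) h.
  by rewrite /pairing !add_lfunE !scale_lfunE.
have d2 l : (A l l)%:~R = 2 :> K[i] by rewrite gcm_diag.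
case: (odd k); rewrite weyl_endM IHk weyl_end_s pE !pairing_root d2.
  by apply: lcomb_sub_l; ring.
by apply: lcomb_sub_r; ring.
Qed.

(** The cases are the types [A1 x A1], [A2], [B2] and [G2]. As [W] consists of linear maps, the
    relation is checked on a vector: six pairs of Cartan integers are possible, and for each the
    coefficients are compared. *)
Lemma altw_braid i j m : (i != j) ->
  (A i j * A j i = 0 /\ m = 2) \/ (A i j * A j i = 1 /\ m = 3) \/
  (A i j * A j i = 2 /\ m = 4) \/ (A i j * A j i = 3 /\ m = 6) ->
  altw i j m = altw j i m.
Proof.
move=> ij mP; apply: weyl_eqP => x.
have := altw_end i j m x; have := altw_end j i m x.
set a := A i j in mP *; set b := A j i in mP *.
have a0 : a <= 0 by apply: gcm_offdiag.
have b0 : b <= 0 by apply: gcm_offdiag; rewrite eq_sym.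
have ab0 : a = 0 <-> b = 0 by apply: gcm_eq0.
move: (pairing x (coroot i)) (pairing x (coroot j)) => l k.
have solve (c1 c2 d1 d2 : K[i]) (y z : V) : c1 = d2 -> d1 = c2 ->
    y = x + c1 *: alpha j + d1 *: alpha i -> z = x + c2 *: alpha i + d2 *: alpha j ->
    z = y.
  by move=> -> -> -> ->; rewrite addrAC.
have : [\/ (a, b, m) = (0, 0, 2), (a, b, m) = (-1, -1, 3) |
        [\/ (a, b, m) = (-1, -2, 4), (a, b, m) = (-2, -1, 4),
         (a, b, m) = (-1, -3, 6) | (a, b, m) = (-3, -1, 6)]].
  clear solve; clearbody a b; case: mP => [[ab ->]|mP].
    have [a00|an0] := eqVneq a 0.
      have b00 : b = 0 by apply/ab0.
      by constructor 1; rewrite a00 b00.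
    have b00 : b = 0 by nia.
    by constructor 1; rewrite b00 (proj2 ab0 b00).
  have bl : (b <= -1)%R by nia.
  have a3 : (- 3 <= a)%R by nia.
  have : a = -1 \/ a = -2 \/ a = -3 by lia.
  case=> [|[|]] aE; rewrite {}aE in mP *; case: mP => [|[|]] [bE ->].
  - have -> : b = -1 by lia. by constructor 2.
  - have -> : b = -2 by lia. by constructor 3; constructor 1.
  - have -> : b = -3 by lia. by constructor 3; constructor 3.
  - by exfalso; lia.
  - have -> : b = -1 by lia. by constructor 3; constructor 2.
  - by exfalso; lia.
  - by exfalso; lia.
  - by exfalso; lia.
  - have -> : b = -1 by lia. by constructor 3; constructor 4.
case=> [[-> -> ->]|[-> -> ->]|[[-> -> ->]|[-> -> ->]|[-> -> ->]|[-> -> ->]]] /=;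
  apply: solve; ring.
Qed.

(** In a word longer than the braid relation, applying the relation makes two equal letters meet;
    cancelling them loses two letters out of [k.+1]. *)
Lemma len_altw_braid i j m k : altw i j m.+1 = altw j i m.+1 -> (m < k)%N ->
  (len (altw j i k.+1) < k)%N.
Proof.
move=> braid; elim: k => // k IHk; rewrite ltnS leq_eqVlt => /predU1P[<-|/IHk H].
  rewrite -[altw j i m.+2]/(s _ * altw j i m.+1)%g -braid /= mulgA.
  have -> : (if ~~ odd m then j else i) = (if odd m then i else j).
    by case: (odd m).
  by rewrite s_sq mul1g ltnS len_altw.
rewrite -[altw j i k.+2]/(s _ * altw j i k.+1)%g.
apply: leq_ltn_trans (lenM _ _) _.
by apply: (@leq_ltn_trans (1 + len (altw j i k.+1))%N); rewrite ?leq_add2r ?len_s.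
Qed.

Fixpoint alt_root (p q : int) k : int * int :=
  if k is k'.+1 then
    let: (x, y) := alt_root p q k' in
    if odd k' then (- x - p * y, y) else (x, - y - q * x)
  else (1, 0).

Lemma altw_root i j k : let: (x, y) := alt_root (A i j) (A j i) k in
  weyl_end (altw i j k) (alpha i) = alpha i *~ x + alpha j *~ y.
Proof.
elim: k => [|k] /=; first by rewrite weyl_end1 mulr1z mulr0z addr0.
case: alt_root => x y IHk; case: (odd k);
  rewrite weyl_endM IHk raddfD !raddfMz /= weyl_end_sself weyl_end_sroot.
  rewrite mulrzBl addrA mulNrz -!mulrNz -!mulrzA; rewrite addrAC -mulrzDr.
  by congr (alpha i *~ _ + _); lia.
rewrite mulrzBl mulNrz -!mulrNz -!mulrzA -addrA -mulrzDr.
by congr (_ + alpha j *~ _); lia.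
Qed.

(** If [a * b < 4], the hypothesis bounds [k] through [len_altw_braid] and finitely many values
    remain to be computed; if [a * b >= 4], the coefficients are nonnegative for all [k]. *)
Lemma alt_root_ge0 i j k : i != j -> (k <= len (altw i j k * s i)%g)%N ->
  let: (x, y) := alt_root (A i j) (A j i) k in (0 <= x)%R /\ (0 <= y)%R.
Proof.
move=> ij; rewrite -altwSr => kl.
have braid m (E : altw i j m.+1 = altw j i m.+1) : (k <= m)%N.
  by rewrite leqNgt; apply: contraTN kl => mk; rewrite -ltnNge; apply: len_altw_braid mk.
have := altw_braid ij; move: braid.
set a := A i j; set b := A j i.
have a0 : a <= 0 by apply: gcm_offdiag.
have b0 : b <= 0 by apply: gcm_offdiag; rewrite eq_sym.
have ab0 : a = 0 <-> b = 0 by apply: gcm_eq0.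
clearbody a b; move=> bnd br.
have [ab4|ab4] := Num.Theory.lerP 4 (a * b).
  (* The added inequality says that the next reflection does not decrease the coefficient that it
     changes; it propagates because [a * b >= 4]. *)
  clear kl bnd br; have : let: (x, y) := alt_root a b k in
      [/\ (0 <= x)%R, (0 <= y)%R &
        if odd k then (2 * x <= - a * y)%R else (2 * y <= - b * x)%R].
    elim: k => [|k] /=; first by split=> //; lia.
    case: alt_root => x y; case: (odd k) => /= -[x0 y0 xy]; split=> //; nia.
  by case: alt_root => x y [].
have k0 : a * b = 0 -> (k <= 1)%N by move=> E; apply/bnd/br; left.
have k1 : a * b = 1 -> (k <= 2)%N by move=> E; apply/bnd/br; right; left.
have k2 : a * b = 2 -> (k <= 3)%N by move=> E; apply/bnd/br; do 2 right; left.
have k3 : a * b = 3 -> (k <= 5)%N by move=> E; apply/bnd/br; do 3 right.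
have [a00|an0] := eqVneq a 0.
  have b00 : b = 0 by apply/ab0.
  have := k0; rewrite a00 b00 => /(_ (mulr0 _)).
  by case: (k) => [|[|]].
have bl : (b <= -1)%R by have : b <> 0 by [move/ab0/eqP; rewrite (negbTE an0)]; lia.
have a3 : (- 3 <= a)%R by nia.
have : a = -1 \/ a = -2 \/ a = -3 by lia.
case=> [|[|]] aE; rewrite {}aE in k1 k2 k3 bl ab4 *.
- have : b = -1 \/ b = -2 \/ b = -3 by lia.
  case=> [|[|]] bE; rewrite {}bE in k1 k2 k3 *.
  + by have := k1 erefl; case: (k) => [|[|[|]]].
  + by have := k2 erefl; case: (k) => [|[|[|[|]]]].
  + by have := k3 erefl; case: (k) => [|[|[|[|[|[|]]]]]].
- have bE : b = -1 by lia.
  by move: k2; rewrite bE => /(_ erefl); case: (k) => [|[|[|[|]]]].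
- have bE : b = -1 by lia.
  by move: k3; rewrite bE => /(_ erefl); case: (k) => [|[|[|[|[|[|]]]]]].
Qed.

End WeylGroup.

(** * Real roots *)

Section WeylRoots.
Variables (K : realType) (n : nat) (A : generalized_cartan_matrix n).
Variable D : root_datum K A.
Local Notation V := (dual_cartan D).
Local Notation W := (weyl D).
Local Notation alpha := (@simple_root K n A D).
Local Notation s := (simple_refl D).
Local Notation wprod := (wprod D).
Local Notation len := (@weyl_length K n A D).
Implicit Types (u v w : W) (x y : V) (i j : 'I_n) (I J : seq 'I_n).

(** Write [w = v * altw i j k] with lengths adding up and [k] maximal, where [j] is
    the last letter of a reduced word of [w]: then [v] sends both [alpha i] and
    [alpha j] to positive roots by induction, and [altw i j k] sends [alpha i] to a
    nonnegative combination of these two. *)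
Theorem len_vpos w i : (len w <= len (w * s i)%g)%N -> vpos (weyl_end w (alpha i)).
Proof.
have [N] := ubnP (len w); elim: N w i => // N IHN w i; rewrite ltnS => wN wi.
have [w0|wn0] := eqVneq (len w) 0%N.
  by rewrite (len0P w0) weyl_end1; apply: vpos_root.
have [v0 [j [wE lw]]] := len_rcons wn0.
have ij : i != j.
  by apply: contraTneq wi => ->; rewrite wE -mulgA s_sq mulg1 -wE lw -ltnNge.
pose P k := `[< exists v, w = (v * altw D i j k)%g /\ (len v + k = len w)%N >].
have P1 : P 1%N.
  by apply/asboolP; exists v0; rewrite /= mulg1 -wE lw addn1.
have Pw k : P k -> (k <= len w)%N.
  by move=> /asboolP[v [_ <-]]; apply: leq_addl.
have [k /asboolP[v [vE lv]] kmax] := ex_maxnP (ex_intro P 1%N P1) Pw.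
have k0 : (0 < k)%N by apply: kmax.
case: k k0 vE lv kmax => // k _ vE lv kmax.
(* [q] is the leftmost letter of [altw D i j k.+1] and [p] the one that would be added before it.
   Maximality of [k] forbids [v * s p] to be shorter than [v], and the length of [w] forbids it for
   [v * s q]. *)
pose p := if odd k.+1 then i else j; pose q := if odd k then i else j.
have vp : (len v <= len (v * s p)%g)%N.
  rewrite leqNgt; apply/negP => vp; have := len_mulr v p => vp'.
  suff /kmax : P k.+2 by rewrite ltnn.
  apply/asboolP; exists (v * s p)%g; split; last by lia.
  by rewrite -[altw D i j k.+2]/(s p * altw D i j k.+1)%g mulgA -[(v * s p * s p)%g]mulgA s_sq mulg1.
have vq : (len v <= len (v * s q)%g)%N.
  rewrite leqNgt; apply/negP => vq.
  have wq : w = ((v * s q) * altw D i j k)%g by rewrite -mulgA.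
  have := lenM (v * s q)%g (altw D i j k); rewrite -wq.
  by have := len_altw D i j k; lia.
have vN : (len v < N)%N by lia.
have vij : vpos (weyl_end v (alpha i)) /\ vpos (weyl_end v (alpha j)).
  have := IHN v p vN vp; have := IHN v q vN vq; rewrite /p /q /=.
  by case: (odd k).
have /(alt_root_ge0 ij) : (k.+1 <= len (altw D i j k.+1 * s i)%g)%N.
  rewrite -(leq_add2l (len v)) lv; apply: leq_trans wi _.
  by rewrite vE -mulgA; apply: lenM.
have := altw_root D i j k.+1; case: alt_root => x y E [x0 y0].
rewrite vE weyl_endM E weyl_endD !weyl_endMz.
by apply: vposD; apply: vposMz => //; case: vij.
Qed.

Lemma weyl_root_neq0 w i : weyl_end w (alpha i) <> 0.
Proof.
move=> w0; have /eqP : alpha i = 0 by rewrite -(weyl_endK w (alpha i)) w0 raddf0.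
rewrite -[X in X == _]mulr1z root_comb1 => /eqP.
by rewrite root_combMz => /root_comb0/(_ i); rewrite eqxx mulr1.
Qed.

Lemma len_vneg w i : (len (w * s i)%g < len w)%N -> vpos (- weyl_end w (alpha i)).
Proof.
move=> wi; rewrite -weyl_endN -weyl_end_sself -weyl_endM; apply: len_vpos.
by rewrite -mulgA s_sq mulg1 ltnW.
Qed.

(** Equal lengths would allow [len_vpos] for both [w] and [w * s i], so that [w(alpha_i)] and its
    opposite would both be positive. *)
Lemma vpos_len w i : vpos (weyl_end w (alpha i)) -> len (w * s i)%g = (len w).+1.
Proof.
move=> wi; have wi' : (len w < len (w * s i)%g)%N.
  have [wi'|] := ltnP (len (w * s i)%g) (len w).
    by have /weyl_root_neq0 := vpos_opp wi (len_vneg wi').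
  rewrite leq_eqVlt => /predU1P[E|//].
  have : vpos (weyl_end (w * s i)%g (alpha i)).
    by apply: len_vpos; rewrite -mulgA s_sq mulg1 E.
  by rewrite weyl_endM weyl_end_sself weyl_endN => /(vpos_opp wi)/weyl_root_neq0.
by apply/eqP; rewrite eqn_leq len_mulrS.
Qed.

Lemma vneg_len w i : vpos (- weyl_end w (alpha i)) -> len w = (len (w * s i)%g).+1.
Proof.
move=> wi; rewrite -[in LHS](mulg1 w) -(s_sq D i) mulgA; apply: vpos_len.
by rewrite weyl_endM weyl_end_sself weyl_endN.
Qed.

Definition rroot x := exists w i, x = weyl_end w (alpha i).

Lemma rroot_alpha i : rroot (alpha i).
Proof. by exists 1%g, i; rewrite weyl_end1. Qed.

Lemma rroot_weyl w x : rroot x -> rroot (weyl_end w x).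
Proof. by move=> [u [i ->]]; exists (w * u)%g, i; rewrite weyl_endM. Qed.

Lemma rroot_neq0 x : rroot x -> x <> 0.
Proof. by move=> [w [i ->]]; apply: weyl_root_neq0. Qed.

Lemma rroot_opp x : rroot x -> rroot (- x).
Proof.
by move=> [w [i ->]]; exists (w * s i)%g, i; rewrite weyl_endM weyl_end_sself weyl_endN.
Qed.

Lemma rroot_posneg x : rroot x -> vpos x \/ vpos (- x).
Proof.
move=> [w [i ->]].
by have [/len_vpos|/len_vneg] := leqP (len w) (len (w * s i)%g); [left|right].
Qed.

Lemma root_combw w c : exists d, weyl_end w (root_comb D c) = root_comb D d.
Proof.
have s_comb i d : exists d', weyl_end (s i) (root_comb D d) = root_comb D d'.
  exists (fun j => d j + (j == i)%:R * - (\sum_k d k * A i k)).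
  rewrite -root_combD -root_combMz -root_comb1 /root_comb weyl_end_sum.
  rewrite mulrNz mulrz_sumr -sumrB; apply: eq_bigr => k _.
  by rewrite weyl_endMz weyl_end_sroot mulrzBl -!mulrzA [A i k * _]mulrC.
have [I _ ->] := lenP w; elim: I => [|i I [d IHI]].
  by exists c; rewrite wprod_nil weyl_end1.
by rewrite wprod_cons weyl_endM IHI.
Qed.

(** Applying [w^-1] exhibits a simple root as [c] times an integral combination of simple roots, so
    [c] divides 1. *)
Lemma rroot_multiple x (c : int) i : rroot x -> x = alpha i *~ c -> c = 1 \/ c = -1.
Proof.
move=> [w [k ->]] E; have [d dE] : exists d, weyl_end w^-1%g (alpha i) = root_comb D d.
  by rewrite root_comb1; apply: root_combw.
have : alpha k = root_comb D (fun j => d j * c).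
  by rewrite -root_combMz -dE -weyl_endMz -E weyl_endK.
rewrite root_comb1 => /root_comb_inj/(_ k); rewrite eqxx => /esym dc.
have : `|c|%N = 1%N.
  by apply/eqP; rewrite -dvdn1; apply/dvdnP; exists `|d k|%N; rewrite -abszM dc.
by lia.
Qed.

Lemma rroot_proportional x y (c : int) : rroot x -> rroot y -> y = x *~ c ->
  y = x \/ y = - x.
Proof.
move=> [u [i ->]] ry E; have := rroot_weyl u^-1%g ry.
rewrite E weyl_endMz weyl_endK => /rroot_multiple/(_ erefl).
by case=> ->; [left|right; rewrite mulrN1z].
Qed.

(** [s i] changes only the coefficient at [i]. If the image were negative, all other coefficients
    would vanish and [x] would be a multiple of [alpha i]. *)
Lemma vpos_s i x : rroot x -> vpos x -> x <> alpha i -> vpos (weyl_end (s i) x).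
Proof.
move=> rx px xi; have [//|] := rroot_posneg (rroot_weyl (s i) rx).
case: px => c c0 xc [d d0 dE].
have [k sE] : exists k : int, weyl_end (s i) x = x - alpha i *~ k.
  rewrite xc /root_comb weyl_end_sum; exists (\sum_j c j * A i j).
  rewrite mulrz_sumr -sumrB; apply: eq_bigr => j _.
  by rewrite weyl_endMz weyl_end_sroot mulrzBl -!mulrzA [A i j * _]mulrC.
have cdk j : c j + d j = (j == i)%:R * k.
  apply: (root_comb_inj (D := D) (c := fun j => c j + d j) (d := fun j => (j == i)%:R * k)).
  rewrite -root_combD -root_combMz -root_comb1 -xc -dE sE opprB addrC.
  by rewrite subrK.
have cj j : j != i -> c j = 0.
  move=> /negbTE ji; have := cdk j; rewrite ji mul0r.
  by have := c0 j; have := d0 j; lia.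
have xci : x = alpha i *~ c i.
  rewrite xc /root_comb (bigD1 i) //= big1 ?addr0 // => j /cj ->.
  by rewrite mulr0z.
have [ci|ci] := rroot_multiple rx xci; first by case: xi; rewrite xci ci.
by have := c0 i; rewrite ci.
Qed.

Lemma vpos_simple_id w : (forall i, vpos (weyl_end w (alpha i))) -> w = 1%g.
Proof.
move=> wp; apply: len0P; apply/eqP; apply: contraT => /len_rcons[v [j [wE lw]]].
by have := vpos_len (wp j); rewrite {1}wE -mulgA s_sq mulg1 lw; lia.
Qed.

Lemma root_refl_end u i x : exists k : K[i],
  weyl_end (root_refl u i) x = x - k *: weyl_end u (alpha i).
Proof.
rewrite /root_refl !weyl_endM weyl_end_s weyl_endB weyl_endZ weyl_endVK.
by exists (pairing (weyl_end u^-1%g x) (simple_coroot D i)).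
Qed.

Lemma root_refl_self u i :
  weyl_end (root_refl u i) (weyl_end u (alpha i)) = - weyl_end u (alpha i).
Proof. by rewrite /root_refl !weyl_endM weyl_endK weyl_end_sself weyl_endN. Qed.

End WeylRoots.

(** * Reflections and the Bruhat order *)

Section WeylReflections.
Variables (K : realType) (n : nat) (A : generalized_cartan_matrix n).
Variable D : root_datum K A.
Local Notation V := (dual_cartan D).
Local Notation W := (weyl D).
Local Notation alpha := (@simple_root K n A D).
Local Notation s := (simple_refl D).
Local Notation wprod := (wprod D).
Local Notation len := (@weyl_length K n A D).
Implicit Types (u v w : W) (x y b : V) (i j : 'I_n) (I J : seq 'I_n).

Lemma root_refl_conj u w i : (w * root_refl u i * w^-1)%g = root_refl (w * u)%g i.
Proof. by rewrite /root_refl invgM !mulgA. Qed.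

Lemma root_refl1 i : root_refl 1%g i = s i.
Proof. by rewrite /root_refl invg1 mulg1 mul1g. Qed.

Lemma root_refl_sq u i : (root_refl u i * root_refl u i)%g = 1%g.
Proof. by rewrite /root_refl !mulgA mulgVK -!mulgA [(s i * (s i * _))%g]mulgA s_sq mul1g mulgV. Qed.

(** If [u] maps [alpha i] to [alpha j], the product of the two reflections maps each
    [alpha k] to [alpha k] plus a multiple of [alpha j], so it preserves positivity. *)
Lemma root_refl_simple u i j : weyl_end u (alpha i) = alpha j -> root_refl u i = s j.
Proof.
move=> uij; suff : (root_refl u i * s j)%g = 1%g.
  by move=> /(congr1 (fun t => t * s j)%g); rewrite -mulgA s_sq mulg1 mul1g.
apply: vpos_simple_id => k; rewrite weyl_endM.
have rj : weyl_end (root_refl u i) (alpha j) = - alpha j by rewrite -uij root_refl_self.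
have [->|kj] := eqVneq k j.
  by rewrite weyl_end_sself weyl_endN rj opprK; apply: vpos_root.
have [c E] : exists c : K[i],
    weyl_end (root_refl u i) (weyl_end (s j) (alpha k)) = alpha k + c *: alpha j.
  rewrite weyl_end_sroot weyl_endB weyl_endMz rj.
  have [c ->] := root_refl_end u i (alpha k); exists (- c + (A j k)%:~R).
  by rewrite uij scalerDl scaleNr scaler_int mulNrz opprK addrA.
have rt : rroot (weyl_end (root_refl u i) (weyl_end (s j) (alpha k))).
  by do 2 apply: rroot_weyl; apply: rroot_alpha.
have [//|[d d0 dE]] := rroot_posneg rt.
have /root_free/(_ k) : \sum_l ((d l)%:~R + (l == k)%:R + (l == j)%:R * c) *: alpha l = 0.
  under eq_bigr do rewrite !scalerDl.
  rewrite !big_split /=.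
  have -> : \sum_l (d l)%:~R *: alpha l = root_comb D d.
    by apply: eq_bigr => l _; rewrite scaler_int.
  rewrite -dE E (bigD1 k) //= eqxx scale1r big1 => [|l /negbTE->]; last by rewrite scale0r.
  rewrite (bigD1 j) //= eqxx mul1r big1 => [|l /negbTE->]; last by rewrite mul0r scale0r.
  by rewrite !addr0 opprD -addrA addrACA addNr add0r addNr.
rewrite eqxx (negbTE kj) mul0r addr0 -[1]/(1%:~R) -intrD => /eqP.
by rewrite intr_eq0 => /eqP; have := d0 k; lia.
Qed.

Lemma root_refl_eq u v i j : weyl_end u (alpha i) = weyl_end v (alpha j) ->
  root_refl u i = root_refl v j.
Proof.
move=> uv; have : root_refl (v^-1 * u)%g i = s j.
  by apply: root_refl_simple; rewrite weyl_endM uv weyl_endK.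
rewrite -root_refl_conj invgK => /(congr1 (fun t => v * t * v^-1)%g).
by rewrite !mulgA mulgV mul1g mulgK.
Qed.

(** By [root_refl_eq], [root_refl] depends only on the root and not on its presentation by [u] and
    [i]; the value is 1 at vectors that are not roots. *)
Definition rootrefl x : W :=
  xget 1%g [set t | exists u i, x = weyl_end u (alpha i) /\ t = root_refl u i].

Lemma rootreflE u i : rootrefl (weyl_end u (alpha i)) = root_refl u i.
Proof.
rewrite /rootrefl; case: xgetP => [_ _ [v [j [E ->]]]|/(_ (root_refl u i))[]].
  exact/root_refl_eq.
by exists u, i.
Qed.

Lemma rootrefl_simple i : rootrefl (alpha i) = s i.
Proof. by rewrite -[alpha i]weyl_end1 rootreflE root_refl1. Qed.

Lemma rootrefl_weyl w x : rroot x -> rootrefl (weyl_end w x) = (w * rootrefl x * w^-1)%g.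
Proof. by move=> [u [i ->]]; rewrite -weyl_endM !rootreflE root_refl_conj. Qed.

Lemma rootrefl_opp x : rroot x -> rootrefl (- x) = rootrefl x.
Proof.
move=> [u [i ->]]; rewrite -weyl_endN -weyl_end_sself -weyl_endM !rootreflE.
by rewrite /root_refl invgM s_inv -!mulgA [(s i * (s i * _))%g]mulgA s_sq mul1g.
Qed.

Lemma rootrefl_self x : rroot x -> weyl_end (rootrefl x) x = - x.
Proof. by move=> [u [i ->]]; rewrite rootreflE root_refl_self. Qed.

Lemma rootrefl_sq x : rroot x -> (rootrefl x * rootrefl x)%g = 1%g.
Proof. by move=> [u [i ->]]; rewrite rootreflE root_refl_sq. Qed.

Lemma rootrefl_mulK x w : rroot x -> (rootrefl x * (rootrefl x * w))%g = w.
Proof. by move=> rx; rewrite mulgA rootrefl_sq ?mul1g. Qed.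

Lemma rootrefl_inv x : rroot x -> (rootrefl x)^-1%g = rootrefl x.
Proof. by move=> rx; rewrite -[LHS]mulg1 -(rootrefl_sq rx) mulKg. Qed.

Lemma rootrefl_eq_simple x i : rroot x -> vpos x -> rootrefl x = s i -> x = alpha i.
Proof.
move=> rx px xi; have [//|/eqP /(vpos_s rx px)] := eqVneq x (alpha i).
by rewrite -xi rootrefl_self // => /(vpos_opp px)/rroot_neq0.
Qed.

(** The inversions of [wprod I], when [I] is reduced *)
Fixpoint binv I : seq V :=
  if I is i :: J then alpha i :: [seq weyl_end (s i) b | b <- binv J] else [::].

Lemma binv_root I b : b \in binv I -> rroot b.
Proof.
elim: I b => //= i I IHI b; rewrite inE => /predU1P[->|/mapP[c /IHI rc ->]].
  exact: rroot_alpha.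
exact: rroot_weyl.
Qed.

(** The entry coming from a given letter is the image of its simple root under the preceding
    letters, and the reflection in it deletes that letter. *)
Lemma binv_del I b : b \in binv I -> exists2 J, (size J < size I)%N &
  (rootrefl b * wprod I = wprod J)%g.
Proof.
elim: I b => //= i I IHI b; rewrite inE => /predU1P[->|/mapP[c cI ->]].
  by exists I => //; rewrite rootrefl_simple wprod_cons mulgA s_sq mul1g.
have [J JI E] := IHI c cI; exists (i :: J) => //.
rewrite rootrefl_weyl; last exact: binv_root cI.
by rewrite !wprod_cons -E -!mulgA mulKg.
Qed.

(** As the letters of [I] are applied to [b] in turn, it must become negative at some point; by
    [vpos_s] it is then the simple root of the current letter. *)
Lemma binv_mem I b : rroot b -> vpos b ->
  vpos (- weyl_end (wprod I)^-1%g b) -> b \in binv I.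
Proof.
elim: I b => [|i I IHI] b rb pb.
  by rewrite wprod_nil invg1 weyl_end1 => /(vpos_opp pb)/rroot_neq0.
rewrite wprod_cons invgM weyl_endM s_inv /= inE => nb.
have [//|/eqP bi] := eqVneq b (alpha i); apply/mapP.
exists (weyl_end (s i) b); last by rewrite -weyl_endM s_sq weyl_end1.
by apply: IHI => //; [apply: rroot_weyl|apply: vpos_s].
Qed.

Lemma rootrefl_lt w b : rroot b -> vpos b -> vpos (- weyl_end w^-1%g b) ->
  (len (rootrefl b * w)%g < len w)%N.
Proof.
have [I <- {1 2}->] := lenP w => rb pb nb.
have [J JI ->] := binv_del (binv_mem rb pb nb).
exact: leq_ltn_trans (len_word _ _) JI.
Qed.

Lemma rootrefl_gt w b : rroot b -> vpos b -> vpos (weyl_end w^-1%g b) ->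
  (len w < len (rootrefl b * w)%g)%N.
Proof.
move=> rb pb wb; rewrite -{1}(rootrefl_mulK w rb); apply: rootrefl_lt => //.
by rewrite invgM weyl_endM rootrefl_inv // rootrefl_self // weyl_endN opprK.
Qed.

Lemma rootrefl_len w b : rroot b -> vpos b ->
  (vpos (weyl_end w^-1%g b) /\ (len w < len (rootrefl b * w)%g)%N) \/
  (vpos (- weyl_end w^-1%g b) /\ (len (rootrefl b * w)%g < len w)%N).
Proof.
move=> rb pb; have [pw|nw] := rroot_posneg (rroot_weyl w^-1%g rb).
  by left; split=> //; apply: rootrefl_gt.
by right; split=> //; apply: rootrefl_lt.
Qed.

Lemma len_mull i w : len (s i * w)%g = (len w).+1 \/ len w = (len (s i * w)%g).+1.
Proof.
rewrite -(lenV w) -[len (s i * w)%g]lenV invgM s_inv.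
have [/vpos_len|/vneg_len] := rroot_posneg (rroot_weyl w^-1%g (rroot_alpha D i)).
  by left.
by right.
Qed.

Definition reduced I := size I = len (wprod I).

Lemma reduced_cons i I : reduced (i :: I) ->
  reduced I /\ len (s i * wprod I)%g = (len (wprod I)).+1.
Proof.
rewrite /reduced wprod_cons /=; have := len_word D I.
by case: (len_mull i (wprod I)); lia.
Qed.

Lemma binv_pos I b : reduced I -> b \in binv I -> vpos b.
Proof.
elim: I b => //= i I IHI b /reduced_cons[rI li]; rewrite inE.
case/predU1P=> [->|/mapP[c cI ->]]; first exact: vpos_root.
apply: vpos_s; [exact: binv_root cI|exact: IHI|move=> ci].
have [J JI] := binv_del cI; rewrite ci rootrefl_simple => E.
by have := len_word D J; rewrite -E li; move: rI; rewrite /reduced => <-; lia.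
Qed.

Lemma binvP I b : reduced I -> b \in binv I <->
  [/\ rroot b, vpos b & vpos (- weyl_end (wprod I)^-1%g b)].
Proof.
move=> rI; split=> [bI|[rb pb nb]]; last exact: binv_mem.
have rb := binv_root bI; have pb := binv_pos rI bI; split=> //.
have [[_ H]|[]//] := rootrefl_len (wprod I) rb pb.
have [J JI E] := binv_del bI; move: H; rewrite E -rI => H.
by have := len_word D J; lia.
Qed.

Lemma binv_uniq I : reduced I -> uniq (binv I).
Proof.
elim: I => //= i I IHI /reduced_cons[rI _]; rewrite map_inj_uniq; last first.
  exact: can_inj (weyl_endK (s i)).
rewrite IHI // andbT; apply/negP => /mapP[c cI ci].
have cE : c = - alpha i by rewrite -[c](weyl_endK (s i)) -ci s_inv weyl_end_sself.
have := binv_pos rI cI; rewrite cE => /(vpos_opp (vpos_root D i)).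
by apply: rroot_neq0; apply: rroot_alpha.
Qed.

Lemma binv_perm I J : reduced I -> reduced J ->
  wprod I = wprod J -> perm_eq (binv I) (binv J).
Proof.
move=> rI rJ E; apply: uniq_perm; try exact: binv_uniq.
move=> b; have PI := binvP b rI; have PJ := binvP b rJ; rewrite E in PI.
by apply/idP/idP => [/PI/PJ|/PJ/PI].
Qed.

(** * The Bruhat order and its lifting property *)

Definition ble u v := u = v \/ bruhat_lt u v.

Lemma bleT u v w : ble u v -> ble v w -> ble u w.
Proof.
move=> [->//|uv] [<-|vw]; first by right.
by right; apply: Relation_Operators.t_trans uv vw.
Qed.

Lemma bruhat_lt_len u v : bruhat_lt u v -> (len u < len v)%N.
Proof. by elim=> [x y []//|x y z _ xy _ yz]; apply: ltn_trans xy yz. Qed.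

(** [bruhat_step] multiplies by a reflection on the right; conjugation by [u] trades it for one on
    the left. *)
Lemma ble_rootrefl u b : rroot b -> (len u < len (rootrefl b * u)%g)%N ->
  ble u (rootrefl b * u)%g.
Proof.
move=> [w [i ->]]; rewrite rootreflE => lu; right; apply: Relation_Operators.t_step.
split=> //; exists (u^-1 * w)%g, i; rewrite -root_refl_conj invgK !mulgA mulgV mul1g //.
Qed.

Lemma bruhat_stepP u v : bruhat_step u v ->
  exists b, [/\ rroot b, vpos b, v = (rootrefl b * u)%g & vpos (weyl_end u^-1%g b)].
Proof.
move=> [[w [i vE]] uv].
have [b [rb pb E]] : exists b, [/\ rroot b, vpos b & rootrefl b = root_refl (u * w)%g i].
  have rb : rroot (weyl_end (u * w)%g (alpha i)) by exists (u * w)%g, i.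
  have [pb|nb] := rroot_posneg rb.
    by exists (weyl_end (u * w)%g (alpha i)); rewrite rootreflE.
  exists (- weyl_end (u * w)%g (alpha i)); rewrite rootrefl_opp // rootreflE.
  by split=> //; apply: rroot_opp.
have vE' : v = (rootrefl b * u)%g by rewrite E -root_refl_conj -mulgA mulVg mulg1.
exists b; split=> //; have [[]//|[_]] := rootrefl_len u rb pb.
by rewrite -vE'; lia.
Qed.

Lemma rootrefl_conj_gt i (x : W) b : rroot b -> vpos b -> b <> alpha i ->
  vpos (weyl_end x^-1%g b) ->
  [/\ rroot (weyl_end (s i) b),
    (s i * (rootrefl b * x) = rootrefl (weyl_end (s i) b) * (s i * x))%g &
    (len (s i * x)%g < len (s i * (rootrefl b * x))%g)%N].
Proof.
move=> rb pb bi xb; have E : (s i * (rootrefl b * x) = rootrefl (weyl_end (s i) b) * (s i * x))%g.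
  by rewrite rootrefl_weyl // -!mulgA mulKg.
split=> //; first exact: rroot_weyl.
rewrite E; apply: rootrefl_gt; [exact: rroot_weyl|exact: vpos_s|].
by rewrite invgM weyl_endM weyl_endK.
Qed.

(** In a chain from [u] to [v], left multiplication by [s i] keeps each step increasing
    ([rootrefl_conj_gt]), except a step by [s i] itself, where it sends the lower element to the
    upper one. *)
Lemma ble_lift i u v : ble u v -> ble (s i * u)%g v \/ ble (s i * u)%g (s i * v)%g.
Proof.
case=> [->|]; first by right; left.
elim=> {u v} [x y xy|x y z xy IHx yz IHy].
  have [b [rb pb yE xb]] := bruhat_stepP xy.
  have [bi|/eqP bi] := eqVneq b (alpha i).
    by left; left; rewrite yE bi rootrefl_simple.
  have [rb' E lt] := rootrefl_conj_gt rb pb bi xb.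
  by right; rewrite yE; move: lt; rewrite E; apply: ble_rootrefl.
have [xy'|xy'] := IHx; first by left; apply: bleT xy' _; right.
by have [yz'|yz'] := IHy; [left|right]; apply: bleT xy' yz'.
Qed.

Lemma rootrefl_cover i v b : rroot b -> vpos b ->
  len (rootrefl b * v)%g = (len v).+1 -> (len v < len (s i * v)%g)%N ->
  (len (s i * (rootrefl b * v))%g < len (rootrefl b * v)%g)%N -> b = alpha i.
Proof.
move=> rb pb bv iv ibv; have [//|/eqP bi] := eqVneq b (alpha i).
have [[vb _]|[_]] := rootrefl_len v rb pb; last by lia.
by have [_ _] := rootrefl_conj_gt rb pb bi vb; lia.
Qed.

End WeylReflections.

(** * Variables attached to real roots *)

Section LatticeBasis.
Variables (K : realType) (n : nat) (A : generalized_cartan_matrix n).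
Variables (D : root_datum K A) (Lam : demazure_lattice D).
Local Notation V := (dual_cartan D).
Local Notation L := (lattice Lam).

Lemma lattice_coord (m : nat) (b : 'I_m -> V) : is_Zbasis (lattice_pred Lam) b ->
  exists (b' : 'I_m -> L) (coord : 'I_m -> {additive L -> int}),
    [/\ forall j, val (b' j) = b j, forall l, l = \sum_j b' j *~ coord j l &
        forall i j, coord j (b' i) = (i == j)%:~R].
Proof.
move=> [bU bP]; pose b' j : L := LatticeElt (bU j).
have val_sum (c : 'I_m -> int) : val (\sum_j b' j *~ c j) = \sum_j b j *~ c j.
  by rewrite raddf_sum; apply: eq_bigr => j _; apply: raddfMz.
have /choice[c cP] (l : L) : exists c : {ffun 'I_m -> int}, l = \sum_j b' j *~ c j.
  by have [c [cl _]] := bP _ (valP l); exists c; apply: val_inj; rewrite val_sum.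
have cU (l : L) (d : 'I_m -> int) : l = \sum_j b' j *~ d j -> c l = finfun d.
  move=> ld; have [e [_ eU]] := bP _ (valP l).
  rewrite -(eU (c l)); first apply: eU.
    by rewrite {1}ld val_sum; apply: eq_bigr => j _; rewrite ffunE.
  by rewrite {1}[l]cP val_sum.
have cB j : zmod_morphism (fun l => c l j).
  move=> l1 l2; rewrite (cU (l1 - l2) (fun j => c l1 j - c l2 j)) ?ffunE //.
  rewrite {1}[l1]cP {1}[l2]cP -sumrB; apply: eq_bigr => k _.
  by rewrite mulrzBr.
pose cM j := GRing.isZmodMorphism.Build _ _ (fun l => c l j) (cB j).
exists b', (fun j => HB.pack (fun l => c l j) (cM j) : {additive L -> int}).
split=> // i j /=; rewrite (cU (b' i) (fun j => (i == j)%:~R)) ?ffunE //.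
rewrite (bigD1 i) //= eqxx mulr1z big1 ?addr0 // => k /negbTE.
by rewrite eq_sym => ->; rewrite mulr0z.
Qed.

End LatticeBasis.

Section RootVariables.
Variables (K : realType) (n : nat) (A : generalized_cartan_matrix n).
Variables (D : root_datum K A) (Lam : demazure_lattice D).
Variables (R : comNzRingType) (F : formal_group_law R).
Hypothesis domR : no_zero_divisor R.
Hypothesis charR : forall c : int, c%:~R = 0 :> R -> c = 0.
Local Notation V := (dual_cartan D).
Local Notation W := (weyl D).
Local Notation L := (lattice Lam).
Local Notation S := (demazure_S Lam F).
Local Notation x := (fga_var F).
Local Notation alpha := (lattice_simple_root Lam).
Local Notation act := (@lattice_act K n A D Lam).
Local Notation wS := (weyl_S Lam F).
Implicit Types (u v w : W) (a b l : L) (y z : S).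

Lemma val_act w l : val (act w l) = weyl_end w (val l).
Proof. by []. Qed.

Lemma actM v w l : act (v * w)%g l = act v (act w l).
Proof. by apply: val_inj; rewrite !val_act weyl_endM. Qed.

Lemma act1 l : act 1%g l = l.
Proof. by apply: val_inj; rewrite val_act weyl_end1. Qed.

Lemma actK w l : act w^-1%g (act w l) = l.
Proof. by rewrite -actM mulVg act1. Qed.

Lemma weyl_S_var w l : wS w (x l) = x (act w l).
Proof. exact: fga_map_var. Qed.

Lemma weyl_S1 z : wS 1%g z = z.
Proof. exact: fga_map_id act1 z. Qed.

Lemma weyl_SM v w z : wS (v * w)%g z = wS v (wS w z).
Proof. exact: fga_map_comp (actM v w) z. Qed.

Lemma weyl_SK w z : wS w^-1%g (wS w z) = z.
Proof. by rewrite -weyl_SM mulVg weyl_S1. Qed.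

Lemma weyl_SVK w z : wS w (wS w^-1%g z) = z.
Proof. by rewrite -weyl_SM mulgV weyl_S1. Qed.

Lemma rdvd_weyl w a z : rdvd (x (act w a)) (wS w z) <-> rdvd (x a) z.
Proof.
have H v l (y : S) : rdvd (x l) y -> rdvd (x (act v l)) (wS v y).
  by move=> [c ->]; exists (wS v c); rewrite rmorphM weyl_S_var.
by split=> [/(H w^-1%g)|/(H w)//]; rewrite actK weyl_SK.
Qed.

Lemma rdvd_weylV w a z : rdvd (x (act w a)) z <-> rdvd (x a) (wS w^-1%g z).
Proof. by rewrite -[z in X in X <-> _](weyl_SVK w); apply: rdvd_weyl. Qed.

Lemma real_rootP a : real_root a <-> rroot (val a).
Proof.
split=> [[w [i ->]]|[w [i E]]]; first by exists w, i.
by exists w, i; apply: val_inj.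
Qed.

Lemma real_root_act w a : real_root a -> real_root (act w a).
Proof. by move=> /real_rootP ra; apply/real_rootP/rroot_weyl. Qed.

Lemma real_root_opp a : real_root a -> real_root (- a).
Proof. by move=> /real_rootP ra; apply/real_rootP; rewrite raddfN; apply: rroot_opp. Qed.

Lemma real_root_simple i : real_root (alpha i).
Proof. by apply/real_rootP/rroot_alpha. Qed.

Definition srefl a : W := rootrefl (val a).

Lemma act_srefl_self a : real_root a -> act (srefl a) a = - a.
Proof.
by move=> /real_rootP ra; apply: val_inj; rewrite val_act rootrefl_self.
Qed.

Lemma srefl_act w a : real_root a -> srefl (act w a) = (w * srefl a * w^-1)%g.
Proof. by move=> /real_rootP; apply: rootrefl_weyl. Qed.

Lemma srefl_simple i : srefl (alpha i) = simple_refl D i.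
Proof. exact: rootrefl_simple. Qed.

Lemma act_simple i l : exists k, act (simple_refl D i) l = l + alpha i *~ k.
Proof.
have [k kE] := lattice_int i (valP l); exists (- k); apply: val_inj.
rewrite val_act weyl_end_s kE scaler_int mulrNz.
by apply/esym; apply: etrans (raddfB val l _) _; congr (_ - _); apply: raddfMz.
Qed.

(** The case of a simple root is [fga_basis_prime], as simple roots extend to
    bases; the general case follows by the action of the Weyl group. *)
Lemma root_var_prime a : real_root a ->
  [/\ no_zero_divisor S, x a <> 0 /\ ~ rdvd (x a) 1,
      forall y z, rdvd (x a) (y * z) -> rdvd (x a) y \/ rdvd (x a) z,
      forall l, rdvd (x a) (x l) -> exists c, l = a *~ c &
      forall z, rdvd (x a) (z - wS (srefl a) z)].
Proof.
move=> [w [i ->]]; have [m [b [j [/lattice_coord[b' [coord [bE cP cB]] bj]]]]] :=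
  lattice_extend Lam i.
have ai : alpha i = b' j by apply: val_inj; rewrite bE bj.
have [domS [x0 x1] xprime xdvd xrefl] := fga_basis_prime F domR charR cP cB j.
rewrite -ai in x0 x1 xprime xdvd xrefl.
split=> //.
- split=> [E|/rdvd_weylV]; last by rewrite rmorph1.
  by apply: x0; apply: (can_inj (weyl_SK w)); rewrite weyl_S_var rmorph0.
- move=> y z /rdvd_weylV; rewrite rmorphM => /xprime.
  by case=> H; [left|right]; apply/rdvd_weylV.
- move=> l /rdvd_weylV; rewrite weyl_S_var => /xdvd[c E]; exists c.
  by have := congr1 (act w) E; rewrite -actM mulgV act1 => ->; apply: raddfMz.
move=> z; rewrite srefl_act; last exact: real_root_simple.
rewrite srefl_simple -[z](weyl_SVK w); move: (wS w^-1%g z) => y.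
rewrite -weyl_SM mulgVK weyl_SM -rmorphB.
by apply/rdvd_weyl/xrefl => l; apply: act_simple.
Qed.

Lemma root_varN_dvd a : rdvd (x a) (x (- a)).
Proof. by have [c] := fga_varN_dvd F (- a); rewrite opprK => ->; exists c. Qed.

End RootVariables.

(** * Localization *)

Section LocalizationLift.
Variables (S : comNzRingType) (G : set S).
Local Notation Q := (localization G).
Local Notation piQ := (\pi_Q)%qT.

Definition invertible (B : comPzRingType) (b : B) : Prop := exists r, r * b = 1.

Lemma ring_invP (B : comPzRingType) (b : B) : invertible b -> ring_inv b * b = 1.
Proof.
by move=> [r rb]; rewrite /ring_inv; case: xgetP => [s _ //|/(_ r)].
Qed.

Lemma invertibleM (B : comPzRingType) (b c : B) :
  invertible b -> invertible c -> invertible (b * c).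
Proof. by move=> [r rb] [s sc]; exists (r * s); rewrite mulrACA rb sc mulr1. Qed.

Lemma invertible_dvd (B : comPzRingType) (b c : B) : invertible (b * c) -> invertible b.
Proof. by move=> [r rb]; exists (r * c); rewrite -mulrA [c * b]mulrC. Qed.

Lemma invertible_reg (B : comPzRingType) (b c d : B) :
  invertible b -> b * c = b * d -> c = d.
Proof. by move=> [r rb] E; rewrite -[c]mul1r -[d]mul1r -rb -!mulrA E. Qed.

Lemma invertible_morph (B C : comPzRingType) (f : {rmorphism B -> C}) b :
  invertible b -> invertible (f b).
Proof. by move=> [r rb]; exists (f r); rewrite -rmorphM rb rmorph1. Qed.

Lemma mul_gen_loc m : mul_gen G m -> invertible (to_loc G m).
Proof.
move=> Gm; exists (piQ (1, Denominator Gm)).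
rewrite -[_ * _]/(loc_mul _ _) /to_loc loc_mulE.
by apply: fraction_eq; rewrite /= !mul1r mulr1.
Qed.

Lemma locP (q : Q) : exists s m, mul_gen G m /\ to_loc G m * q = to_loc G s.
Proof.
rewrite -[q]reprK; move: (repr q) => [s m]; exists s, (val m).
split; first exact: denominatorP.
rewrite -[_ * _]/(loc_mul _ _) /to_loc loc_mulE.
by apply: fraction_eq; rewrite /= mul1r mulr1 mulrC.
Qed.

Lemma loc_morph_eq (B : comPzRingType) (f g : {rmorphism Q -> B}) :
  (forall s, f (to_loc G s) = g (to_loc G s)) -> f =1 g.
Proof.
move=> fg q; have [s [m [/mul_gen_loc Gm E]]] := locP q.
apply: (invertible_reg (invertible_morph f Gm)).
by rewrite -rmorphM E fg -E rmorphM fg.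
Qed.

Lemma to_loc_inj : (forall m, mul_gen G m -> forall s, m * s = 0 -> s = 0) ->
  injective (to_loc G).
Proof.
move=> Greg s t /fraction_eqP[u Gu] /=; rewrite !mulr1 => /(Greg u Gu)/eqP.
by rewrite subr_eq0 => /eqP.
Qed.

Variables (B : comPzRingType) (f : {rmorphism S -> B}).
Hypothesis fG : forall m, mul_gen G m -> invertible (f m).

Definition loc_lift of (forall m, mul_gen G m -> invertible (f m)) : Q -> B :=
  fun q => f (repr q).1 * ring_inv (f (val (repr q).2)).
Local Notation lift := (loc_lift fG).

Lemma loc_liftE p : lift (piQ p) = f p.1 * ring_inv (f (val p.2)).
Proof.
have /fraction_eqP[u Gu] : piQ (repr (piQ p)) = piQ p by rewrite reprK.
rewrite /loc_lift; move: (repr _) => p' E.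
have fd (d : denominator G) : ring_inv (f (val d)) * f (val d) = 1.
  by apply/ring_invP/fG/denominatorP.
apply: (invertible_reg (b := f (val p.2 * val p'.2))).
  by apply: fG; apply: mul_genM; apply: denominatorP.
transitivity (f (p'.1 * val p.2)).
  rewrite !rmorphM -[RHS]mulr1 -(fd p'.2); ring.
transitivity (f (p.1 * val p'.2)).
  apply: (invertible_reg (fG Gu)); rewrite -!rmorphM; apply/eqP.
  by rewrite -subr_eq0 -rmorphB -mulrBr E rmorph0.
by rewrite !rmorphM -[LHS]mulr1 -(fd p.2); ring.
Qed.

Lemma loc_lift_to_loc s : lift (to_loc G s) = f s.
Proof.
rewrite loc_liftE /=; have := ring_invP (fG (mul_gen1 G)).
by rewrite rmorph1 mulr1 => ->; rewrite mulr1.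
Qed.

Lemma loc_lift_eq q s m : mul_gen G m -> to_loc G m * q = to_loc G s ->
  f m * lift q = f s.
Proof.
move=> Gm; rewrite -[q]reprK; move: (repr q) => p.
rewrite -[_ * _]/(loc_mul _ _) /to_loc loc_mulE => /fraction_eqP[u Gu] /=.
rewrite mul1r mulr1 loc_liftE => E.
apply: (invertible_reg (fG (denominatorP p.2))).
transitivity (f (m * p.1)).
  rewrite rmorphM -[RHS]mulr1 -(ring_invP (fG (denominatorP p.2))); ring.
apply: (invertible_reg (fG Gu)); rewrite -!rmorphM; apply/eqP.
rewrite -subr_eq0 -rmorphB -mulrBr.
by rewrite [val p.2 * s]mulrC E rmorph0.
Qed.

Fact loc_lift_zmod : zmod_morphism lift.
Proof.
move=> q q'; have [s [m [Gm E]]] := locP q; have [s' [m' [Gm' E']]] := locP q'.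
apply: (invertible_reg (fG (mul_genM Gm Gm'))).
rewrite (@loc_lift_eq _ (s * m' - s' * m)); [|exact: mul_genM|]; last first.
  have -> : to_loc G (s * m' - s' * m) =
      to_loc G s * to_loc G m' - to_loc G s' * to_loc G m.
    by rewrite rmorphB !rmorphM.
  by rewrite -E -E' rmorphM; ring.
by rewrite rmorphB !rmorphM -(loc_lift_eq Gm E) -(loc_lift_eq Gm' E'); ring.
Qed.

Fact loc_lift_monoid : monoid_morphism lift.
Proof.
split=> [|q q'].
  by rewrite -(rmorph1 (to_loc G)) loc_lift_to_loc rmorph1.
have [s [m [Gm E]]] := locP q; have [s' [m' [Gm' E']]] := locP q'.
apply: (invertible_reg (fG (mul_genM Gm Gm'))).
rewrite (@loc_lift_eq _ (s * s')); [|exact: mul_genM|]; last first.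
  have -> : to_loc G (s * s') = to_loc G s * to_loc G s' by rewrite rmorphM.
  by rewrite -E -E' rmorphM; ring.
by rewrite !rmorphM -(loc_lift_eq Gm E) -(loc_lift_eq Gm' E'); ring.
Qed.

HB.instance Definition _ := GRing.isZmodMorphism.Build _ _ lift loc_lift_zmod.
HB.instance Definition _ := GRing.isMonoidMorphism.Build _ _ lift loc_lift_monoid.

End LocalizationLift.

Section LocalizedActionExtends.
Variables (W : groupType) (S : comNzRingType) (G : set S).
Variable act : W -> {rmorphism S -> S}.
Hypothesis act1 : forall s, act 1%g s = s.
Hypothesis actM : forall v w s, act (v * w)%g s = act v (act w s).
Hypothesis actG : forall w a, G a -> invertible (to_loc G (act w a)).

(** The extension is built with [loc_lift], and [loc_morph_eq] gives its action laws; so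
    [loc_action] is this extension and not the trivial default. *)
Lemma loc_actionE w s : loc_action G act w (to_loc G s) = to_loc G (act w s).
Proof.
suff ex : exists b, extends_action (G := G) act b.
  rewrite /loc_action; case: pselect => [e|/(_ ex) //].
  exact: (projT2 (cid e)).
have actQ v m : mul_gen G m -> invertible ((to_loc G \o act v) m).
  move=> [l lG ->]; rewrite rmorph_prod big_seq; apply: big_ind => [||a al].
  - by exists 1; rewrite mulr1.
  - exact: invertibleM.
  - exact/actG/lG.
pose b v : {rmorphism localization G -> localization G} := loc_lift (actQ v).
have bE v r : b v (to_loc G r) = to_loc G (act v r) by apply: loc_lift_to_loc.
have b1 q : b 1%g q = q.
  by apply: (loc_morph_eq (f := b 1%g) (g := idfun)) => r; rewrite bE act1.
have bM v u q : b (v * u)%g q = b v (b u q).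
  apply: (loc_morph_eq (f := b (v * u)%g) (g := b v \o b u)) => r.
  by rewrite /= !bE actM.
by exists (RingAction b1 bM).
Qed.

End LocalizedActionExtends.

(** * Poles along real roots *)

Section LocalizedRootVariables.
Variables (K : realType) (n : nat) (A : generalized_cartan_matrix n).
Variables (D : root_datum K A) (Lam : demazure_lattice D).
Variables (R : comNzRingType) (F : formal_group_law R).
Hypothesis domR : no_zero_divisor R.
Hypothesis charR : forall c : int, c%:~R = 0 :> R -> c = 0.
Local Notation W := (weyl D).
Local Notation L := (lattice Lam).
Local Notation S := (demazure_S Lam F).
Local Notation Q := (demazure_Q Lam F).
Local Notation x := (fga_var F).
Local Notation alpha := (lattice_simple_root Lam).
Local Notation act := (@lattice_act K n A D Lam).
Local Notation wS := (weyl_S Lam F).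
Local Notation wQ := (weyl_Q Lam F).
Implicit Types (u v w : W) (a b l : L) (y z s d : S) (p q : Q).

Let G : set S := [set s : S | exists2 a : L, positive_root a & s = fga_var F a].
Definition dloc : {rmorphism S -> Q} := to_loc G.
Local Notation iota := dloc.

Lemma positive_rootP a : positive_root a <-> real_root a /\ vpos (val a).
Proof.
split=> -[ra [c]]; [move=> aE|move=> c0 aE]; split=> //.
  exists (fun i => (c i)%:Z) => //; rewrite aE raddf_sum.
  by apply: eq_bigr => i _; apply: raddfMn.
exists (fun i => `|c i|%N); apply: val_inj; rewrite aE raddf_sum.
apply: eq_bigr => i _; rewrite -[in LHS](gez0_abs (c0 i)); apply/esym.
exact: raddfMn.
Qed.

Lemma real_root_posneg a : real_root a -> positive_root a \/ positive_root (- a).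
Proof.
move=> ra; have /real_rootP/rroot_posneg[pa|na] := ra.
  by left; apply/positive_rootP.
by right; apply/positive_rootP; split; [apply: real_root_opp|rewrite raddfN].
Qed.

Lemma dloc_var_inv a : real_root a -> invertible (iota (x a)).
Proof.
have H b : positive_root b -> invertible (iota (x b)).
  by move=> pb; apply/mul_gen_loc/mul_gen_sub; exists b.
move=> /real_root_posneg[/H //|/H]; have [c ->] := root_varN_dvd F a.
by rewrite rmorphM => /invertible_dvd.
Qed.

Lemma weyl_Q_loc w s : wQ w (iota s) = iota (wS w s).
Proof.
apply: loc_actionE => [z|v u z|v z [a /positive_rootP[ra _] ->]].
- exact: weyl_S1.
- exact: weyl_SM.
- by rewrite weyl_S_var; apply/dloc_var_inv/real_root_act.
Qed.

Lemma dloc_inj : injective iota.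
Proof.
apply: to_loc_inj => _ [l lG ->]; elim: l lG => [|a l IHl] lG s.
  by rewrite big_nil mul1r.
have /lG[b /positive_rootP[rb _] E] : a \in a :: l by rewrite inE eqxx.
have [domS [xb _] _ _ _] := root_var_prime F domR charR rb.
rewrite big_cons -mulrA => /domS[a0|]; first by case: xb; rewrite -E.
by apply: IHl => c cl; apply: lG; rewrite inE cl orbT.
Qed.

Definition xinv a : Q := ring_inv (iota (x a)).

Lemma xinvK a : real_root a -> xinv a * iota (x a) = 1.
Proof. by move=> /dloc_var_inv/ring_invP. Qed.

Lemma weyl_Q_xinv w a : real_root a -> wQ w (xinv a) = xinv (act w a).
Proof.
move=> ra; have rwa := real_root_act w ra.
apply: (invertible_reg (dloc_var_inv rwa)).
by rewrite [RHS]mulrC xinvK // -weyl_S_var -weyl_Q_loc -rmorphM mulrC xinvK ?rmorph1.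
Qed.

(** The elements of the localization of [S] at the prime ideal generated by [x a] *)
Definition reg a q : Prop :=
  exists d s, ~ rdvd (x a) d /\ iota d * q = iota s.

Lemma reg_loc a s : real_root a -> reg a (iota s).
Proof.
move=> ra; exists 1, s; split; last by rewrite rmorph1 mul1r.
by have [_ [_ xa1] _ _ _] := root_var_prime F domR charR ra.
Qed.

Lemma not_rdvdM a y z : real_root a ->
  ~ rdvd (x a) y -> ~ rdvd (x a) z -> ~ rdvd (x a) (y * z).
Proof. by move=> ra ny nz; have [_ _ xp _ _] := root_var_prime F domR charR ra; case/xp. Qed.

Lemma regD a p q : real_root a -> reg a p -> reg a q -> reg a (p + q).
Proof.
move=> ra [d [s [nd E]]] [d' [s' [nd' E']]]; exists (d * d'), (s * d' + s' * d).
split; first exact: not_rdvdM.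
by rewrite rmorphD !rmorphM -E -E'; ring.
Qed.

Lemma regM a p q : real_root a -> reg a p -> reg a q -> reg a (p * q).
Proof.
move=> ra [d [s [nd E]]] [d' [s' [nd' E']]]; exists (d * d'), (s * s').
by split; [exact: not_rdvdM|rewrite !rmorphM -E -E'; ring].
Qed.

Lemma regN a p : real_root a -> reg a p -> reg a (- p).
Proof. by move=> ra [d [s [nd E]]]; exists d, (- s); rewrite mulrN E rmorphN. Qed.

Lemma regB a p q : real_root a -> reg a p -> reg a q -> reg a (p - q).
Proof. by move=> ra pa /regN qa; apply: regD => //; apply: qa. Qed.

Lemma reg_weyl w a q : reg a q -> reg (act w a) (wQ w q).
Proof.
move=> [d [s [nd E]]]; exists (wS w d), (wS w s); split.
  by move=> /rdvd_weyl.
by rewrite -!weyl_Q_loc -rmorphM E.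
Qed.

Lemma rdvd_opp a z : rdvd (x (- a)) z <-> rdvd (x a) z.
Proof.
have H b : rdvd (x (- b)) z -> rdvd (x b) z.
  by have [c ->] := root_varN_dvd F b; move=> [e ->]; exists (c * e); rewrite mulrA.
by split=> [/H//|]; rewrite -{1}[a]opprK => /H.
Qed.

Lemma reg_opp a q : reg (- a) q <-> reg a q.
Proof.
by split=> -[d [s [nd E]]]; exists d, s; split=> // H; apply: nd; apply/rdvd_opp.
Qed.

Lemma real_root_dvd a b : real_root a -> real_root b ->
  rdvd (x a) (x b) -> b = a \/ b = - a.
Proof.
move=> ra rb; have [_ _ _ xdvd _] := root_var_prime F domR charR ra.
move=> /xdvd[c bE].
have := @rroot_proportional _ _ _ _ (val a) (val b) c.
case=> [|||E|E]; try exact/real_rootP.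
- by rewrite bE; apply: raddfMz.
- by left; apply: val_inj.
- by right; apply: val_inj; rewrite raddfN.
Qed.

Lemma reg_xinv a b : real_root a -> real_root b -> b <> a -> b <> - a ->
  reg a (xinv b).
Proof.
move=> ra rb ba bna; exists (x b), 1; split; last by rewrite mulrC xinvK ?rmorph1.
by move=> /(real_root_dvd ra rb)[].
Qed.

(** Numerator and denominator are congruent to their images under [srefl a] modulo [x a], so a
    factor [x a] cancels. For the same reason the new denominator [d * wS (srefl a) d] is still not
    divisible by [x a]. *)
Lemma reg_diff a q : real_root a -> reg a q ->
  reg a (xinv a * (q - wQ (srefl a) q)).
Proof.
move=> ra [d [s [nd E]]].
have [_ _ _ _ xrefl] := root_var_prime F domR charR ra.
have [[d1 dE] [s1 sE]] := (xrefl d, xrefl s).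
have Ew : iota (wS (srefl a) d) * wQ (srefl a) q = iota (wS (srefl a) s).
  by rewrite -!weyl_Q_loc -rmorphM E.
exists (d * wS (srefl a) d), (d * s1 - s * d1); split.
  apply: not_rdvdM => // -[c cE]; apply: nd; exists (d1 + c).
  by rewrite mulrDr -dE -cE subrK.
transitivity (xinv a * iota (s * wS (srefl a) d - d * wS (srefl a) s)).
  by rewrite rmorphB !rmorphM -E -Ew; ring.
have -> : s * wS (srefl a) d - d * wS (srefl a) s = x a * (d * s1 - s * d1).
  rewrite mulrBr mulrCA -sE mulrCA -dE; ring.
by rewrite rmorphM mulrA xinvK // mul1r.
Qed.

(** A denominator is a product of variables [x a]; as these are primes, regularity at [a] forces the
    numerator to be divisible by the first factor, which is cancelled, and so on. *)
Lemma reg_everywhere q : (forall a, positive_root a -> reg a q) ->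
  exists s, q = iota s.
Proof.
move=> qreg; have [s [_ [[l lG ->]]]] := locP q.
elim: l lG s => [|y l IHl] lG s.
  by rewrite big_nil rmorph1 mul1r => ->; exists s.
have /lG[a pa yE] : y \in y :: l by rewrite inE eqxx.
have [ra _] := proj1 (positive_rootP a) pa.
rewrite big_cons yE => E; have [d [s' [nd Ed]]] := qreg a pa.
have [_ _ xprime _ _] := root_var_prime F domR charR ra.
have : rdvd (x a) (d * s).
  exists (\prod_(c <- l) c * s'); apply: dloc_inj.
  by rewrite !rmorphM -Ed -[iota s]E rmorphM; ring.
case/xprime => [//|[s2 s2E]]; apply: (IHl _ s2) => [c cl|].
  by apply: lG; rewrite inE cl orbT.
apply: (invertible_reg (dloc_var_inv ra)).
by rewrite -rmorphM -s2E -[iota s]E rmorphM mulrA.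
Qed.

(** The sum is [(x_a + x_(-a)) / (x_a x_(-a))], and by [fga_varN] the denominator divides the
    numerator. This cancels the poles in [residue_elt]. *)
Lemma xinv_sum a : real_root a -> exists c, xinv a + xinv (- a) = iota c.
Proof.
move=> ra; have rna := real_root_opp ra; have [c E] := fga_varN F a; exists c.
apply: (invertible_reg (invertibleM (dloc_var_inv ra) (dloc_var_inv rna))).
transitivity (iota (x a + x (- a))); last by rewrite E !rmorphM.
rewrite rmorphD; transitivity ((xinv a * iota (x a)) * iota (x (- a)) +
  (xinv (- a) * iota (x (- a))) * iota (x a)); first by ring.
by rewrite !xinvK // !mul1r addrC.
Qed.

End LocalizedRootVariables.

(** * Residues of products of Demazure elements *)

Section TwistedCoefficients.
Variables (W : groupType) (Q : pzRingType) (act : ring_action W Q).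
Local Notation QW := (twisted act).
Implicit Types (a b : QW) (q r : Q) (u v w : W).

Definition tw_coef v a : Q := mcoeff v (a : {malg Q[W]}).

Lemma tw_coefB v a b : tw_coef v (a - b) = tw_coef v a - tw_coef v b.
Proof. exact: mcoeffB. Qed.

Lemma tw_coefD v a b : tw_coef v (a + b) = tw_coef v a + tw_coef v b.
Proof. exact: mcoeffD. Qed.

Lemma tw_coef0 v : tw_coef v 0 = 0.
Proof. exact: mcoeff0. Qed.

Lemma tw_coef_sum v (T : Type) (r : seq T) (f : T -> QW) :
  tw_coef v (\sum_(i <- r) f i) = \sum_(i <- r) tw_coef v (f i).
Proof. by elim/big_rec2: _ => [|i y z _ <-]; rewrite ?tw_coef0 ?tw_coefD. Qed.

Lemma tw_coefP a b : (forall v, tw_coef v a = tw_coef v b) -> a = b.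
Proof. by move=> ab; apply/malgP. Qed.

Lemma tw_coefU v q w : tw_coef v (<< q *g w >> : {malg Q[W]}) = q *+ (w == v).
Proof. exact: mcoeffU. Qed.

Let tw_mulUU q v r w :
  (<< q *g v >> : QW) * (<< r *g w >> : QW) = (<< q * act v r *g (v * w)%g >> : QW).
Proof.
rewrite -[LHS]/(tw_mul _ _) /tw_mul !msuppU.
have [->|q0] := eqVneq q 0; first by rewrite big_seq_fset0 mul0r monalgU0.
rewrite big_seq_fset1; have [->|r0] := eqVneq r 0.
  by rewrite big_seq_fset0 rmorph0 mulr0 monalgU0.
by rewrite big_seq_fset1 !mcoeffUU.
Qed.

Lemma tw_coef_mulU v q u a :
  tw_coef v ((<< q *g u >> : QW) * a) = q * act u (tw_coef (u^-1 * v)%g a).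
Proof.
have aE : a = \sum_(w <- msupp (a : {malg Q[W]})) (<< mcoeff w (a : {malg Q[W]}) *g w >> : QW).
  exact: monalgE.
rewrite [in LHS]aE [in RHS]aE mulr_sumr !tw_coef_sum rmorph_sum mulr_sumr.
apply: eq_bigr => w _; rewrite tw_mulUU !tw_coefU rmorphMn mulrnAr.
by congr (_ *+ _); rewrite -[in RHS](inj_eq (mulgI u)) mulVKg.
Qed.

Lemma tw_coef_scalar v q a : tw_coef v (tw_scalar act q * a) = q * tw_coef v a.
Proof. by rewrite tw_coef_mulU ract1 invg1 mul1g. Qed.

Lemma tw_coef_delta v u a :
  tw_coef v (tw_delta act u * a) = act u (tw_coef (u^-1 * v)%g a).
Proof. by rewrite tw_coef_mulU mul1r. Qed.

Lemma tw_coef_difference v q u a :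
  tw_coef v (tw_scalar act q * (1 - tw_delta act u) * a) =
  q * (tw_coef v a - act u (tw_coef (u^-1 * v)%g a)).
Proof. by rewrite -mulrA tw_coef_scalar mulrBl mul1r tw_coefB tw_coef_delta. Qed.

Lemma tw_coef1 v : tw_coef v 1 = (v == 1%g)%:R.
Proof. by rewrite [LHS]tw_coefU eq_sym. Qed.

End TwistedCoefficients.

Section DemazureWords.
Variables (K : realType) (n : nat) (A : generalized_cartan_matrix n).
Variables (D : root_datum K A) (Lam : demazure_lattice D).
Variables (R : comNzRingType) (F : formal_group_law R).
Hypothesis domR : no_zero_divisor R.
Hypothesis charR : forall c : int, c%:~R = 0 :> R -> c = 0.
Local Notation W := (weyl D).
Local Notation L := (lattice Lam).
Local Notation S := (demazure_S Lam F).
Local Notation Q := (demazure_Q Lam F).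
Local Notation QW := (demazure_QW Lam F).
Local Notation x := (fga_var F).
Local Notation alpha := (lattice_simple_root Lam).
Local Notation act := (@lattice_act K n A D Lam).
Local Notation wQ := (weyl_Q Lam F).
Local Notation iota := (dloc Lam F).
Local Notation xinv := (@xinv K n A D Lam R F).
Local Notation s := (simple_refl D).
Local Notation len := (@weyl_length K n A D).
Local Notation wprod := (wprod D).
Local Notation cf := (@tw_coef _ _ wQ).
Implicit Types (u v w : W) (a b : L) (i : 'I_n) (I J : seq 'I_n) (y z : QW).

Lemma cf_demazure_elt v i y : cf v (demazure_elt Lam F 1%g i * y) =
  xinv (alpha i) * (cf v y - wQ (s i) (cf (s i * v)%g y)).
Proof.
rewrite /demazure_elt root_refl1 act1 -{3}(s_inv D i).
exact: (@tw_coef_difference W Q wQ v (xinv (alpha i)) (s i) y).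
Qed.

Definition dword I : QW := \prod_(i <- I) demazure_elt Lam F 1%g i.

Lemma dword_cons i I : dword (i :: I) = demazure_elt Lam F 1%g i * dword I.
Proof. exact: big_cons. Qed.

Lemma dword_nil : dword [::] = 1.
Proof. exact: big_nil. Qed.

(** The coefficients have at most simple poles, with opposite residues at [v] and
    [srefl a * v] along [x a]. *)
Definition residue y := forall a v, real_root a ->
  reg a (iota (x a) * cf v y) /\ reg a (cf v y + cf (srefl a * v)%g y).

Lemma residueB y z : residue y -> residue z -> residue (y - z).
Proof.
move=> ry rz a v ra; have [[y1 y2] [z1 z2]] := (ry a v ra, rz a v ra).
rewrite !tw_coefB; split; first by rewrite mulrBr; apply: regB.
by rewrite addrACA -opprD; apply: regB.
Qed.

Lemma residue0 : residue 0.
Proof.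
move=> a v ra; rewrite !tw_coef0 mulr0 addr0 -(rmorph0 iota).
by split; apply: reg_loc.
Qed.

Lemma residueD y z : residue y -> residue z -> residue (y + z).
Proof.
move=> ry rz; rewrite -[z]opprK; apply: residueB => //.
by rewrite -sub0r; apply: residueB => //; apply: residue0.
Qed.

Lemma residueS t y : residue y -> residue (S_to_QW t * y).
Proof.
move=> ry a v ra; have [y1 y2] := ry a v ra; have rt : reg a (iota t) by apply: reg_loc.
rewrite !tw_coef_scalar -mulrDr mulrCA.
by split; apply: regM.
Qed.

Lemma residue1 : residue 1.
Proof.
move=> a v ra; rewrite !tw_coef1 -!(rmorph_nat iota).
by rewrite -rmorphM -rmorphD; split; apply: reg_loc.
Qed.

(** For [a] other than [alpha i] and its opposite, [1 / x_(alpha i)] is regular at [a], and [s i]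
    carries the conditions at [s_i(a)] to those at [a]. The case of [alpha i] uses the opposite
    residues of [y], which prevent double poles. *)
Lemma residue_elt i y : residue y -> residue (demazure_elt Lam F 1%g i * y).
Proof.
move=> ry a v ra; have ri := real_root_simple Lam i.
have sK u : (s i * (s i * u))%g = u by rewrite mulgA s_sq mul1g.
have simple : reg (alpha i) (iota (x (alpha i)) * cf v (demazure_elt Lam F 1%g i * y)) /\
    reg (alpha i) (cf v (demazure_elt Lam F 1%g i * y) +
      cf (s i * v)%g (demazure_elt Lam F 1%g i * y)).
  have [y1 y2] := ry _ v ri; rewrite srefl_simple in y2.
  have r_s q : reg (alpha i) q -> reg (alpha i) (wQ (s i) q).
    move=> /(reg_weyl (s i)); rewrite -{1}(srefl_simple Lam i) act_srefl_self //.
    by move=> /reg_opp.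
  rewrite !cf_demazure_elt sK; set p := cf v y in y1 y2 *; set q := cf (s i * v)%g y in y2 *.
  split.
    rewrite mulrA [iota _ * xinv _]mulrC xinvK // mul1r.
    (* With [e = p + q] and [t = x_(alpha i) p], both regular, [p - s_i(q)] becomes the divided
       difference of [t], plus [s_i(t)] times the sum in [xinv_sum], minus [s_i(e)]. *)
    have qE : q = (p + q) - xinv (alpha i) * (iota (x (alpha i)) * p).
      by rewrite mulrA xinvK // mul1r addrC addKr.
    have pE : p = xinv (alpha i) * (iota (x (alpha i)) * p).
      by rewrite mulrA xinvK ?mul1r.
    move: (p + q) (iota (x (alpha i)) * p) y1 y2 qE pE => e t rt re -> ->.
    have [c cE] := xinv_sum F ri.
    rewrite rmorphB rmorphM weyl_Q_xinv // -{2}(srefl_simple Lam i) act_srefl_self //.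
    have -> : xinv (alpha i) * t - (wQ (s i) e - xinv (- alpha i) * wQ (s i) t) =
      xinv (alpha i) * (t - wQ (srefl (alpha i)) t) +
      (xinv (alpha i) + xinv (- alpha i)) * wQ (s i) t - wQ (s i) e.
      by rewrite srefl_simple; ring.
    apply: regB => //; last exact: r_s.
    apply: regD => //; first exact: reg_diff.
    by rewrite cE; apply: regM => //; [apply: reg_loc|apply: r_s].
  have -> : xinv (alpha i) * (p - wQ (s i) q) + xinv (alpha i) * (q - wQ (s i) p) =
      xinv (alpha i) * ((p + q) - wQ (srefl (alpha i)) (p + q)).
    by rewrite srefl_simple rmorphD; ring.
  exact: reg_diff.
have [ai|/eqP ai] := eqVneq a (alpha i); first by rewrite ai srefl_simple.
have [ani|/eqP ani] := eqVneq a (- alpha i).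
  have -> : srefl a = s i.
    rewrite -(srefl_simple Lam i) ani /srefl raddfN rootrefl_opp //.
    exact: rroot_alpha.
  have [y1 y2] := simple; rewrite ani; split; apply/reg_opp => //.
  have [c ->] := root_varN_dvd F (alpha i).
  rewrite rmorphM mulrAC; apply: regM => //; exact: reg_loc.
have rxi : reg a (xinv (alpha i)).
  apply: reg_xinv => // E; first by apply: ai.
  by apply: ani; rewrite E opprK.
have rsa := real_root_act (s i) ra.
have aK : act (s i) (act (s i) a) = a by rewrite -actM s_sq act1.
have [y1 y2] := ry a v ra; have [z1 z2] := ry (act (s i) a) (s i * v)%g rsa.
rewrite !cf_demazure_elt mulrCA -mulrDr; split; apply: regM => //.
  rewrite mulrBr; apply: regB => //.
  have -> : iota (x a) * wQ (s i) (cf (s i * v)%g y) =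
      wQ (s i) (iota (x (act (s i) a)) * cf (s i * v)%g y).
    by rewrite rmorphM weyl_Q_loc weyl_S_var aK.
  by rewrite -{1}aK; apply: reg_weyl.
have -> : cf v y - wQ (s i) (cf (s i * v)%g y) +
    (cf (srefl a * v)%g y - wQ (s i) (cf (s i * (srefl a * v))%g y)) =
    (cf v y + cf (srefl a * v)%g y) - wQ (s i) (cf (s i * v)%g y +
      cf (srefl (act (s i) a) * (s i * v))%g y).
  by rewrite srefl_act // s_inv -!mulgA sK rmorphD; ring.
apply: regB => //; rewrite -{1}aK; exact: reg_weyl.
Qed.

Lemma residue_dword I : residue (dword I).
Proof.
elim: I => [|i I IHI]; first by rewrite dword_nil; apply: residue1.
by rewrite dword_cons; apply: residue_elt.
Qed.

End DemazureWords.

(** * Leading coefficients *)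

Section LeadingCoefficients.
Variables (K : realType) (n : nat) (A : generalized_cartan_matrix n).
Variables (D : root_datum K A) (Lam : demazure_lattice D).
Variables (R : comNzRingType) (F : formal_group_law R).
Hypothesis domR : no_zero_divisor R.
Hypothesis charR : forall c : int, c%:~R = 0 :> R -> c = 0.
Local Notation W := (weyl D).
Local Notation L := (lattice Lam).
Local Notation S := (demazure_S Lam F).
Local Notation Q := (demazure_Q Lam F).
Local Notation QW := (demazure_QW Lam F).
Local Notation x := (fga_var F).
Local Notation alpha := (lattice_simple_root Lam).
Local Notation act := (@lattice_act K n A D Lam).
Local Notation wQ := (weyl_Q Lam F).
Local Notation iota := (dloc Lam F).
Local Notation xinv := (@xinv K n A D Lam R F).
Local Notation s := (simple_refl D).
Local Notation len := (@weyl_length K n A D).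
Local Notation wprod := (wprod D).
Local Notation cf := (@tw_coef _ _ wQ).
Local Notation dword := (dword Lam F).
Implicit Types (u v w : W) (a b : L) (i : 'I_n) (I J : seq 'I_n) (y z : QW).

Fixpoint lbinv I : seq L :=
  if I is i :: J then alpha i :: [seq act (s i) b | b <- lbinv J] else [::].

Lemma val_lbinv I : [seq val b | b <- lbinv I] = binv D I.
Proof.
elim: I => //= i I IHI; congr (_ :: _); rewrite -IHI -!map_comp.
exact: eq_map.
Qed.

Lemma mem_lbinv I a : (a \in lbinv I) = (val a \in binv D I).
Proof. by rewrite -val_lbinv mem_map //; apply: val_inj. Qed.

Lemma lbinv_root I a : a \in lbinv I -> real_root a.
Proof. by rewrite mem_lbinv => /binv_root/real_rootP. Qed.

(** One factor for each inversion, with the sign of [- delta_i] in [X_i]. For reduced [I] it depends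
    only on the element [wprod I] ([lead_eq]). *)
Definition lead I : Q := \prod_(b <- lbinv I) - xinv b.

Lemma lead_cons i I : lead (i :: I) = - xinv (alpha i) * wQ (s i) (lead I).
Proof.
rewrite /lead /= big_cons big_map rmorph_prod; congr (_ * _).
rewrite !big_seq; apply: eq_bigr => b /lbinv_root rb.
by rewrite rmorphN weyl_Q_xinv.
Qed.

Lemma lead_eq I J : reduced D I -> reduced D J -> wprod I = wprod J ->
  lead I = lead J.
Proof.
move=> rI rJ E; apply: perm_big.
have := binv_perm rI rJ E; rewrite -!val_lbinv => /perm_map_inj; apply.
exact: val_inj.
Qed.

Lemma reduced_exists w : exists2 I, reduced D I & wprod I = w.
Proof. by have [I sI wE] := lenP w; exists I; rewrite // /reduced -wE. Qed.

Lemma simple_mulK i w : (s i * (s i * w))%g = w.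
Proof. by rewrite mulgA s_sq mul1g. Qed.

(** Multiplication by [X_i] enlarges the support at most by its translate under [s i], which
    [ble_lift] keeps below [s i * wprod I]. *)
Lemma cf_dword_ble I v : reduced D I -> cf v (dword I) <> 0 -> ble v (wprod I).
Proof.
elim: I v => [|i I IHI] v.
  move=> _; rewrite dword_nil tw_coef1; case: eqP => [->|//] _.
  by left; rewrite wprod_nil.
move=> /reduced_cons[rI li]; rewrite dword_cons cf_demazure_elt wprod_cons => cn.
have uw : ble (wprod I) (s i * wprod I)%g.
  rewrite -(rootrefl_simple D i); apply: ble_rootrefl; first exact: rroot_alpha.
  by rewrite rootrefl_simple li.
have [c0|/(IHI _ rI) vu] := EM (cf v (dword I) = 0); last exact: bleT vu uw.
have [c1|/(IHI _ rI)/(ble_lift i)] := EM (cf (s i * v)%g (dword I) = 0).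
  by case: cn; rewrite c0 c1 rmorph0 subr0 mulr0.
by rewrite simple_mulK => -[vu|//]; apply: bleT vu uw.
Qed.

Lemma ble_len u v : ble u v -> u = v \/ (len u < len v)%N.
Proof. by case=> [|/bruhat_lt_len]; [left|right]. Qed.

Lemma cf_dword0 I v : reduced D I -> (len (wprod I) <= len v)%N -> v <> wprod I ->
  cf v (dword I) = 0.
Proof.
move=> rI lv vI; apply: contrapT => /(cf_dword_ble rI)/ble_len[//|].
by rewrite ltnNge lv.
Qed.

Lemma cf_dword_lead I : reduced D I -> cf (wprod I) (dword I) = lead I.
Proof.
elim: I => [|i I IHI]; first by rewrite wprod_nil dword_nil tw_coef1 eqxx /lead big_nil.
move=> /reduced_cons[rI li]; rewrite lead_cons -IHI // wprod_cons dword_cons.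
rewrite cf_demazure_elt simple_mulK cf_dword0 ?li //.
  by rewrite sub0r mulrN mulNr.
by move=> E; move: li; rewrite E; lia.
Qed.

(** Deleting one letter from a reduced word multiplies it by a reflection on the
    left; the coefficient of the result does not depend on the word. *)
Lemma cf_dword_sub I J b : reduced D I -> reduced D J ->
  real_root b -> vpos (val b) -> wprod I = (srefl b * wprod J)%g ->
  len (wprod I) = (len (wprod J)).+1 -> cf (wprod J) (dword I) = xinv b * lead J.
Proof.
elim: I J b => [|i I IHI] J b; first by rewrite wprod_nil len1.
move=> /reduced_cons[rI li] rJ rb pb; rewrite wprod_cons => wE; rewrite li => -[luv].
rewrite dword_cons cf_demazure_elt.
have rvb : rroot (val b) by apply/real_rootP.
have [bi|/eqP bi] := eqVneq (val b) (simple_root D i).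
  have bE : b = alpha i by apply: val_inj.
  have uv : wprod I = wprod J.
    by rewrite -(simple_mulK i (wprod I)) wE bE srefl_simple simple_mulK.
  rewrite -uv cf_dword_lead // cf_dword0 ?li //; last by move=> E; move: li; rewrite E; lia.
  by rewrite rmorph0 subr0 bE (lead_eq rI rJ uv).
have vu : wprod J <> wprod I.
  move=> uv; apply: bi; apply: rootrefl_eq_simple => //.
  by move: wE; rewrite uv => /(congr1 (fun t => t * (wprod I)^-1)%g); rewrite !mulgK.
rewrite cf_dword0 ?luv // sub0r.
have vE : len (rootrefl (val b) * wprod J)%g = (len (wprod J)).+1.
  by rewrite -[rootrefl (val b)]/(srefl b) -wE li luv.
(* If [s i] lengthened [wprod J], [rootrefl_cover] would give [b = alpha i]. So it shortens it, and
   induction applies to [s i * wprod J] and the root [s_i(b)]. *)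
have [lv|lv] := len_mull i (wprod J).
  case: bi; apply: (rootrefl_cover (v := wprod J)) => //; first by rewrite lv.
  by rewrite vE -[rootrefl (val b)]/(srefl b) -wE simple_mulK luv.
have [T rT tE] := reduced_exists (s i * wprod J)%g.
have vT : wprod (i :: T) = wprod J by rewrite wprod_cons tE simple_mulK.
have riT : reduced D (i :: T) by rewrite /reduced vT lv -tE /= rT.
have rsb := real_root_act (s i) rb.
rewrite -tE (IHI T (act (s i) b)) //.
- rewrite -(lead_eq riT rJ vT) lead_cons rmorphM weyl_Q_xinv //.
  by rewrite -actM s_sq act1; ring.
- exact: vpos_s.
- by rewrite srefl_act // s_inv tE -!mulgA simple_mulK -wE simple_mulK.
- by rewrite tE luv lv.
Qed.

(** Complement of [cf_dword_sub]: together they determine the coefficients at all elements of length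
    one less. *)
Lemma cf_dword_sub0 I v : reduced D I ->
  (forall b, real_root b -> vpos (val b) -> wprod I <> (srefl b * v)%g) ->
  len (wprod I) = (len v).+1 -> cf v (dword I) = 0.
Proof.
elim: I v => [|i I IHI] v; first by rewrite wprod_nil len1.
move=> /reduced_cons[rI li]; rewrite wprod_cons => vb; rewrite li => -[luv].
rewrite dword_cons cf_demazure_elt.
have ri := real_root_simple Lam i.
have vu : v <> wprod I.
  by move=> vE; apply: (vb _ ri (vpos_root D i)); rewrite srefl_simple vE.
rewrite cf_dword0 ?luv // sub0r.
have [lv|lv] := len_mull i v.
  rewrite cf_dword0 ?rmorph0 ?oppr0 ?mulr0 //; first by rewrite luv lv.
  by move=> E; move: lv; rewrite E; lia.
rewrite IHI ?rmorph0 ?oppr0 ?mulr0 //; last by rewrite luv lv.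
move=> b rb pb E; have rsb := real_root_act (s i) rb.
have E' : (s i * wprod I)%g = (srefl (act (s i) b) * v)%g.
  by rewrite E srefl_act // s_inv -!mulgA.
(* [s_i(b)] may be negative; its opposite has the same reflection. *)
have [pos|neg] := rroot_posneg (proj1 (real_rootP _) rsb); first exact: vb E'.
apply: (vb (- act (s i) b)); [exact: real_root_opp|by rewrite raddfN|].
by rewrite E' /srefl raddfN rootrefl_opp //; apply/real_rootP.
Qed.

(** In these lengths the coefficient is [lead], 0, or the one given by [cf_dword_sub], all
    independent of the word. This is the origin of the bound by [len w - 2] in the theorem. *)
Lemma cf_dword_eq I J v : reduced D I -> reduced D J -> wprod I = wprod J ->
  (len (wprod I) <= (len v).+1)%N -> cf v (dword I) = cf v (dword J).
Proof.
move=> rI rJ E; rewrite leq_eqVlt => /predU1P[lv|]; last first.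
  rewrite ltnS => lv; have [->|/eqP vI] := eqVneq v (wprod I).
    by rewrite {2}E !cf_dword_lead //; apply: lead_eq.
  by rewrite !cf_dword0 // -E.
have [T rT tE] := reduced_exists v.
have [[b [rb [pb wE]]]|nb] := EM (exists b, real_root b /\ vpos (val b) /\
    wprod I = (srefl b * v)%g).
  by rewrite -tE in wE lv *; rewrite !(cf_dword_sub (b := b)) // -E.
have nb' b : real_root b -> vpos (val b) -> wprod I <> (srefl b * v)%g.
  by move=> rb pb wE; apply: nb; exists b.
by rewrite !cf_dword_sub0 // -E.
Qed.

(** With [P] the inverse of [lead I], it suffices that [cf v y * P] be regular at each positive root
    [a]. At an inversion, the factor [x a] of [P] absorbs the simple pole; elsewhere [srefl a * v]
    is longer than [v], its coefficient is 0, and the coefficient at [v], of opposite residue, is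
    regular. *)
Lemma cf_top I v y : residue y -> reduced D I -> wprod I = v ->
  (forall u, (len v < len u)%N -> cf u y = 0) -> exists t, cf v y = iota t * lead I.
Proof.
move=> ry rI vE y0; pose P := \prod_(b <- lbinv I) - iota (x b).
have PK : P * lead I = 1.
  rewrite /P /lead -big_split big_seq big1 // => b /lbinv_root rb.
  by rewrite /= mulrNN mulrC xinvK.
have regP r a : real_root a -> reg a (\prod_(b <- r) - iota (x b)).
  move=> ra; apply: (big_ind (reg a)) => [|p q|b _].
  - by rewrite -(rmorph1 iota); apply: reg_loc.
  - exact: regM.
  - by apply: regN => //; apply: reg_loc.
have [a /positive_rootP[ra pa]|t tE] := reg_everywhere domR charR (q := cf v y * P).
  have [y1 y2] := ry a v ra; rewrite /P.
  have [aI|aI] := boolP (a \in lbinv I).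
    rewrite (big_rem a aI) /= mulrA mulrN mulNr [cf v y * _]mulrC.
    by apply: regN => //; apply: regM => //; apply: regP.
  apply: regM => //; last exact: regP.
  have [[_ lt]|[na _]] := rootrefl_len v (proj1 (real_rootP a) ra) pa.
    by rewrite (y0 (srefl a * v)%g lt) addr0 in y2.
  case/negP: aI; rewrite mem_lbinv; apply/(binvP _ rI).
  rewrite vE.
  by split; [exact: proj1 (real_rootP a) ra|exact: pa|exact: na].
by exists t; rewrite -tE -mulrA PK mulr1.
Qed.

End LeadingCoefficients.

(** * Expansion *)

Section Expansion.
Variables (K : realType) (n : nat) (A : generalized_cartan_matrix n).
Variables (D : root_datum K A) (Lam : demazure_lattice D).
Variables (R : comNzRingType) (F : formal_group_law R).
Hypothesis domR : no_zero_divisor R.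
Hypothesis charR : forall c : int, c%:~R = 0 :> R -> c = 0.
Local Notation W := (weyl D).
Local Notation S := (demazure_S Lam F).
Local Notation QW := (demazure_QW Lam F).
Local Notation wQ := (weyl_Q Lam F).
Local Notation len := (@weyl_length K n A D).
Local Notation wprod := (wprod D).
Local Notation cf := (@tw_coef _ _ wQ).
Local Notation dword := (dword Lam F).
Implicit Types (u v w : W) (y : QW).

Variable Iv : W -> seq 'I_n.
Hypothesis Iv_reduced : forall v, reduced D (Iv v).
Hypothesis IvE : forall v, wprod (Iv v) = v.

Lemma cf_scaled_dword v t w :
  cf v (S_to_QW t * dword (Iv w)) = dloc Lam F t * cf v (dword (Iv w)).
Proof. exact: tw_coef_scalar. Qed.

(** Induction on a strict bound [k] for the lengths in the support, the top length being removed by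
    [cf_top]. The lower set [T] carries the Bruhat condition along; the sum is over a list, as
    supports are finite while [W] need not be. *)
Lemma residue_expansion (T : W -> Prop) k y :
  (forall u v, ble u v -> T v -> T u) -> residue y ->
  (forall v, cf v y <> 0 -> T v /\ (len v < k)%N) ->
  exists (p : W -> S) (r : seq W), [/\ uniq r, forall v, v \in r -> T v /\ (len v < k)%N &
    y = \sum_(v <- r) S_to_QW (p v) * dword (Iv v)].
Proof.
move=> Tle; elim: k y => [|k IHk] y ry yT.
  exists (fun _ => 0), [::]; split=> //; rewrite big_nil; apply: tw_coefP => v.
  by rewrite tw_coef0; apply: contrapT => /yT[].
pose M := [seq v <- (msupp (y : {malg _[W]}) : seq W) | len v == k].
have MP v : v \in M -> cf v y <> 0 /\ len v = k.
  by rewrite mem_filter => /andP[/eqP ? ]; rewrite -mcoeff_neq0 => /eqP.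
have uM : uniq M by apply/filter_uniq/fset_uniq.
have /choice[t tP] v : exists t, v \in M -> cf v y = dloc Lam F t * lead Lam F (Iv v).
  have [vM|vM] := boolP (v \in M); last by exists 0.
  have [_ lv] := MP v vM; have [u lu|t tE] := cf_top domR charR ry (Iv_reduced v) (IvE v).
    by apply: contrapT => /yT[_]; lia.
  by exists t.
pose y' := y - \sum_(v <- M) S_to_QW (t v) * dword (Iv v).
have cfy' u : cf u y' = cf u y - \sum_(v <- M) dloc Lam F (t v) * cf u (dword (Iv v)).
  by rewrite tw_coefB tw_coef_sum; congr (_ - _); apply: eq_bigr => v _; apply: cf_scaled_dword.
have [||p [r [ur rP y'E]]] := IHk y'.
- apply: residueB => //; elim: (M) => [|v N IHN]; first by rewrite big_nil; apply: residue0.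
  rewrite big_cons; apply: residueD => //; apply: residueS => //.
  exact: residue_dword.
- move=> u; rewrite cfy' => un0.
  (* Among elements of length at least [k], the term of [v] meets only [v] itself, so the
     subtraction clears length [k] and creates nothing above. *)
  have cf0 v : v \in M -> (k <= len u)%N -> u <> v -> cf u (dword (Iv v)) = 0.
    by move=> /MP[_ lv] ku uv; apply: cf_dword0; rewrite ?IvE ?lv.
  have Tu : T u.
    have [yu|/yT[]//] := EM (cf u y = 0).
    (* [u] is then in the support of some subtracted term, hence below an element of [M], which
       satisfies [T]. *)
    apply: contrapT => nT; apply: un0; rewrite yu big_seq big1 ?subr0 // => v vM.
    have [vu|/(cf_dword_ble (Iv_reduced v))] := EM (cf u (dword (Iv v)) = 0).
      by rewrite vu mulr0.
    rewrite IvE => uv; case: nT; apply: Tle uv _.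
    by have [/yT[]] := MP v vM.
  split=> //; rewrite ltnNge; apply/negP => ku; apply: un0.
  have [uM'|uM'] := boolP (u \in M).
    rewrite (bigD1_seq u) //= big_seq_cond big1 ?addr0 => [|v /andP[vM /eqP vu]].
      by rewrite -{3}(IvE u) cf_dword_lead // tP // subrr.
    by rewrite cf0 ?mulr0 // => uv; apply: vu.
  rewrite big_seq big1 ?subr0 => [|v vM].
    apply: contrapT => yu; case/negP: uM'; rewrite mem_filter.
    have [_ luk] := yT u yu; rewrite -mcoeff_neq0; apply/andP; split; last exact/eqP.
    by rewrite eqn_leq ku -ltnS luk.
  by rewrite cf0 ?mulr0 // => uv; case/negP: uM'; rewrite uv.
exists (fun v => if len v == k then t v else p v), (r ++ M); split.
- rewrite cat_uniq ur uM andbT; apply/hasPn => v /MP[_ lv].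
  by apply/negP => /rP[_]; rewrite lv ltnn.
- move=> v; rewrite mem_cat => /orP[/rP[Tv lv]|/MP[/yT//]].
  by split=> //; apply: ltnW.
have -> : y = y' + \sum_(v <- M) S_to_QW (t v) * dword (Iv v) by rewrite subrK.
rewrite y'E big_cat; apply: (f_equal2 (fun a b : QW => a + b)).
  apply: eq_big_seq => v /rP[_].
  by rewrite ltn_neqAle => /andP[/negbTE->].
by apply: eq_big_seq => v /MP[_ ->]; rewrite eqxx.
Qed.

End Expansion.

Lemma val_demazure_word (K : realType) (n : nat) (A : generalized_cartan_matrix n)
    (D : root_datum K A) (Lam : demazure_lattice D) (R : comNzRingType)
    (F : formal_group_law R) (I : seq 'I_n) :
  val (demazure_word Lam F I) = dword Lam F I.
Proof.
rewrite /demazure_word /dword; elim: I => [|i I IHI]; first by rewrite !big_nil.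
by rewrite !big_cons -IHI.
Qed.

Lemma intr_eq0_pchar0 (R : idomainType) : [pchar R] =i pred0 ->
  forall c : int, c%:~R = 0 :> R -> c = 0.
Proof.
move=> /pcharf0P R0.
have R0' k : k%:R = 0 :> R -> k = 0%N by move=> /eqP; rewrite R0 => /eqP.
case=> k; first by move=> /R0' ->.
by rewrite NegzE mulrNz => /eqP; rewrite oppr_eq0 => /eqP/R0'.
Qed.

Theorem corollary4p4 (R : idomainType) (charR : [pchar R] =i pred0)
  (F : formal_group_law R)
  (K : realType) (n : nat) (A : generalized_cartan_matrix n)
  (D : root_datum K A) (Lam : demazure_lattice D)
  (Iv : weyl D -> seq 'I_n) (Iv_reduced : forall v, reduced_word v (Iv v))
  (w : weyl D) (Iw Iw' : seq 'I_n)
  (Iw_reduced : reduced_word w Iw) (Iw'_reduced : reduced_word w Iw') :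
  exists p : weyl D -> demazure_S Lam F,
    demazure_word Lam F Iw - demazure_word Lam F Iw' =
    \sum_(v \in [set v | bruhat_lt v w /\ (weyl_length v + 2 <= weyl_length w)%N])
       demazure_scalar (p v) * demazure_word Lam F (Iv v).
Proof.
have domR : no_zero_divisor R.
  by move=> a b /eqP; rewrite mulf_eq0 => /orP[/eqP|/eqP]; [left|right].
have char0 := intr_eq0_pchar0 charR.
have red v I : reduced_word v I -> reduced D I /\ wprod D I = v.
  by move=> [vE sI]; rewrite /reduced /wprod -vE.
have [rI IE] := red _ _ Iw_reduced; have [rI' IE'] := red _ _ Iw'_reduced.
pose T v := bruhat_lt v w /\ (weyl_length v + 2 <= weyl_length w)%N.
have Tle u v : ble u v -> T v -> T u.
  move=> [->//|uv] [vw lv]; split; first exact: Relation_Operators.t_trans uv vw.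
  by have := bruhat_lt_len uv; lia.
pose y := dword Lam F Iw - dword Lam F Iw'.
have yT v : tw_coef v y <> 0 -> T v /\ (weyl_length v < weyl_length w)%N.
  (* In lengths at least [weyl_length w - 1] both words have the same coefficients; below, one of
     the two coefficients is nonzero, which gives the Bruhat relation. *)
  rewrite tw_coefB => yv; have [lv|lv] := leqP (weyl_length w) (weyl_length v).+1.
    by case: yv; apply/eqP; rewrite subr_eq0; apply/eqP/cf_dword_eq; rewrite // IE.
  suff [vw|vw] : ble v w; [by rewrite vw in lv; lia| |].
    by split; [split=> //; lia|lia].
  have [c0|] := EM (tw_coef v (dword Lam F Iw) = 0); last first.
    by move=> /(cf_dword_ble rI); rewrite IE.
  have [c1|] := EM (tw_coef v (dword Lam F Iw') = 0); last first.
    by move=> /(cf_dword_ble rI'); rewrite IE'.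
  by case: yv; rewrite c0 c1 subrr.
have ry : residue y by apply: residueB => //; apply: residue_dword.
have [p [r [ur rT yE]]] := residue_expansion domR char0
  (fun v => proj1 (red _ _ (Iv_reduced v))) (fun v => proj2 (red _ _ (Iv_reduced v)))
  Tle ry yT.
(* The value 0 off the list [r] gives the sum over the set finite support and reduces it to the
   list. *)
exists (fun v => if v \in r then p v else 0).
rewrite -(fsbig_widen [set` r]); first last.
- move=> v /= [_ /negP/negbTE ->]; have -> : demazure_scalar (0 : demazure_S Lam F) = 0.
    by apply: val_inj; rewrite /= /S_to_QW rmorph0; exact: monalgU0.
  exact: mul0r.
- by move=> v /= /rT[].
rewrite -fsbig_seq //; apply: val_inj.
transitivity y; first by rewrite /y -!val_demazure_word.
rewrite yE; apply/esym; apply: etrans (raddf_sum val _ _ _) _.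
by apply: eq_big_seq => v vr; rewrite vr -val_demazure_word.
Qed.
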